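(* For arbitrary integral domains $R_1$ and $R_2$ (in the sense given in the context) the categories $\textup{mod-}R_1$ and $\textup{mod-}R_2$ are elementarily equivalent if and only if the structures $\langle \mathrm{Cn},R_1\rangle$ and $\langle \mathrm{Cn},R_2\rangle$ are equivalent in the logic $L_2$.
   Context: The ambient set theory is NBG (von Neumann--Bernays--G\''odel, with choice). $\mathrm{Cn}$ is the class of all cardinal numbers (initial ordinals; a cardinal is identified with the set of smaller ordinals). Rings are associative with unit. In this paper a ring is called an integral domain if it has no zero divisors and each of its ideals is principal (generated by one element); ideals are understood as submodules of the ring regarded as a left module over itself. $\textup{mod-}R$ is the category of all left $R$-modules and all homomorphisms. The first order language of category theory has variables for objects and for morphisms, equality, and expressions for ''$f\in \mathrm{Mor}(X,Y)$'', ''$h=f\circ g$'' and ''$f=1_X$''. Two categories are elementarily equivalent if the same sentences of this language hold in both. The second-order logic $L_2$ of the structure $\langle \mathrm{Cn},\mathsf{ring}\rangle$ (where $\mathsf{ring}$ stands for a ring, with its operations $+$ and $\cdot$): formulas are built by the logical connectives from: quantifiers $\forall r\in\mathsf{ring}$, $\exists r\in \mathsf{ring}$; quantifiers $\forall\varkappa\in\mathrm{Cn}$, $\exists\varkappa\in\mathrm{Cn}$; quantifiers $\forall\alpha\in\varkappa$, $\exists\alpha\in\varkappa$, where $\varkappa$ is a free or previously introduced cardinal variable; atomic formulas $r_1=r_2+r_3$, $r_1=r_2\cdot r_3$, $r_1=r_2$, $\varkappa_1=\varkappa_2$, $\alpha_1=\alpha_2$; quantifiers $\forall$, $\exists$ over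 predicate variables $P_{\varkappa_1,\dots,\varkappa_k}(c_1,\dots,c_k;v_1,\dots,v_n)$, where $\varkappa_1,\dots,\varkappa_k$ are free or previously introduced cardinal variables, ranging over arbitrary relations $P\subseteq \varkappa_1\times\dots\times\varkappa_k\times \mathsf{ring}^n$; and atomic formulas $P_{\varkappa_1,\dots,\varkappa_k}(\alpha_1,\dots,\alpha_k;r_1,\dots,r_n)$ with $\alpha_i\in\varkappa_i$, $r_j\in \mathsf{ring}$. Structures $\langle \mathrm{Cn},R\rangle$ and $\langle \mathrm{Cn},S\rangle$ are equivalent in $L_2$ if the same sentences of this language are true in both. *)

(* Defs.v *)
From mathcomp Require Import all_boot all_algebra.
From mathcomp Require Import wochoice.

Set Implicit Arguments.
Unset Strict Implicit.
Unset Printing Implicit Defensive.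
Import GRing.Theory.
Local Open Scope ring_scope.

(* A set is a type in the universe of the carriers of lmodType, which          *)
(* mathcomp makes equal to the universe of the carriers of pzRingType; proper  *)
(* classes (all modules, all ordinals) live above it. With the classical       *)
(* axioms of boolp, quantifying over boolean predicates is quantifying over    *)
(* all subsets.                                                                *)

(* Neither commutativity nor 1 != 0 is assumed. *)
Definition is_integral_domain (R : pzRingType) : Prop :=
  (forall a b : R, a * b = 0 -> a = 0 \/ b = 0) /\
  (forall I : {pred R^o}, GRing.submod_closed I ->
     exists a : R, forall x : R, x \in I <-> exists r : R, x = r * a).

(* Bound variables are de Bruijn indices: index 0 is the variable introduced   *)
(* by the innermost quantifier of its sort.                                    *)
Definition env_cons (T : Type) (n : nat) (x : T) (e : 'I_n -> T)
    (i : 'I_n.+1) : T :=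
  let: Ordinal k lt_kn := i in
  match k return k < n.+1 -> T with
  | 0 => fun _ => x
  | k'.+1 => fun lt_k'n => e (Ordinal (lt_k'n : k' < n))
  end%N lt_kn.

(* A category as a structure for the two-sorted language: isMor f X Y is       *)
(* "f \in Mor(X, Y)", isComp h f g is "h = f o g" (f after g), and isId f X is *)
(* "f = 1_X".                                                                  *)
Record cat_structure := CatStructure {
  Ob : Type;
  Mor : Type;
  isMor : Mor -> Ob -> Ob -> Prop;
  isComp : Mor -> Mor -> Mor -> Prop;
  isId : Mor -> Ob -> Prop
}.

(* Formulas with n free object variables and m free morphism variables. *)
Inductive cat_formula (n m : nat) : Type :=
| CatEqOb (X Y : 'I_n)
| CatEqMor (f g : 'I_m)
| CatMor (f : 'I_m) (X Y : 'I_n)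
| CatComp (h f g : 'I_m)
| CatId (f : 'I_m) (X : 'I_n)
| CatNot (p : cat_formula n m)
| CatAnd (p q : cat_formula n m)
| CatOr (p q : cat_formula n m)
| CatImp (p q : cat_formula n m)
| CatAllOb (p : cat_formula n.+1 m)
| CatExOb (p : cat_formula n.+1 m)
| CatAllMor (p : cat_formula n m.+1)
| CatExMor (p : cat_formula n m.+1).

Fixpoint cat_holds (C : cat_structure) n m (p : cat_formula n m)
    (eo : 'I_n -> Ob C) (em : 'I_m -> Mor C) : Prop :=
  match p with
  | CatEqOb X Y => eo X = eo Y
  | CatEqMor f g => em f = em g
  | CatMor f X Y => isMor (em f) (eo X) (eo Y)
  | CatComp h f g => isComp (em h) (em f) (em g)
  | CatId f X => isId (em f) (eo X)
  | CatNot p => ~ cat_holds p eo em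
  | CatAnd p q => cat_holds p eo em /\ cat_holds q eo em
  | CatOr p q => cat_holds p eo em \/ cat_holds q eo em
  | CatImp p q => cat_holds p eo em -> cat_holds q eo em
  | CatAllOb p => forall X : Ob C, cat_holds p (env_cons X eo) em
  | CatExOb p => exists X : Ob C, cat_holds p (env_cons X eo) em
  | CatAllMor p => forall f : Mor C, cat_holds p eo (env_cons f em)
  | CatExMor p => exists f : Mor C, cat_holds p eo (env_cons f em)
  end.

Definition no_var (T : Type) (i : 'I_0) : T :=
  match notF (ltn_ord i) with end.

Definition cat_true (C : cat_structure) (p : cat_formula 0 0) : Prop :=
  cat_holds p (@no_var (Ob C)) (@no_var (Mor C)).

Definition elementarily_equivalent (C D : cat_structure) : Prop :=
  forall p : cat_formula 0 0, cat_true C p <-> cat_true D p.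

Record mod_arrow (R : pzRingType) := ModArrow {
  mod_dom : lmodType R;
  mod_cod : lmodType R;
  mod_map : {linear mod_dom -> mod_cod}
}.

Definition mod_isMor (R : pzRingType) (f : mod_arrow R) (X Y : lmodType R) :=
  mod_dom f = X /\ mod_cod f = Y.

Definition mod_isComp (R : pzRingType) (h f g : mod_arrow R) : Prop :=
  exists (X Y Z : lmodType R) (u : {linear Y -> Z}) (v : {linear X -> Y}),
    [/\ f = ModArrow u, g = ModArrow v &
        h = @ModArrow R X Z (u \o v)].

Definition mod_isId (R : pzRingType) (f : mod_arrow R) (X : lmodType R) : Prop :=
  f = @ModArrow R X X idfun.

Definition mod_cat (R : pzRingType) : cat_structure :=
  @CatStructure (lmodType R) (mod_arrow R)
    (@mod_isMor R) (@mod_isComp R) (@mod_isId R).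

(* The carrier lives in the universe of the carriers of modules, so that the   *)
(* ordinals are exactly the order types of sets.                               *)
Record woset := WOSet {
  wo_car : Type@{GRing.Lmodule.axioms_.u0};
  wo_le : rel wo_car;
  wo_leP : well_order wo_le
}.

Definition wo_lt (w : woset) (x y : wo_car w) : Prop := wo_le x y /\ x <> y.

Definition wo_iso (v w : woset) : Prop :=
  exists2 f : wo_car v -> wo_car w,
    bijective f & forall x y, wo_le (f x) (f y) = wo_le x y.

(* v is isomorphic to the initial segment of w strictly below some z. *)
Definition wo_iso_segment (v w : woset) : Prop :=
  exists (z : wo_car w) (f : wo_car v -> wo_car w),
    [/\ injective f,
        forall x y, wo_le (f x) (f y) = wo_le x y &
        forall y, wo_lt y z <-> exists x, f x = y].

(* Ordinals are order types, i.e. isomorphism classes of well-ordered sets. *)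
Record ordnum := OrdNum {
  order_type : woset -> Prop;
  order_typeP : exists w, forall v, order_type v <-> wo_iso v w
}.

Definition ord_lt (a b : ordnum) : Prop :=
  exists v w, [/\ order_type a v, order_type b w & wo_iso_segment v w].

Definition equipotent (a b : ordnum) : Prop :=
  exists v w, [/\ order_type a v, order_type b w &
    exists f : wo_car v -> wo_car w, bijective f].

Definition is_cardinal (k : ordnum) : Prop :=
  forall a, ord_lt a k -> ~ equipotent a k.

(* Sort of a predicate variable P_{k_1,...,k_k}(c_1,...,c_k; v_1,...,v_n), the *)
(* k_i being among c cardinal variables.                                       *)
Record pvar_sort (c : nat) := PVarSort {
  oarity : nat;
  ocards : 'I_oarity -> 'I_c;
  rarity : nat
}.

Arguments ocards {c} s i : rename.

Definition shift_pvar_sort (c : nat) (s : pvar_sort c) : pvar_sort c.+1 :=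
  PVarSort (fun i => lift ord0 (ocards s i)) (rarity s).

(* Formulas with c free cardinal, o free ordinal, r free ring and p free       *)
(* predicate variables; so i is the cardinal variable bounding the i-th        *)
(* ordinal variable and sp j the sort of the j-th predicate variable.          *)
Inductive L2_formula (c o r p : nat)
    (so : 'I_o -> 'I_c) (sp : 'I_p -> pvar_sort c) : Type :=
| L2AddR (x y z : 'I_r)
| L2MulR (x y z : 'I_r)
| L2EqR (x y : 'I_r)
| L2EqC (k l : 'I_c)
| L2EqO (a b : 'I_o)
| L2App (P : 'I_p)
    (al : 'I_(oarity (sp P)) -> 'I_o) (xs : 'I_(rarity (sp P)) -> 'I_r)
    (sort_al : forall i, so (al i) = ocards (sp P) i)
| L2Not (q : @L2_formula c o r p so sp)
| L2And (q1 q2 : @L2_formula c o r p so sp)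
| L2Or (q1 q2 : @L2_formula c o r p so sp)
| L2Imp (q1 q2 : @L2_formula c o r p so sp)
| L2AllR (q : @L2_formula c o r.+1 p so sp)
| L2ExR (q : @L2_formula c o r.+1 p so sp)
| L2AllC (q : @L2_formula c.+1 o r p (fun i => lift ord0 (so i))
                (fun j => shift_pvar_sort (sp j)))
| L2ExC (q : @L2_formula c.+1 o r p (fun i => lift ord0 (so i))
               (fun j => shift_pvar_sort (sp j)))
| L2AllO (k : 'I_c) (q : @L2_formula c o.+1 r p (env_cons k so) sp)
| L2ExO (k : 'I_c) (q : @L2_formula c o.+1 r p (env_cons k so) sp)
| L2AllP (s : pvar_sort c) (q : @L2_formula c o r p.+1 so (env_cons s sp))
| L2ExP (s : pvar_sort c) (q : @L2_formula c o r p.+1 so (env_cons s sp)).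

Arguments L2App {c o r p so sp} P al xs sort_al.
Arguments L2AllO {c o r p so sp} k q.
Arguments L2ExO {c o r p so sp} k q.
Arguments L2AllP {c o r p so sp} s q.
Arguments L2ExP {c o r p so sp} s q.

Definition ord_ring_rel (R : Type) (k n : nat) : Type :=
  ('I_k -> ordnum) -> ('I_n -> R) -> Prop.

Definition pvar_rel (R : Type) (c : nat) (s : pvar_sort c) : Type :=
  ord_ring_rel R (oarity s) (rarity s).

(* P is contained in K_1 x ... x K_k x R^n, a cardinal being the set of        *)
(* smaller ordinals.                                                           *)
Definition rel_within (R : Type) (k n : nat) (K : 'I_k -> ordnum)
    (P : ord_ring_rel R k n) : Prop :=
  forall a x, P a x -> forall i, ord_lt (a i) (K i).

Definition penv_cons (R : Type) (c p : nat) (s : pvar_sort c)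
    (sp : 'I_p -> pvar_sort c) (P : pvar_rel R s)
    (ep : forall j, pvar_rel R (sp j)) (i : 'I_p.+1) :
    pvar_rel R (env_cons s sp i) :=
  let: Ordinal k lt_kp := i in
  match k return
    forall lt_kp : k < p.+1, pvar_rel R (env_cons s sp (Ordinal lt_kp))
  with
  | 0 => fun _ => P
  | k'.+1 => fun lt_k'p => ep (Ordinal (lt_k'p : k' < p))
  end%N lt_kp.

Fixpoint L2_holds (R : pzRingType) (c o r p : nat)
    (so : 'I_o -> 'I_c) (sp : 'I_p -> pvar_sort c) (q : L2_formula r so sp)
    (ec : 'I_c -> ordnum) (eo : 'I_o -> ordnum) (er : 'I_r -> R)
    (ep : forall j, pvar_rel R (sp j)) : Prop :=
  match q with
  | L2AddR x y z => er x = er y + er z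
  | L2MulR x y z => er x = er y * er z
  | L2EqR x y => er x = er y
  | L2EqC k l => ec k = ec l
  | L2EqO a b => eo a = eo b
  | L2App P al xs _ => ep P (fun i => eo (al i)) (fun i => er (xs i))
  | L2Not q => ~ L2_holds q ec eo er ep
  | L2And q1 q2 => L2_holds q1 ec eo er ep /\ L2_holds q2 ec eo er ep
  | L2Or q1 q2 => L2_holds q1 ec eo er ep \/ L2_holds q2 ec eo er ep
  | L2Imp q1 q2 => L2_holds q1 ec eo er ep -> L2_holds q2 ec eo er ep
  | L2AllR q => forall x : R, L2_holds q ec eo (env_cons x er) ep
  | L2ExR q => exists x : R, L2_holds q ec eo (env_cons x er) ep
  | L2AllC q =>
      forall k, is_cardinal k -> L2_holds q (env_cons k ec) eo er ep
  | L2ExC q =>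
      exists2 k, is_cardinal k & L2_holds q (env_cons k ec) eo er ep
  | L2AllO k q =>
      forall a, ord_lt a (ec k) -> L2_holds q ec (env_cons a eo) er ep
  | L2ExO k q =>
      exists2 a, ord_lt a (ec k) & L2_holds q ec (env_cons a eo) er ep
  | L2AllP s q =>
      forall P : pvar_rel R s, rel_within (fun i => ec (ocards s i)) P ->
        L2_holds q ec eo er (penv_cons P ep)
  | L2ExP s q =>
      exists2 P : pvar_rel R s, rel_within (fun i => ec (ocards s i)) P &
        L2_holds q ec eo er (penv_cons P ep)
  end.

Definition L2_sentence :=
  L2_formula 0 (@no_var 'I_0) (@no_var (pvar_sort 0)).

Definition L2_true (R : pzRingType) (q : L2_sentence) : Prop :=
  L2_holds q (@no_var ordnum) (@no_var ordnum) (@no_var R)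
    (fun j => match notF (ltn_ord j) with end).

(* Equivalence of the structures <Cn, R> and <Cn, S>. *)
Definition L2_equivalent (R S : pzRingType) : Prop :=
  forall q : L2_sentence, L2_true R q <-> L2_true S q.

(* Main.v *)
(* From the category to the logic: the ideals being principal and R without    *)
(* zero divisors, a generator that is a retract of all generators is a copy of *)
(* R, so the ring is recovered as the endomorphisms of a definable object. A   *)
(* set B is coded by a tuple of arrows between free modules such that the      *)
(* endomorphisms of R^(B) compatible with the endomorphisms commuting with the *)
(* tuple are diagonal; the basis vectors of R^(B) are then the normalized      *)
(* arrows R -> R^(B) fixed or killed by every such idempotent. The tuple is    *)
(* built from a coloured system of ladders on a successor cardinal, where      *)
(* Fodor's lemma ensures that every function is bounded along some ladder of   *)
(* each colour. Relations between sets are coded by arrows from a further set, *)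
(* which interprets the second-order logic of <Cn, R>.                         *)
(*                                                                             *)
(* Conversely, modules whose carrier is a cardinal, and the graphs of linear   *)
(* maps between them, are relations of the logic L2. With an idle cardinal     *)
(* added as a tag, every such module has infinitely many isomorphic copies,    *)
(* as every module has in mod-R, so a back-and-forth argument shows that these *)
(* modules form a category elementarily equivalent to mod-R.                   *)
Require Import Defs.
From HB Require Import structures.
From mathcomp Require Import all_boot all_algebra.
From mathcomp Require Import boolp wochoice.
From mathcomp Require classical_sets.
From Stdlib Require List.

Set Implicit Arguments.
Unset Strict Implicit.
Unset Printing Implicit Defensive.
Import GRing.Theory.
Local Open Scope ring_scope.

(** * Isomorphic copies of a module *)

(** Sentences of each language are translated into the other by a recipe that does not depend on the
    ring; equivalence then transfers in both directions ([cat_to_L2] and [L2_to_cat]).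

    From [L2] to arrows, for a nonzero ring [R]: the module [R] is a separator and a retract of
    every separator ([generator_regular]), and any module with this property is free on one element
    ([generator_free]). Fix such an [X]. Arrows from [X] to [M] are the elements of [M], arrows from
    [X] to [X] are the elements of the ring, and their sum is read off a biproduct ([sum_arrowP]).
    The crux is to single out, by finitely many arrows, a basis of a free module R^(B), which has
    many other bases. On a successor cardinal above [B] there are ladders of order type omega
    coloured by [B], stationarily many of each colour ([coloured_ladders]). An endomorphism
    compatible with the arrows built from these ladders is diagonal on R^(B) ([code_eigen]); in the
    absence of zero divisors a compatible idempotent therefore fixes or kills each basis vector
    ([code_idem]). The projections on single coordinates are compatible, so no other normalised
    vector has this property ([code_points]). Thus arbitrary sets and relations become parameters of
    first-order formulas ([coded_set], [coded_rel]), cardinals are coded as well-ordered sets not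
    equipotent to a proper initial segment ([isCardP]), and [interpret] translates [L2] by induction
    on formulas. Zero rings are recognised by [trivial_sentence] and are all equivalent by
    [trivial_L2].

    From arrows to [L2]: a module whose carrier is a cardinal is given by relations, and so is the
    graph of a linear map between two such modules. The category [kcat] of these objects is
    therefore interpreted in [L2] ([cat_interpret]). It is equivalent to mod-R as a category, but
    the language sees equality of objects, hence also the number of isomorphic copies. In both
    categories every object has infinitely many copies, so a finite matching of objects can always
    be extended, and a back-and-forth argument gives elementary equivalence ([back_and_forth],
    [kcat_equivalent]). *)

Record moddata (R : pzRingType) := ModData {
  md_car : Type;
  md_zero : md_car;
  md_opp : md_car -> md_car;
  md_add : md_car -> md_car -> md_car;
  md_scale : R -> md_car -> md_car;
  md_addA : associative md_add;
  md_addC : commutative md_add;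
  md_add0 : left_id md_zero md_add;
  md_addN : left_inverse md_zero md_opp md_add;
  md_scaleA : forall a b v, md_scale a (md_scale b v) = md_scale (a * b) v;
  md_scale1 : left_id 1 md_scale;
  md_scaleDr : right_distributive md_scale md_add;
  md_scaleDl : forall v a b,
    md_scale (a + b) v = md_add (md_scale a v) (md_scale b v)
}.

(* The choice structure is part of an lmodType: making its search fail before  *)
(* stage k yields infinitely many distinct modules on the same data.           *)
Definition delayed_find (T : Type) (k : nat) (P : pred T) (n : nat) : option T :=
  if (n < k)%N then None else
  if pselect (exists x, P x) is left ex then Some (sval (cid ex)) else None.

Lemma delayed_find_mixin (T : Type) (k : nat) : hasChoice T.
Proof.
apply: (@hasChoice.Build T (@delayed_find T k)) => [P n x|P exP|P Q /funext->//].
  rewrite /delayed_find; case: ifP => // _; case: pselect => // ex [<-].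
  exact: (svalP (cid ex)).
by exists k; rewrite /delayed_find ltnn; case: pselect.
Defined.

Section Mkmod.
Variables (R : pzRingType) (k : nat) (D : moddata R).

(** The vacuous redex makes the type depend on [k], so that the instances below are indexed by [k]
    while the carrier stays convertible to that of [D]. *)
Definition mkmod_car : Type := (fun _ : nat => md_car D) k.
HB.instance Definition _ := gen_eqMixin mkmod_car.
HB.instance Definition _ : hasChoice mkmod_car := delayed_find_mixin (md_car D) k.
HB.instance Definition _ := GRing.isZmodule.Build mkmod_car
  (@md_addA R D) (@md_addC R D) (@md_add0 R D) (@md_addN R D).
HB.instance Definition _ := GRing.Zmodule_isLmodule.Build R mkmod_car
  (@md_scaleA R D) (@md_scale1 R D) (@md_scaleDr R D) (@md_scaleDl R D).
Definition mkmod : lmodType R := mkmod_car.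
End Mkmod.

(** An invariant of the structure itself rather than of its isomorphism class. It recovers [k] from
    [mkmod k D], so modules with different delays are distinct. *)
Definition find_delay (R : pzRingType) (M : lmodType R) (k : nat) : Prop :=
  isSome (find_subdef (xpredT : pred M) k) /\ forall n, (n < k)%N ->
    find_subdef (xpredT : pred M) n = None.

Lemma mkmod_delay (R : pzRingType) k (D : moddata R) : find_delay (mkmod k D) k.
Proof.
rewrite /find_delay /find_subdef /= /delayed_find; split=> [|n ->//].
by rewrite ltnn; case: pselect => // -[]; exists (md_zero D).
Qed.

Lemma find_delay_inj (R : pzRingType) (M : lmodType R) k l :
  find_delay M k -> find_delay M l -> k = l.
Proof.
move=> [kS kN] [lS lN]; case: (ltngtP k l) => // lt.
  by move: kS; rewrite lN.
by move: lS; rewrite kN.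
Qed.

Definition data_of (R : pzRingType) (M : lmodType R) : moddata R :=
  @ModData R M 0 -%R +%R *:%R (@addrA M) (@addrC M) (@add0r M) (@addNr M)
   (@scalerA R M) (@scale1r R M) (@scalerDr R M) (fun v a b => scalerDl v a b).

Section Copy.
Variables (R : pzRingType) (M : lmodType R) (k : nat).
Definition to_copy (x : M) : mkmod k (data_of M) := x.
Lemma to_copy_linear : linear to_copy. Proof. by []. Qed.
HB.instance Definition _ := GRing.isLinear.Build R M (mkmod k (data_of M)) _ to_copy to_copy_linear.
Definition of_copy (x : mkmod k (data_of M)) : M := x.
Lemma of_copy_linear : linear of_copy. Proof. by []. Qed.
HB.instance Definition _ := GRing.isLinear.Build R (mkmod k (data_of M)) M _ of_copy of_copy_linear.
End Copy.

(** * Free modules *)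

Section FreeModule.
Variables (R : pzRingType) (J : Type).
Local Notation I := {classic J}.

Definition supported (f : I -> R) (s : seq I) := forall i, f i != 0 -> i \in s.
Definition fcar := {f : I -> R | exists s, supported f s}.
Implicit Types x y : fcar.

Lemma fcar_ext x y : sval x =1 sval y -> x = y.
Proof. by case: x y => [f fP] [g gP] /= /funext; apply: eq_exist. Qed.

Definition fcar0 : fcar.
Proof. by exists (fun=> 0); exists [::] => i; rewrite eqxx. Defined.

Definition fcar_opp x : fcar.
Proof.
exists (fun i => - sval x i); case: x => f [s fs]; exists s => i /=.
by rewrite oppr_eq0; apply: fs.
Defined.

Definition fcar_add x y : fcar.
Proof.
exists (fun i => sval x i + sval y i); case: x y => f [s fs] [g [t gt]].
exists (s ++ t) => i /=; rewrite mem_cat; apply: contraNT.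
by rewrite negb_or => /andP[/(contraNT (@fs _))/eqP-> /(contraNT (@gt _))/eqP->];
  rewrite addr0.
Defined.

Definition fcar_scale (a : R) x : fcar.
Proof.
exists (fun i => a * sval x i); case: x => f [s fs]; exists s => i /= ne.
by apply: fs; apply: contraNneq ne => ->; rewrite mulr0.
Defined.

Definition free_data : moddata R.
Proof.
apply: (@ModData R fcar fcar0 fcar_opp fcar_add fcar_scale).
- by move=> x y z; apply: fcar_ext => i /=; rewrite addrA.
- by move=> x y; apply: fcar_ext => i /=; rewrite addrC.
- by move=> x; apply: fcar_ext => i /=; rewrite add0r.
- by move=> x; apply: fcar_ext => i /=; rewrite addNr.
- by move=> a b x; apply: fcar_ext => i /=; rewrite mulrA.
- by move=> x; apply: fcar_ext => i /=; rewrite mul1r.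
- by move=> a x y; apply: fcar_ext => i /=; rewrite mulrDr.
- by move=> x a b; apply: fcar_ext => i /=; rewrite mulrDl.
Defined.

Definition free : lmodType R := mkmod 0 free_data.

Definition coef (i : J) (x : free) : R := sval (x : fcar) i.

Definition delta_fcar (i : J) : fcar.
Proof.
exists (fun j => ((i : I) == j)%:R); exists [:: i : I] => j.
by rewrite inE [j == _]eq_sym; case: ((i : I) == j) => //; rewrite eqxx.
Defined.
Definition delta (i : J) : free := delta_fcar i.
Arguments delta : simpl never.

Arguments coef : simpl never.

Lemma coef_delta i : coef i (delta i) = 1.
Proof. by rewrite /coef /= eqxx. Qed.

Lemma coef_delta_ne i j : i <> j -> coef j (delta i) = 0.
Proof. by move=> ne; rewrite /coef /=; case: eqP. Qed.

Lemma coefD i (x y : free) : coef i (x + y) = coef i x + coef i y.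
Proof. by []. Qed.

Lemma coefZ i a (x : free) : coef i (a *: x) = a * coef i x.
Proof. by []. Qed.

Lemma coef0 i : coef i 0 = 0. Proof. by []. Qed.

Lemma coef_sum i T (s : seq T) (F : T -> free) :
  coef i (\sum_(j <- s) F j) = \sum_(j <- s) coef i (F j).
Proof. by elim/big_rec2: _ => [|j y1 y2 _ <-]. Qed.

Lemma free_ext (x y : free) : (forall i, coef i x = coef i y) -> x = y.
Proof. by move=> e; apply: fcar_ext. Qed.

Lemma free_supp (x : free) : {s : seq I | uniq s & forall i : I, coef i x != 0 -> i \in s}.
Proof.
have [s xs] := cid (svalP (x : fcar)).
exists (undup s); first exact: undup_uniq.
by move=> i nz; rewrite mem_undup; apply: xs.
Qed.

Definition supp (x : free) : seq I := s2val (free_supp x).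
Lemma supp_uniq x : uniq (supp x).
Proof. by rewrite /supp; case: free_supp. Qed.

Lemma suppP x (i : I) : coef i x != 0 -> i \in supp x.
Proof. by rewrite /supp; case: free_supp => s /= _; apply. Qed.

(** Both sums reduce to their nonzero terms, which the two duplicate-free lists enumerate up to
    order. This makes [lift_fun] independent of the chosen support. *)
Lemma sum_supported (V : nmodType) (F : I -> V) (s t : seq I) :
    uniq s -> uniq t -> (forall i, F i != 0 -> (i \in s) && (i \in t)) ->
  \sum_(i <- s) F i = \sum_(i <- t) F i.
Proof.
move=> us ut Fst; rewrite (bigID (fun i => F i == 0)) big1 /=; last by move=> i /eqP.
rewrite [RHS](bigID (fun i => F i == 0)) [X in _ = X + _]big1 /=; last by move=> i /eqP.
congr (_ + _); rewrite -!(big_filter _ (fun i => F i != 0)); apply: perm_big.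
apply: uniq_perm => [||i]; rewrite ?filter_uniq // !mem_filter.
by case: (boolP (F i != 0)) => // /Fst/andP[-> ->].
Qed.

Lemma free_sum (x : free) : x = \sum_(i <- supp x) coef i x *: delta i.
Proof.
apply: free_ext => i; move: (i : I) => {}i; rewrite coef_sum.
case: (boolP (i \in supp x)) => si.
  rewrite (bigD1_seq (i : I)) ?supp_uniq //= coefZ coef_delta mulr1 big1 ?addr0 // => j ne.
  by rewrite coefZ coef_delta_ne ?mulr0 //; exact: (elimN eqP ne).
rewrite big_seq big1 => [|j sj].
  by apply/eqP; apply: contraNT si => /suppP.
by rewrite coefZ coef_delta_ne ?mulr0 // => e; rewrite -e sj in si.
Qed.

Lemma free_ind (P : free -> Prop) : P 0 ->
  (forall a i x, P x -> P (a *: delta i + x)) -> forall x, P x.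
Proof.
move=> P0 Pd x; rewrite (free_sum x).
by elim: (supp x) => [|i s IH]; rewrite (big_nil, big_cons) //; apply: Pd.
Qed.

Section Lift.
Variables (M : lmodType R) (m : J -> M).

Definition lift_fun (x : free) : M := \sum_(i <- supp x) coef i x *: m i.

Lemma lift_funE (s : seq I) x : uniq s -> (forall i : I, coef i x != 0 -> i \in s) ->
  lift_fun x = \sum_(i <- s) coef i x *: m i.
Proof.
move=> us xs; apply: sum_supported => // [|i]; first exact: supp_uniq.
have [->|ne _] := eqVneq (coef i x) 0; first by rewrite scale0r eqxx.
by rewrite xs // suppP.
Qed.

Lemma lift_linear : linear lift_fun.
Proof.
move=> a x y; pose s := undup (supp x ++ supp y).
have sx (i : I) : coef i x != 0 -> i \in s by rewrite mem_undup mem_cat => /suppP->.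
have sy (i : I) : coef i y != 0 -> i \in s.
  by rewrite mem_undup mem_cat orbC => /suppP->.
rewrite !(@lift_funE s) ?undup_uniq // => [|i].
  rewrite scaler_sumr -big_split; apply: eq_bigr => i _ /=.
  by rewrite coefD coefZ scalerDl scalerA.
have [x0|/sx//] := eqVneq (coef i x) 0.
have [y0|/sy//] := eqVneq (coef i y) 0.
by rewrite coefD coefZ x0 y0 mulr0 addr0 eqxx.
Qed.
HB.instance Definition _ := GRing.isLinear.Build R free M _ lift_fun lift_linear.
Definition flift : {linear free -> M} := lift_fun.

Lemma flift_delta i : flift (delta i) = m i.
Proof.
rewrite /flift /= (@lift_funE [:: i : I]) ?big_seq1 ?coef_delta ?scale1r // => j.
by rewrite inE; apply: contraNT => ne; rewrite coef_delta_ne // => e; rewrite e eqxx in ne.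
Qed.
End Lift.

Lemma free_eq (M : lmodType R) (f g : {linear free -> M}) :
  (forall i, f (delta i) = g (delta i)) -> f =1 g.
Proof.
move=> e; apply: free_ind => [|a i x IH]; first by rewrite !linear0.
by rewrite !linearP e IH.
Qed.
End FreeModule.

Arguments coef : simpl never.
Arguments delta : simpl never.

(** * Coloured ladder systems *)

Section WellOrder.
Variables (T : Type) (le : rel T).
Hypothesis leP : well_order le.

Definition slt (x y : T) : Prop := le x y /\ x <> y.

Lemma wo_min (P : T -> Prop) : (exists x, P x) ->
  exists m, P m /\ forall y, P y -> le m y.
Proof.
move=> [x Px]; have [|m [[mP mmin] _]] := @leP (fun x => `[< P x >]).
  by exists x; apply/asboolP.
by exists m; split=> [|y Py]; [apply/asboolP | apply: mmin; apply/asboolP].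
Qed.

Lemma wo_refl x : le x x.
Proof. by have [m [->]] := @wo_min (fun y => y = x) (ex_intro _ x erefl); apply. Qed.

Lemma wo_total x y : le x y \/ le y x.
Proof.
have [|m [[->|->] mmin]] := @wo_min (fun z => z = x \/ z = y).
- by exists x; left.
- by left; apply: mmin; right.
- by right; apply: mmin; left.
Qed.

Lemma wo_anti x y : le x y -> le y x -> x = y.
Proof.
move=> xy yx; have [|m [_ mU]] := @leP (fun z => `[< z = x \/ z = y >]).
  by exists x; apply/asboolP; left.
by rewrite -(mU x) ?(mU y) //; split=> [|z /asboolP[->|->]];
  rewrite ?wo_refl //; apply/asboolP; auto.
Qed.

Lemma wo_trans y x z : le x y -> le y z -> le x z.
Proof.
move=> xy yz; have [|m [mP mmin]] := @wo_min (fun t => t = x \/ t = y \/ t = z).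
  by exists x; left.
case: mP => [e|[e|e]]; subst m.
- by apply: mmin; auto.
- by rewrite (wo_anti xy (mmin x _)) //; auto.
- by rewrite (wo_anti (mmin y _) yz) //; auto.
Qed.

Lemma slt_nge x y : ~ le y x -> slt x y.
Proof.
move=> n; split=> [|e]; first by case: (wo_total x y) => // /n.
by apply: n; rewrite e wo_refl.
Qed.

Lemma slt_geF x y : slt x y -> ~ le y x.
Proof. by move=> [xy n] yx; apply/n/wo_anti. Qed.

Lemma le_slt_trans y x z : le x y -> slt y z -> slt x z.
Proof.
move=> xy yz; apply: slt_nge => zx; exact: (slt_geF yz (wo_trans zx xy)).
Qed.

Lemma slt_le_trans y x z : slt x y -> le y z -> slt x z.
Proof.
move=> xy yz; apply: slt_nge => zx; exact: (slt_geF xy (wo_trans yz zx)).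
Qed.

Lemma slt_trans y x z : slt x y -> slt y z -> slt x z.
Proof. by move=> xy [yz _]; apply: slt_le_trans yz. Qed.

Lemma slt_irr x : ~ slt x x.
Proof. by case. Qed.

Lemma slt_total x y : slt x y \/ x = y \/ slt y x.
Proof.
case: (pselect (x = y)) => [|n]; first by auto.
by case: (wo_total x y) => h; [left|right; right]; split=> // e; apply: n.
Qed.
End WellOrder.

Lemma wo_pull (T U : Type) (le : rel U) (h : T -> U) :
  well_order le -> injective h -> well_order (fun x y => le (h x) (h y)).
Proof.
move=> leP hI; apply: antisymmetric_well_order => [x y /andP[xy yx]|A [x Ax]].
  exact: hI (wo_anti leP xy yx).
have [|m [[z [Az <-]] mmin]] := wo_min leP (P := fun y => exists z, z \in A /\ h z = y).
  by exists (h x), x.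
by exists z; split=> // y Ay; apply: mmin; exists y.
Qed.

(** Zorn's lemma gives a maximal partial bijection; if it missed a point on each side, that pair
    could be added. *)
Lemma inj_total (A B : Type) :
  (exists f : A -> B, injective f) \/ (exists f : B -> A, injective f).
Proof.
pose ok (G : classical_sets.set (A * B)) :=
  forall p q, G p -> G q -> (p.1 = q.1 <-> p.2 = q.2).
have [F Fsub Ftot|G [Gok Gmax]] := @classical_sets.Zorn_bigcup (A * B)%type ok.
  move=> p q [X FX Xp] [Y FY Yq].
  case: (Ftot X Y FX FY) => XY; first exact: (Fsub Y FY p q (XY _ Xp) Yq).
  exact: (Fsub X FX p q Xp (XY _ Yq)).
case: (pselect (forall a, exists b, G (a, b))) => [/choice[f fP]|nA].
  by left; exists f => a a' e; apply/(Gok _ _ (fP a) (fP a')).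
case: (pselect (forall b, exists a, G (a, b))) => [/choice[f fP]|nB].
  by right; exists f => b b' e; apply/(Gok _ _ (fP b) (fP b')).
have [a na] := (existsNP _).2 nA; have [b nb] := (existsNP _).2 nB.
case: (Gmax (fun p => G p \/ p = (a, b))).
  split=> [p Gp|/(_ (a, b))]; first by left.
  by move=> /(_ (or_intror erefl)) Gab; apply: na; exists b.
move=> p q [Gp|->] [Gq|->] //=; [exact: Gok| |].
- by case: p Gp => p1 p2 Gp /=; split=> e; subst; [case: na; exists p2|case: nb; exists p1].
- by case: q Gq => q1 q2 Gq /=; split=> e; subst; [case: na; exists q2|case: nb; exists q1].
Qed.

Lemma wo_exists (T : Type) : exists le : rel T, well_order le.
Proof. by have [R RP] := well_ordering_principle {classic T}; exists R. Qed.

(** Well-order the power set of [M]. If some initial segment does not inject into [M], cut at the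
    least such point; otherwise keep the whole power set, which does not inject by Cantor's diagonal
    argument. *)
Lemma hartogs (M : Type) (m0 : M) : exists (L : Type) (le : rel L),
  [/\ well_order le, ~ (exists f : L -> M, injective f) &
      forall a, exists f : L -> M, forall x y, slt le x a -> slt le y a -> f x = f y -> x = y].
Proof.
have [le leP] := wo_exists (M -> bool).
pose P a := exists f : (M -> bool) -> M,
  forall x y, slt le x a -> slt le y a -> f x = f y -> x = y.
case: (pselect (forall a, P a)) => [allP|/(existsNP _).2 /(wo_min leP)[a [na amin]]].
  exists (M -> bool), le; split=> // -[f fI].
  pose D m := ~~ `[< exists X, f X = m /\ X m >].
  have nD : ~ D (f D).
    by move=> /[dup] DD /negP; apply; apply/asboolP; exists D.
  apply: (nD); apply/negP => /asboolP[X [/fI eX DD]]; rewrite eX in DD.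
  exact: nD DD.
pose L := {x | slt le x a}; pose leL (x y : L) := le (sval x) (sval y).
have svI : injective (sval : L -> _) by move=> [x px] [y py] /= e; apply: eq_exist.
exists L, leL; split; first exact: (wo_pull leP svI).
- move=> [g gI]; apply: na.
  exists (fun x => if pselect (slt le x a) is left h then g (exist _ x h) else m0).
  by move=> x y xa ya; case: pselect => // hx; case: pselect => // hy /gI[].
- move=> b; have [f fP] : P (sval b).
    by apply: contrapT => /amin; apply: (slt_geF leP (svalP b)).
  exists (f \o sval) => x y [xb nx] [yb ny] e; apply: (svI); apply: fP => //.
    by split=> // /svI.
  by split=> // /svI.
Qed.

(** * Closed and stationary sets on a successor cardinal *)

Section Ladders.
Variables (M L : Type) (le : rel L).
Hypothesis leP : well_order le.
Local Notation lt := (slt le).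
Hypothesis noinj : ~ (exists f : L -> M, injective f).
Hypothesis seginj : forall a, exists f : L -> M,
  forall x y, lt x a -> lt y a -> f x = f y -> x = y.
Variable J : M * option M -> M.
Hypothesis J_inj : injective J.
Variable N : nat -> M.
Hypothesis N_inj : injective N.

Definition small (I : Type) := exists g : I -> M, injective g.

Lemma small_prod (I I' : Type) : small I -> small I' -> small (I * I').
Proof.
move=> [g gI] [h hI]; exists (fun p => J (g p.1, Some (h p.2))).
by move=> [i i'] [j j'] /= /J_inj[/gI-> /hI->].
Qed.

(** Regularity: were [f] unbounded, each [x] would be determined by an index [i] with [x] at most
    [f i] and by its place in the segment below [f i], which injects [L] into [M]. The value [None]
    marks [x = f i], a point outside that open segment. *)
Lemma bounded_small (I : Type) (f : I -> L) : small I -> exists x, forall i, lt (f i) x.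
Proof.
move=> [g gI]; apply: contrapT => nb; apply: noinj.
have /choice[i iP] x : exists i, le x (f i).
  apply: contrapT => n; apply: nb; exists x => i.
  by apply: slt_nge => // h; apply: n; exists i.
have [e eP] := choice seginj.
pose k x := if pselect (x = f (i x)) is left _ then None else Some (e (f (i x)) x).
exists (fun x => J (g (i x), k x)) => x y /J_inj[/gI exy]; rewrite /k.
case: pselect => hx; case: pselect => hy //; first by rewrite hx exy -hy.
by rewrite -exy => -[/eP]; apply; split=> //; rewrite exy.
Qed.

Lemma small_le c : small {x | le x c}.
Proof.
have [|d /(_ tt) cd] := @bounded_small unit (fun=> c).
  by exists (fun=> N 0) => -[] [].
have [f fP] := seginj d; exists (f \o sval) => -[x px] [y py] /= e.
by apply: eq_exist; apply: fP e; apply: le_slt_trans cd.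
Qed.

Lemma small_nat : small nat. Proof. by exists N. Qed.

(** Closed unbounded sets are represented by functions [u] through their closed points. *)
Definition closed_pt (u : L -> L) d := forall a, lt a d -> lt (u a) d.

Definition is_ladder d (s : nat -> L) :=
  [/\ forall n, lt (s n) (s n.+1), forall n, lt (s n) d &
      forall a, lt a d -> exists n, le a (s n)].

(** Iterate a map [nx] that exceeds the values of [u] at all points up to its argument. The supremum
    of the orbit is closed under [u], and the orbit is a ladder to it. *)
Lemma closed_pt_exists u a0 : exists d,
  [/\ exists s, is_ladder d s, closed_pt u d & lt a0 d].
Proof.
have /choice[nx nxP] c : exists d, lt c d /\ forall a, le a c -> lt (u a) d.
  have [d1 d1P] := bounded_small (fun x : {x | le x c} => sval x) (small_le c).
  have [d2 d2P] := bounded_small (fun x : {x | le x c} => u (sval x)) (small_le c).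
  have c1 := d1P (exist _ c (wo_refl leP c)).
  case: (wo_total leP d1 d2) => d12.
    exists d2; split=> [|a ac]; first exact: slt_le_trans d12.
    exact: (d2P (exist _ a ac)).
  exists d1; split=> // a ac; apply: (slt_le_trans leP) d12.
  exact: (d2P (exist _ a ac)).
pose s n := iter n nx a0.
have [|d [dub dmin]] := wo_min leP (P := fun d => forall n, lt (s n) d).
  exact: bounded_small small_nat.
have scof a : lt a d -> exists n, le a (s n).
  move=> ad; apply: contrapT => n; apply: (slt_geF leP ad); apply: dmin => m.
  by apply: slt_nge => // h; apply: n; exists m.
exists d; split; last exact: (dub 0).
  by exists s; split=> // n; exact: (nxP _).1.
by move=> a /scof[n /(nxP _).2 h]; apply: slt_trans (dub n.+1).
Qed.

Variable lad : L -> nat -> L.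
Hypothesis ladP : forall d, (exists s, is_ladder d s) -> is_ladder d (lad d).

(** Stationarity, among points of cofinality omega, of the set of limits whose ladder has [v] as its
    rung [n]. *)
Definition stationary n v :=
  forall u, exists d, [/\ exists s, is_ladder d s, lad d n = v & closed_pt u d].

(* Fodor's pressing-down argument: if the fibres of every map d |-> lad d n    *)
(* were eventually nonstationary, a common closed point of all the witnesses   *)
(* would contradict the cofinality of its ladder.                              *)
Lemma unbounded_stationary : exists n, forall a, exists v, le a v /\ stationary n v.
Proof.
apply: contrapT => /(forallNP _).2 H.
have /choice[a aP] n : exists a, forall v, le a v -> ~ stationary n v.
  have /(existsNP _).2[a na] := H n.
  by exists a => v av st; apply: na; exists v.
have /choice[U UP] nv : exists u, le (a nv.1) nv.2 ->
    forall d, (exists s, is_ladder d s) -> lad d nv.1 = nv.2 -> ~ closed_pt u d.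
  case: (pselect (le (a nv.1) nv.2)) => [av|]; last by exists id.
  have /(existsNP _).2[u nu] := aP nv.1 nv.2 av.
  by exists u => _ d dl dn dc; apply: nu; exists d.
have [b bP] := bounded_small a small_nat.
(* A diagonal intersection: [u] dominates at [c] every witness [U (n, v)] with [v] up to [c], at
   every argument up to [c]. *)
have /choice[u uP] c : exists e, forall n v x, le v c -> le x c -> lt (U (n, v) x) e.
  have sm := small_prod small_nat (small_prod (small_le c) (small_le c)).
  have [e eP] := bounded_small (fun p : nat * ({x | le x c} * {x | le x c}) =>
    U (p.1, sval p.2.1) (sval p.2.2)) sm.
  by exists e => n v x vc xc; exact: (eP (n, (exist _ v vc, exist _ x xc))).
have [d [dlim dcl bd]] := closed_pt_exists u b.
have [_ lt_d /(_ _ bd)[n bn]] := ladP dlim.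
apply: (UP (n, lad d n) _ d) => //= [|x xd].
  by have [h _] := bP n; apply: wo_trans bn.
have [c [lc xc cd]] : exists c, [/\ le (lad d n) c, le x c & lt c d].
  by case: (wo_total leP (lad d n) x) => h; [exists x|exists (lad d n)]; rewrite !wo_refl.
by apply: slt_trans (dcl c cd) => //; apply: uP.
Qed.
End Ladders.

(** For some [n], the values of rung [n] with a stationary fibre are unbounded. They cannot inject
    into [B], since small families are bounded; so [B] injects into them, and a ladder takes its
    colour from its rung [n]. *)
Lemma coloured_ladders (B : Type) : exists (L : Type) (le : rel L) (S : Type)
    (s : S -> nat -> L) (pt : S -> L) (G : S -> B),
  [/\ well_order le, injective pt, forall x, is_ladder le (pt x) (s x) &
      forall b u, exists x, G x = b /\ closed_pt le u (pt x)].
Proof.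
case: (pselect (exists b : B, True)) => [[b0 _]|nB]; last first.
  have [le leP] := wo_exists B.
  have B0 (b : B) : False by apply: nB; exists b.
  exists B, le, B, (fun b _ => b), id, id; split=> // b; case: (B0 b).
(* Sequences can be paired by interleaving, with slot 0 kept for the tag of the option; constant
   sequences make [B] and [nat] small. *)
pose C := (B + nat)%type; pose M := nat -> C.
pose J (p : M * option M) n : C :=
  if n is m.+1 then
    if odd m then p.1 m./2 else if p.2 is Some v then v m./2 else inr 0%N
  else inr (isSome p.2 : nat).
have J_inj : injective J.
  move=> [u v] [u' v'] e.
  have -> : u = u'.
    apply: funext => k; have := congr1 (fun w : M => w k.*2.+2) e.
    by rewrite /J /= odd_double /= uphalf_double.
  congr (_, _); have := congr1 (fun w : M => w 0) e; rewrite /J /=.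
  case: v v' e => [v|] [v'|] e //= _; congr Some.
  apply: funext => k; have := congr1 (fun w : M => w k.*2.+1) e.
  by rewrite /J /= odd_double /= doubleK.
pose N n : M := fun=> inr n.
have N_inj : injective N by move=> m n /(congr1 (fun w : M => w 0)) [].
have [L [le [leP noinj seginj]]] := hartogs (N 0).
have /choice[lad ladP] d : exists s, (exists s, is_ladder le d s) -> is_ladder le d s.
  case: (pselect (exists s, is_ladder le d s)) => [[s sP]|n]; first by exists s.
  by exists (fun=> d) => /n.
have [n nP] := unbounded_stationary leP noinj seginj J_inj N_inj ladP.
pose U := {v | stationary le lad n v}.
have [h hI] : exists h : B -> U, injective h.
  case: (inj_total B U) => // -[h hI].
  have [|x xP] := bounded_small leP noinj seginj J_inj (sval : U -> L).
    exists (fun v => fun=> inl (h v)) => v w /(congr1 (fun w : M => w 0)) [].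
    exact: hI.
  have [v [xv vS]] := nP x.
  by case: (slt_geF leP (xP (exist _ v vS)) xv).
pose g (v : L) : B := if pselect (exists b, sval (h b) = v) is left e then sval (cid e) else b0.
have gP b : g (sval (h b)) = b.
  rewrite /g; case: pselect => [e|[]]; last by exists b.
  by case: (cid e) => b' /= e'; apply: hI; case: (h b) (h b') e' => ? ? [? ?] /= e';
    apply: eq_exist.
pose S := {d | exists s, is_ladder le d s}.
exists L, le, S, (fun x => lad (sval x)), sval, (fun x => g (lad (sval x) n)).
split=> // [[x px] [y py] /= e|x|b u]; first exact: eq_exist.
  exact: ladP (svalP x).
have [d [dl dn dc]] := svalP (h b) u.
by exists (exist _ d dl); rewrite /= dn gP.
Qed.

(** * The ladder code *)

Lemma wo_ind (T : Type) (le : rel T) (P : T -> Prop) : well_order le ->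
  (forall x, (forall y, slt le y x -> P y) -> P x) -> forall x, P x.
Proof.
move=> leP IH x; apply: contrapT => nPx.
have [|m [nPm mmin]] := wo_min leP (P := fun y => ~ P y); first by exists x.
apply: nPm; apply: IH => y ym; apply: contrapT => /mmin; exact: slt_geF ym.
Qed.

Lemma list_bound (T U : Type) (le : rel U) (u0 : U) (h : T -> U) (s : seq {classic T}) :
  well_order le -> exists m, forall x : {classic T}, x \in s -> le (h x) m.
Proof.
move=> leP; elim: s => [|y s [m mP]]; first by exists u0.
case: (wo_total leP m (h y)) => hy; [exists (h y)|exists m] => x;
  rewrite inE => /orP[/eqP->|/mP] //; first exact: wo_refl.
by move=> xm; apply: wo_trans hy.
Qed.

Lemma lin_free_sum (R : pzRingType) (J : Type) (M : lmodType R) (f : {linear free R J -> M}) x :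
  f x = \sum_(i <- supp x) coef i x *: f (delta R i).
Proof.
by rewrite {1}(free_sum x) linear_sum; apply: eq_bigr => i _; rewrite linearZ.
Qed.

Lemma sum_neq0 (V : nmodType) (I : Type) (s : seq {classic I}) (F : I -> V) :
  \sum_(i <- s) F i != 0 -> exists i, F i != 0.
Proof.
move=> ne; apply: contrapT => n; case/eqP: ne; apply: big1 => i _.
by apply/eqP; apply: contrapT => /negP h; apply: n; exists i.
Qed.

Lemma mul_neq0l (R : pzRingType) (a b : R) : a * b != 0 -> a != 0.
Proof. by apply: contraNneq => ->; rewrite mul0r. Qed.

Section LadderCode.
Variables (R : pzRingType) (B L S : Type) (le : rel L) (s : S -> nat -> L).
Variables (pt : S -> L) (G : S -> B).
Hypothesis leP : well_order le.
Hypothesis pt_inj : injective pt.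
Hypothesis sP : forall x, is_ladder le (pt x) (s x).
Hypothesis GP : forall b u, exists x, G x = b /\ closed_pt le u (pt x).
Hypothesis Rdom : forall a b : R, a * b = 0 -> a = 0 \/ b = 0.
Hypothesis R1 : (1 : R) != 0.
Local Notation lt := (slt le).

(** [codeF] is spanned by one forest per colour: [code_p] drops the head of a list that starts with
    an increase and kills all other nodes, so below a node with head [c] there is a node with each
    smaller head. The roots are the singletons. [codeE] is spanned by the rungs [(x, k)] of the
    ladders, moved up by [code_sh]; [code_s] places a rung at the root it names, in the colour of
    its ladder, and [code_s0] keeps only the bottom rungs, as colours in [codeZ]. *)
Definition codeF := free R (B * seq L).
Definition codeE := free R (S * nat).
Definition codeZ := free R B.

Definition code_p : {linear codeF -> codeF} := flift (fun bl : B * seq L =>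
  if bl.2 is a :: c :: l then
    if pselect (lt a c) is left _ then delta R (bl.1, c :: l) else 0
  else 0 : codeF).
Definition code_sh : {linear codeE -> codeE} :=
  flift (fun xk : S * nat => delta R (xk.1, xk.2.+1) : codeE).
Definition code_s : {linear codeE -> codeF} :=
  flift (fun xk : S * nat => delta R (G xk.1, [:: s xk.1 xk.2]) : codeF).
Definition code_s0 : {linear codeE -> codeZ} :=
  flift (fun xk : S * nat => if xk.2 is 0 then delta R (G xk.1) else 0 : codeZ).

Section Endo.
Variables (fF : {linear codeF -> codeF}) (fE : {linear codeE -> codeE}).
Variable (fZ : {linear codeZ -> codeZ}).
Hypothesis fFp : forall x, fF (code_p x) = code_p (fF x).
Hypothesis fEsh : forall x, fE (code_sh x) = code_sh (fE x).
Hypothesis fFs : forall x, fF (code_s x) = code_s (fE x).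
Hypothesis fZs0 : forall x, fZ (code_s0 x) = code_s0 (fE x).

(* Along code_p the heads strictly increase, so an endomorphism commuting with *)
(* code_p cannot decrease the head of a node.                                  *)
Lemma code_heads c b l b' c' l' :
  coef (b', c' :: l') (fF (delta R (b, c :: l))) != 0 -> le c c'.
Proof.
move: c b l b' c' l'; apply: (wo_ind leP) => c IH b l b' c' l'.
apply: contraNT => /negP/(slt_nge leP) cc'.
have -> : delta R (b, c :: l) = code_p (delta R (b, c' :: c :: l)).
  by rewrite flift_delta /=; case: pselect.
rewrite fFp lin_free_sum coef_sum; apply/negPn/negP => /sum_neq0[[b1 l1]].
rewrite coefZ flift_delta /=; case: l1 => [|a [|d l1]] /=; rewrite ?mulr0 ?eqxx //.
case: pselect => [ad|]; last by rewrite mulr0 eqxx.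
case: (pselect ((b1, d :: l1) = (b', c' :: l'))) => [[_ edc _]|ne]; last first.
  by rewrite coef_delta_ne ?mulr0 ?eqxx.
move=> /mul_neq0l/(IH c' cc') c'a; rewrite edc in ad.
exact: slt_geF ad c'a.
Qed.

(** The image of a root has finite support, hence bounded heads. *)
Lemma root_bound b : exists u : L -> L, forall a b' c,
  coef (b', [:: c]) (fF (delta R (b, [:: a]))) != 0 -> le c (u a).
Proof.
suff /choice[u uP] : forall a, exists m, forall b' c,
  coef (b', [:: c]) (fF (delta R (b, [:: a]))) != 0 -> le c m by exists u.
move=> a; have [m mP] := list_bound a
  (fun bl : B * seq L => head a bl.2) (supp (fF (delta R (b, [:: a])))) leP.
by exists m => b' c h; exact: (mP (b', [:: c]) (suppP h)).
Qed.

Lemma iter_code_sh n x k : iter n code_sh (delta R (x, k)) = delta R (x, (k + n)%N).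
Proof. by elim: n => [|n IH]; rewrite ?addn0 // iterS IH flift_delta addnS. Qed.

Lemma coef_code_s n (y : codeE) b c :
  coef (b, [:: c]) (code_s (iter n code_sh y)) =
  \sum_(xk <- supp y | `[< G xk.1 = b /\ s xk.1 (xk.2 + n) = c >]) coef xk y.
Proof.
have iterD a u v : iter n code_sh (a *: u + v) = a *: iter n code_sh u + iter n code_sh v.
  by elim: n => //= m ->; rewrite linearP.
have -> : code_s (iter n code_sh y) =
    \sum_(xk <- supp y) coef xk y *: delta R (G xk.1, [:: s xk.1 (xk.2 + n)]).
  have iter0 : iter n code_sh 0 = 0 by elim: n {iterD} => //= m ->; rewrite linear0.
  rewrite {1}(free_sum y); elim: (supp y) => [|[x k] r IH].
    by rewrite !big_nil iter0 linear0.
  by rewrite !big_cons iterD linearP IH iter_code_sh flift_delta.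
rewrite coef_sum [RHS]big_mkcond; apply: eq_bigr => -[x k] _; rewrite coefZ /=.
case: asboolP => [[-> ->]|n0].
  by rewrite coef_delta mulr1.
by rewrite coef_delta_ne ?mulr0 // => -[? ?]; apply: n0.
Qed.

Lemma ladder_mono x m n : (m <= n)%N -> le (s x m) (s x n).
Proof.
have [inc _ _] := sP x; move=> /subnKC <-; elim: (n - m)%N => [|k IH].
  by rewrite addn0; apply: wo_refl.
by rewrite addnS; apply: (wo_trans leP) IH _; case: (inc (m + k)%N).
Qed.

Lemma ladder_inj x : injective (s x).
Proof.
have lt_s m n : (m < n)%N -> lt (s x m) (s x n).
  have [inc _ _] := sP x; move=> mn.
  by apply: (slt_le_trans leP) (inc m) _; apply: ladder_mono.
move=> m n e; case: (ltngtP m n) => // /lt_s; rewrite e => h; case: (slt_irr h).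
Qed.

(** A single ladder is injective. For two ladders with different limits, the higher one eventually
    passes the limit of the lower one. *)
Lemma ladder_separate (x1 : S) k1 (p : S * nat) : p <> (x1, k1) ->
  exists n0, forall n, (n0 <= n)%N -> s p.1 (p.2 + n) <> s x1 (k1 + n).
Proof.
case: p => x k /= ne; case: (pselect (x = x1)) => [e|nx].
  exists 0 => n _; rewrite e => /ladder_inj/eqP; rewrite eqn_add2r => /eqP ek.
  by apply: ne; rewrite e ek.
have sep y z (i j : nat) : lt (pt y) (pt z) ->
    exists n0, forall n, (n0 <= n)%N -> s y (i + n) <> s z (j + n).
  have [_ ltz cofz] := sP z => /cofz[n0 yn0]; exists n0 => n n0n e.
  have [_ lty _] := sP y; apply: (slt_geF leP (lty (i + n))).
  rewrite e; apply: (wo_trans leP) yn0 _; apply: ladder_mono.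
  exact: leq_trans n0n (leq_addl _ _).
case: (slt_total leP (pt x) (pt x1)) => [/sep|[/pt_inj//|/sep h]]; first exact.
by have [n0 n0P] := h k1 k; exists n0 => n /n0P ne' e; apply: ne'.
Qed.

(** Far along, the finitely many shifted rungs in [y] occupy other places than the shift of
    [(x1, k1)], so its coefficient can be read at one root. *)
Lemma ladder_eventually (y : codeE) (x1 : S) k1 : exists n0, forall n, (n0 <= n)%N ->
  coef (G x1, [:: s x1 (k1 + n)]) (code_s (iter n code_sh y)) = coef (x1, k1) y.
Proof.
have /choice[N NP] (p : S * nat) : exists n0, p <> (x1, k1) -> forall n, (n0 <= n)%N ->
    s p.1 (p.2 + n) <> s x1 (k1 + n).
  case: (pselect (p = (x1, k1))) => [e|ne]; first by exists 0.
  by have [n0 h] := ladder_separate ne; exists n0.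
exists (\max_(p <- supp y) N p) => n nN; rewrite coef_code_s.
have Np (p : {classic S * nat}) : p \in supp y -> p <> (x1, k1) ->
    s p.1 (p.2 + n) <> s x1 (k1 + n).
  move=> py ne; apply: NP => //; apply: leq_trans nN.
  by rewrite (big_rem p) //= leq_maxl.
have [y0|ny0] := eqVneq (coef (x1, k1) y) 0.
  rewrite y0 big_seq_cond big1 // => p /andP[py /asboolP[_ e]].
  case: (pselect (p = (x1, k1))) => [->//|ne]; by case: (Np p py ne).
rewrite big_mkcond (bigD1_seq ((x1, k1) : {classic S * nat})) ?supp_uniq ?suppP //=.
rewrite asboolT // big_seq_cond big1 ?addr0 // => p /andP[py /eqP ne].
by case: asboolP => // -[_ e]; case: (Np p py ne).
Qed.

(** Take a ladder [x0] of colour [b] whose limit is closed under the bound of [root_bound], and let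
    [y] be the image of its bottom rung. A rung of a ladder [x1] occurring in [y] produces, far
    along, roots in the images of the roots at [s x0 n]. They are not below [s x0 n] by
    [code_heads], and they stay below the limit of [x0] by closedness. So both ladders have the same
    limit and coincide; [code_s0] then retains only the rung [(x0, 0)]. *)
Lemma code_eigen b : exists d, fZ (delta R b) = d *: delta R b.
Proof.
have [u uP] := root_bound b; have [x0 [Gx0 x0u]] := GP b u.
pose y := fE (delta R (x0, 0%N)); exists (coef (x0, 0%N) y).
have eqn n : fF (delta R (b, [:: s x0 n])) = code_s (iter n code_sh y).
  have -> : delta R (b, [:: s x0 n]) = code_s (iter n code_sh (delta R (x0, 0%N))).
    by rewrite iter_code_sh flift_delta /= Gx0.
  by rewrite fFs; congr (code_s _); elim: n => //= n IH; rewrite fEsh IH.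
have only x1 k1 : coef (x1, k1) y != 0 -> x1 = x0.
  move=> nz; have [n0 n0P] := ladder_eventually y x1 k1.
  have low n : (n0 <= n)%N -> le (s x0 n) (s x1 (k1 + n)).
    move=> /n0P e; apply: (@code_heads _ b [::] (G x1) _ [::]).
    by rewrite eqn e.
  have up n : (n0 <= n)%N -> lt (s x1 (k1 + n)) (pt x0).
    move=> /n0P e; apply: (@le_slt_trans _ _ leP (u (s x0 n))).
      by apply: (uP _ (G x1)); rewrite eqn e.
    by apply: x0u; have [_ h _] := sP x0.
  apply: pt_inj; have [_ lt0 cof0] := sP x0; have [_ lt1 cof1] := sP x1.
  case: (slt_total leP (pt x1) (pt x0)) => [/cof0[m m1]|[//|/cof1[m m1]]].
    pose n := maxn n0 m; case: (slt_geF leP (lt1 (k1 + n)%N)).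
    apply: (wo_trans leP) m1 _; apply: (wo_trans leP) (low n (leq_maxl _ _)).
    by apply: ladder_mono; apply: leq_maxr.
  pose n := maxn n0 m; case: (slt_geF leP (up n (leq_maxl _ _))).
  apply: (wo_trans leP) m1 _; apply: ladder_mono.
  by apply: leq_trans (leq_addl _ _); apply: leq_maxr.
have -> : delta R b = code_s0 (delta R (x0, 0%N)) by rewrite flift_delta /= Gx0.
rewrite fZs0 -/y [in RHS]flift_delta [in RHS]/= (lin_free_sum code_s0 y).
have [y0|ny0] := eqVneq (coef (x0, 0%N) y) 0.
  rewrite y0 scale0r big1 // => -[x [|k]] _; rewrite flift_delta ?scaler0 //=.
  have [->|/only ->] := eqVneq (coef (x, 0%N) y) 0; first by rewrite scale0r.
  by rewrite y0 scale0r.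
rewrite (bigD1_seq ((x0, 0%N) : {classic S * nat})) ?supp_uniq ?suppP //.
rewrite flift_delta big1 => [|[x [|k]] ne]; first (by rewrite /= addr0);
  rewrite flift_delta ?scaler0 //=.
have [->|/only e] := eqVneq (coef (x, 0%N) y) 0; first by rewrite scale0r.
by rewrite e eqxx in ne.
Qed.

Lemma code_idem b : (forall z, fZ (fZ z) = fZ z) ->
  fZ (delta R b) = delta R b \/ fZ (delta R b) = 0.
Proof.
move=> idem; have [d dP] := code_eigen b.
have := congr1 (coef b) (idem (delta R b)).
rewrite dP linearZ dP !coefZ coef_delta mulr1 => dd.
have /Rdom[->|/subr0_eq->] : d * (d - 1) = 0; last by left; rewrite scale1r.
  by rewrite mulrBr mulr1 dd subrr.
by right; rewrite scale0r.
Qed.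
End Endo.

Definition code_commute (fF : {linear codeF -> codeF}) (fE : {linear codeE -> codeE})
    (fZ : {linear codeZ -> codeZ}) : Prop :=
  [/\ fF \o code_p =1 code_p \o fF, fE \o code_sh =1 code_sh \o fE,
      fF \o code_s =1 code_s \o fE & fZ \o code_s0 =1 code_s0 \o fE].

Section Block.
Variable b0 : B.
(** The projection on one colour acts compatibly on all three modules; it is the idempotent against
    which candidate basis vectors are tested. *)
Definition blockZ : {linear codeZ -> codeZ} :=
  flift (fun b => if pselect (b = b0) is left _ then delta R b else 0 : codeZ).
Definition blockF : {linear codeF -> codeF} :=
  flift (fun bl : B * seq L => if pselect (bl.1 = b0) is left _ then delta R bl else 0 : codeF).
Definition blockE : {linear codeE -> codeE} :=
  flift (fun xk : S * nat => if pselect (G xk.1 = b0) is left _ then delta R xk else 0 : codeE).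

Lemma block_commute : code_commute blockF blockE blockZ.
Proof.
split.
- apply: (@free_eq _ _ _ (blockF \o code_p) (code_p \o blockF)) => -[b l] /=.
  rewrite !flift_delta /=; case: l => [|a [|c l]]; rewrite ?linear0 ?flift_delta /=;
    try by case: pselect => // ?; rewrite ?flift_delta ?linear0.
  case: pselect => ac; rewrite ?linear0 ?flift_delta /=;
    case: pselect => bb; rewrite ?linear0 ?flift_delta //=;
    by case: pselect.
- apply: (@free_eq _ _ _ (blockE \o code_sh) (code_sh \o blockE)) => -[x k] /=.
  by rewrite !flift_delta /=; case: pselect => e; rewrite ?linear0 ?flift_delta.
- apply: (@free_eq _ _ _ (blockF \o code_s) (code_s \o blockE)) => -[x k] /=.
  by rewrite !flift_delta /=; case: pselect => e; rewrite ?linear0 ?flift_delta.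
- apply: (@free_eq _ _ _ (blockZ \o code_s0) (code_s0 \o blockE)) => -[x [|k]] /=.
    by rewrite !flift_delta /=; case: pselect => e; rewrite ?linear0 ?flift_delta.
  by rewrite !flift_delta linear0; case: pselect => e; rewrite ?linear0 ?flift_delta.
Qed.

Lemma blockZE z : blockZ z = coef b0 z *: delta R b0.
Proof.
apply: (@free_ind R B (fun z => blockZ z = _)) z => [|a i z IH].
  by rewrite linear0 coef0 scale0r.
rewrite linearP IH flift_delta coefD coefZ scalerDl -scalerA; congr (_ + _).
congr (_ *: _); case: pselect => [->|ne]; first by rewrite coef_delta scale1r.
by rewrite coef_delta_ne ?scale0r.
Qed.
End Block.

(** A vector with a nonzero coefficient at [b] is not killed by [blockZ b], hence is fixed by it and
    is a multiple of [delta R b]; since [eps] maps it to [g], the scalar is 1. The converse is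
    [code_idem]. *)
Lemma code_points (X : lmodType R) (g : X) (eps : {linear codeZ -> X}) (z : codeZ) :
    (forall r : R, r *: g = 0 -> r = 0) -> (forall b, eps (delta R b) = g) ->
  (eps z = g /\ forall fF fE fZ, code_commute fF fE fZ -> fZ \o fZ =1 fZ ->
    fZ z = z \/ fZ z = 0) <-> exists b, z = delta R b.
Proof.
move=> gfree epsg; split=> [[ez zP]|[b ->]]; last first.
  split=> // fF fE fZ [fFp fEsh fFs fZs0] fZ2; exact: (code_idem fFp fEsh fFs fZs0).
have [z0|nz] := pselect (z = 0).
  have : (1 : R) *: g = 0 by rewrite scale1r -ez z0 linear0.
  by move=> /gfree/eqP; rewrite (negPf R1).
have [b bz] : exists b, coef b z != 0.
  apply: contrapT => n; apply: nz; apply: free_ext => b; rewrite coef0.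
  by apply/eqP; apply: contrapT => /negP h; apply: n; exists b.
have b2 : blockZ b \o blockZ b =1 blockZ b.
  move=> x /=; rewrite !blockZE coefZ coef_delta mulr1.
  by [].
case: (zP _ _ _ (block_commute b) b2); rewrite blockZE => e; last first.
  by move: bz; rewrite -[coef b z]mulr1 -(coef_delta R b) -coefZ e coef0 eqxx.
exists b; have : (coef b z - 1) *: g = 0.
  by rewrite scalerBl scale1r -{1}(epsg b) -linearZ [X in eps X]e ez subrr.
by move=> /gfree/subr0_eq c1; rewrite -e c1 scale1r.
Qed.
End LadderCode.

(** * Ordinals *)

Lemma wo_iso_refl w : wo_iso w w.
Proof. by exists id => //; exists id. Qed.

Lemma wo_iso_sym v w : wo_iso v w -> wo_iso w v.
Proof.
move=> [f [h fK hK] fle]; exists h; first by exists f.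
by move=> x y; rewrite -fle !hK.
Qed.

Lemma wo_iso_trans u v w : wo_iso u v -> wo_iso v w -> wo_iso u w.
Proof.
move=> [f fb fle] [h hb hle]; exists (h \o f); first exact: bij_comp.
by move=> x y /=; rewrite hle fle.
Qed.

Definition ot (w : woset) : ordnum :=
  @OrdNum (fun v => wo_iso v w) (ex_intro _ w (fun v => iff_refl _)).

Lemma ordnum_ext a b : (forall v, order_type a v <-> order_type b v) -> a = b.
Proof.
case: a b => [A Ap] [B Bp] /= e; have {}e : A = B by apply: funext => v; apply/propext.
by subst B; rewrite (Prop_irrelevance Ap Bp).
Qed.

Lemma ot_eq v w : ot v = ot w <-> wo_iso v w.
Proof.
split=> [e|vw]; last first.
  apply: ordnum_ext => u /=; split=> uv; apply: wo_iso_trans uv _ => //.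
  exact: wo_iso_sym.
by have : order_type (ot v) v by [apply: wo_iso_refl]; rewrite e.
Qed.

Lemma order_type_ot a w : order_type a w <-> a = ot w.
Proof.
have [v vP] := order_typeP a; have -> : a = ot v by apply: ordnum_ext.
by rewrite ot_eq; split; apply: wo_iso_sym.
Qed.

Lemma ord_rep a : exists w, a = ot w.
Proof. by have [v vP] := order_typeP a; exists v; apply: ordnum_ext. Qed.

Definition seg_car (w : woset) (z : wo_car w) := {x : wo_car w | slt (@wo_le w) x z}.
Definition seg_le (w : woset) (z : wo_car w) : rel (seg_car z) :=
  fun x y => wo_le (sval x) (sval y).
Lemma seg_leP (w : woset) (z : wo_car w) : well_order (@seg_le w z).
Proof.
apply: (wo_pull (@wo_leP w)) => -[x px] [y py] /= e; exact: eq_exist.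
Qed.
Definition seg (w : woset) (z : wo_car w) : woset := WOSet (@seg_leP w z).

Lemma seg_ext (w : woset) (z : wo_car w) (x y : wo_car (seg z)) : sval x = sval y -> x = y.
Proof. by case: x y => [x px] [y py] /=; apply: eq_exist. Qed.

Definition in_seg (w : woset) (z x : wo_car w) (h : slt (@wo_le w) x z) :
  wo_car (seg z) := exist _ x h.

Lemma wo_iso_segmentP v w : wo_iso_segment v w <-> exists z, wo_iso v (@seg w z).
Proof.
split=> [[z [f [fI fle fim]]]|[z [f fb fle]]]; exists z.
  have fz x : slt (@wo_le w) (f x) z by apply/fim; exists x.
  pose h x : wo_car (seg z) := exist _ (f x) (fz x).
  exists h => [|x y]; last by rewrite /= /seg_le /= fle.
  have /choice[k kP] (y : wo_car (seg z)) : exists x, f x = sval y.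
    by apply/fim; apply: (svalP y).
  exists k => [x|y]; first by apply: fI; rewrite kP.
  by apply: seg_ext; rewrite /= kP.
exists (fun x => sval (f x)); split=> [x y e|x y|y].
- by apply: (bij_inj fb); apply: seg_ext.
- exact: fle.
- split=> [yz|[x <-]]; last exact: (svalP (f x)).
  by have [k kK fK] := fb; exists (k (exist _ y yz)); rewrite fK.
Qed.

Lemma ord_lt_ot a w : ord_lt a (ot w) <-> exists z : wo_car w, a = ot (seg z).
Proof.
split=> [[v [u [/order_type_ot-> /order_type_ot/ot_eq wu /wo_iso_segmentP[z vz]]]]|[z ->]].
  have [f [h fK hK] fle] := wo_iso_sym wu; exists (f z).
  apply/ot_eq; apply: wo_iso_trans vz _.
  have fz (x : wo_car (seg z)) : slt (@wo_le w) (f (sval x)) (f z).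
    have [xz n] := svalP x; split; first by rewrite fle.
    by move=> /(can_inj fK).
  exists (fun x => exist _ (f (sval x)) (fz x) : wo_car (seg (f z))); last first.
    by move=> x y; rewrite /= /seg_le /= fle.
  have hz (y : wo_car (seg (f z))) : slt (@wo_le u) (h (sval y)) z.
    have [yz n] := svalP y; split; first by rewrite -fle hK.
    by move=> e; apply: n; rewrite -[LHS]hK e.
  exists (fun y => exist _ (h (sval y)) (hz y) : wo_car (seg z)) => x;
    by apply: seg_ext; rewrite /= ?fK ?hK.
exists (seg z), w; split; try exact/order_type_ot.
by apply/wo_iso_segmentP; exists z; apply: wo_iso_refl.
Qed.

(** An isomorphism onto a shorter segment would move some point down; the image of the least such
    point would be moved down as well. *)
Lemma seg_no_iso (w : woset) (z z' : wo_car w) :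
  slt (@wo_le w) z z' -> ~ wo_iso (seg z') (seg z).
Proof.
move=> zz' [f fb fle].
pose P x := exists h : slt (@wo_le w) x z', slt (@wo_le w) (sval (f (in_seg h))) x.
have [|m [[hm mP] mmin]] := wo_min (@wo_leP w) (P := P).
  by exists z, zz'; exact: (svalP (f (in_seg zz'))).
have [h1 h2] := mP; apply: (slt_geF (@wo_leP w) mP); apply: mmin.
have fz := slt_trans (@wo_leP w) mP hm.
exists fz; split; first by move: (fle (in_seg fz) (in_seg hm)); rewrite /= /seg_le /= => ->.
move=> e; have /(bij_inj fb)/(congr1 sval)/= e2 : f (in_seg fz) = f (in_seg hm).
  by apply: seg_ext.
by case: h2.
Qed.

Lemma ot_seg_inj (w : woset) : injective (fun z : wo_car w => ot (seg z)).
Proof.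
move=> z z' /ot_eq e; case: (slt_total (@wo_leP w) z z') => [/seg_no_iso|[//|/seg_no_iso]].
  by case; apply: wo_iso_sym.
by case.
Qed.

Lemma equipotent_ot v w : equipotent (ot v) (ot w) <->
  exists f : wo_car v -> wo_car w, bijective f.
Proof.
split=> [[v' [w' [/order_type_ot/ot_eq[f fb _] /order_type_ot/ot_eq/wo_iso_sym[h hb _]]]]|fb].
  by move=> [k kb]; exists (h \o (k \o f)); exact: (bij_comp hb (bij_comp kb fb)).
by exists v, w; split; try exact/order_type_ot.
Qed.

Lemma is_cardinal_ot w : is_cardinal (ot w) <->
  forall z : wo_car w, ~ exists f : wo_car (seg z) -> wo_car w, bijective f.
Proof.
split=> [c z fb|c a /ord_lt_ot[z ->] /equipotent_ot]; last exact: c.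
by apply: (c (ot (seg z))); [apply/ord_lt_ot; exists z | apply/equipotent_ot].
Qed.

Lemma seg_seg (w : woset) (z : wo_car w) (x : wo_car (seg z)) :
  wo_iso (seg x) (seg (sval x)).
Proof.
have h1 (y : wo_car (seg x)) : slt (@wo_le w) (sval (sval y)) (sval x).
  have [yx n] := svalP y; split=> // e; apply: n; exact: seg_ext.
pose f y : wo_car (seg (sval x)) := exist _ (sval (sval y)) (h1 y).
exists f => //.
have h2 (y : wo_car (seg (sval x))) : slt (@wo_le w) (sval y) z.
  exact: (slt_trans (@wo_leP w) (svalP y) (svalP x)).
have h3 (y : wo_car (seg (sval x))) : slt (@wo_le (seg z)) (in_seg (h2 y)) x.
  by have [yx n] := svalP y; split=> // e; apply: n; rewrite -[in RHS]e.
exists (fun y => in_seg (h3 y)) => y.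
  by apply: seg_ext; apply: seg_ext.
exact: seg_ext.
Qed.

(** In a well-order of [T], take the least point whose initial segment is equipotent to [T], or the
    whole order if there is none. *)
Lemma cardinal_exists (T : Type) : exists w, is_cardinal (ot w) /\
  exists f : T -> wo_car w, bijective f.
Proof.
have [le leP] := wo_exists T; pose w0 := WOSet leP.
case: (pselect (exists z : wo_car w0, exists f : T -> wo_car (seg z), bijective f)); last first.
  move=> n; exists w0; split; last by exists id; exists id.
  by apply/is_cardinal_ot => z [f [h fK hK]]; apply: n; exists z, h; exists f.
move=> /(wo_min (@wo_leP w0))[z [[f fb] zmin]]; exists (seg z); split; last by exists f.
apply/is_cardinal_ot => x [h [k hK kK]].
have [u ub _] := seg_seg x.
apply: (slt_geF (@wo_leP w0) (svalP x)); apply: zmin.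
have kb : bijective k by exists h.
by exists (u \o (k \o f)); exact: (bij_comp ub (bij_comp kb fb)).
Qed.

(** * Definable predicates of arrows *)

Section Arrows.
Variable R : pzRingType.
Implicit Types (X Y Z : lmodType R) (f g h k : mod_arrow R).

Lemma linear_ext X Y (u v : {linear X -> Y}) : u =1 v -> u = v.
Proof.
move=> /funext; case: u => u [[mu] [su]]; case: v => v [[mv] [sv]] /= e; subst v.
by rewrite (Prop_irrelevance mu mv) (Prop_irrelevance su sv).
Qed.

(** Proof irrelevance turns the equality between first components into reflexivity. It serves to
    recover a linear map from its arrow. *)
Lemma existT_inj (A : Type) (P : A -> Type) a (x y : P a) :
  existT P a x = existT P a y -> x = y.
Proof.
have gen (s t : {a : A & P a}) (e : s = t) :
    eq_rect _ P (projT2 s) _ (congr1 (@projT1 A P) e) = projT2 t by case: _ / e.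
by move=> e; have := gen _ _ e; rewrite (Prop_irrelevance (congr1 (@projT1 A P) e) (erefl a)).
Qed.

Lemma arrow_inj X Y (u v : {linear X -> Y}) : ModArrow u = ModArrow v -> u = v.
Proof.
pose P (p : lmodType R * lmodType R) := {linear p.1 -> p.2}.
move=> /(congr1 (fun f => existT P (mod_dom f, mod_cod f) (mod_map f))).
exact: (@existT_inj _ P (X, Y)).
Qed.

Lemma arrow_eqfun X Y (u v : {linear X -> Y}) : ModArrow u = ModArrow v -> u =1 v.
Proof. by move=> /arrow_inj->. Qed.

Lemma arrow_eq X Y (u v : {linear X -> Y}) : u =1 v -> ModArrow u = ModArrow v.
Proof. by move=> /linear_ext->. Qed.

Lemma cmp_arrow X Y Z (u : {linear Y -> Z}) (v : {linear X -> Y}) :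
  mod_isComp (@ModArrow R X Z (u \o v)) (ModArrow u) (ModArrow v).
Proof. by exists X, Y, Z, u, v. Qed.

Lemma cmp_uniq f g h k : mod_isComp h f g -> mod_isComp k f g -> h = k.
Proof.
move=> [X [Y [Z [u [v [ef eg ->]]]]]] [X' [Y' [Z' [u' [v' [ef' eg' ->]]]]]]; subst f g.
have eX := congr1 (@mod_dom R) eg'; have eY := congr1 (@mod_cod R) eg'.
have eZ := congr1 (@mod_cod R) ef'; rewrite /= in eX eY eZ; subst X' Y' Z'.
by rewrite (arrow_inj ef') (arrow_inj eg').
Qed.

Lemma cmpE X Y Z (u : {linear Y -> Z}) (v : {linear X -> Y}) h :
  mod_isComp h (ModArrow u) (ModArrow v) <-> h = @ModArrow R X Z (u \o v).
Proof.
by split=> [/cmp_uniq/(_ (cmp_arrow _ _))//|->]; apply: cmp_arrow.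
Qed.

Lemma cmp_dom h f g : mod_isComp h f g ->
  [/\ mod_cod g = mod_dom f, mod_dom h = mod_dom g & mod_cod h = mod_cod f].
Proof. by move=> [X [Y [Z [u [v [-> -> ->]]]]]]. Qed.

Lemma cmp_invr Y X h f (v : {linear X -> Y}) : mod_isComp h f (ModArrow v) ->
  exists Z (u : {linear Y -> Z}), f = ModArrow u /\ h = @ModArrow R X Z (u \o v).
Proof.
move=> hc; have [/= e _ _] := cmp_dom hc; case: f e hc => Y' Z u /= e; subst Y'.
by move=> /cmpE->; exists Z, u.
Qed.

Lemma cmp_invl Y Z h (u : {linear Y -> Z}) g : mod_isComp h (ModArrow u) g ->
  exists X (v : {linear X -> Y}), g = ModArrow v /\ h = @ModArrow R X Z (u \o v).
Proof.
move=> hc; have [/= e _ _] := cmp_dom hc; case: g e hc => X Y' v /= e; subst Y'.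
by move=> /cmpE->; exists X, v.
Qed.

Definition idA X : mod_arrow R := @ModArrow R X X idfun.

Lemma cmp_idr f X : mod_isComp f f (idA X) <-> mod_dom f = X.
Proof.
split=> [/cmp_dom[/=]//|<-]; case: f => A B u /=; apply/cmpE/arrow_eq => x //.
Qed.

Lemma cmp_idl f X : mod_isComp f (idA X) f <-> mod_cod f = X.
Proof.
split=> [/cmp_dom[/=]//|<-]; case: f => A B u /=; apply/cmpE/arrow_eq => x //.
Qed.

(** Identity arrows stand for objects, so the definable predicates have morphism variables only. *)
Definition isIdA f := exists X, mod_isId f X.
End Arrows.

(* Environments interpret all natural numbers, in de Bruijn order, so that a   *)
(* shift of the variables is a composition with a function.                    *)
Definition push (T : Type) (x : T) (e : nat -> T) (i : nat) : T :=
  if i is j.+1 then e j else x.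

Definition uprop := forall R : pzRingType, (nat -> mod_arrow R) -> Prop.

Definition ordenv (T : Type) (e : nat -> T) n : 'I_n -> T := fun i => e i.
Arguments ordenv {T} e n.

(** One formula serves all rings. Asking for it with every large enough number of free variables
    builds weakening into the notion. *)
Definition definable (P : uprop) : Prop :=
  exists n0, forall n, (n0 <= n)%N -> exists p : cat_formula 0 n, forall R e,
    @cat_holds (mod_cat R) 0 n p (@no_var _) (ordenv e n) <-> P R e.

Lemma env_cons_ordenv (T : Type) n (x : T) (e : nat -> T) :
  env_cons x (ordenv e n) = ordenv (push x e) n.+1.
Proof. by apply: funext => -[[|i] ilt]. Qed.

Lemma no_var_unique (T : Type) (f : 'I_0 -> T) : f = @no_var T.
Proof. by apply: funext => -[]. Qed.

(** * Closure properties of definable predicates *)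

Section Definable.
Implicit Types (P Q : uprop).

Lemma definable_ext P Q : (forall R e, P R e <-> Q R e) -> definable P -> definable Q.
Proof.
by move=> PQ [n0 H]; exists n0 => n /H[p pP]; exists p => R e; rewrite pP PQ.
Qed.

Lemma def_not P : definable P -> definable (fun R e => ~ P R e).
Proof. by move=> [n0 H]; exists n0 => n /H[p pP]; exists (CatNot p) => R e /=; rewrite pP. Qed.

Lemma def_and P Q : definable P -> definable Q -> definable (fun R e => P R e /\ Q R e).
Proof.
move=> [n0 H] [n1 K]; exists (maxn n0 n1) => n; rewrite geq_max => /andP[/H[p pP] /K[q qP]].
by exists (CatAnd p q) => R e /=; rewrite pP qP.
Qed.

Lemma def_or P Q : definable P -> definable Q -> definable (fun R e => P R e \/ Q R e).
Proof.
move=> [n0 H] [n1 K]; exists (maxn n0 n1) => n; rewrite geq_max => /andP[/H[p pP] /K[q qP]].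
by exists (CatOr p q) => R e /=; rewrite pP qP.
Qed.

Lemma def_imp P Q : definable P -> definable Q -> definable (fun R e => P R e -> Q R e).
Proof.
move=> [n0 H] [n1 K]; exists (maxn n0 n1) => n; rewrite geq_max => /andP[/H[p pP] /K[q qP]].
by exists (CatImp p q) => R e /=; rewrite pP qP.
Qed.

Lemma def_iff P Q : definable P -> definable Q -> definable (fun R e => P R e <-> Q R e).
Proof. by move=> dP dQ; apply: def_and; apply: def_imp. Qed.

Lemma def_all (P : forall R, (nat -> mod_arrow R) -> mod_arrow R -> Prop) :
  definable (fun R e => P R (fun i => e i.+1) (e 0)) ->
  definable (fun R e => forall f, P R e f).
Proof.
move=> [n0 H]; exists n0 => n nn0; have [|p pP] := H n.+1; first exact: leqW.
exists (CatAllMor p) => R e /=.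
by split=> h f; move: (h f); rewrite env_cons_ordenv pP.
Qed.

Lemma def_ex (P : forall R, (nat -> mod_arrow R) -> mod_arrow R -> Prop) :
  definable (fun R e => P R (fun i => e i.+1) (e 0)) ->
  definable (fun R e => exists f, P R e f).
Proof.
move=> [n0 H]; exists n0 => n nn0; have [|p pP] := H n.+1; first exact: leqW.
exists (CatExMor p) => R e /=.
by split=> -[f h]; exists f; move: h; rewrite env_cons_ordenv pP.
Qed.

Lemma def_eq i j : definable (fun R e => e i = e j).
Proof.
exists (maxn i j).+1 => n; rewrite gtn_max => /andP[ilt jlt].
by exists (CatEqMor _ (Ordinal ilt) (Ordinal jlt)).
Qed.

Lemma def_cmp i j k : definable (fun R e => mod_isComp (e i) (e j) (e k)).
Proof.
exists (maxn i (maxn j k)).+1 => n; rewrite !gtn_max => /and3P[ilt jlt klt].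
by exists (CatComp _ (Ordinal ilt) (Ordinal jlt) (Ordinal klt)).
Qed.

Lemma def_isId i : definable (fun R e => isIdA (e i)).
Proof.
exists i.+1 => n ilt; exists (CatExOb (CatId (Ordinal ilt) ord0)) => R e.
by [].
Qed.
End Definable.

(** * Points, relations, generators and sums in terms of arrows *)

Section ArrowPredicates.
Variable R : pzRingType.
Implicit Types (a b f g h k l x y : mod_arrow R) (t s : nat -> mod_arrow R).
Local Notation cmp := (@mod_isComp R).

Definition hom a b f := cmp f f a /\ cmp f b f.

(** An arrow that does not distinguish endomorphisms of the generator is zero ([iszero_pt]). *)
Definition iszero a k := forall f g, hom a a f -> hom a a g ->
  exists l, cmp l k f /\ cmp l k g.

(** The two compositions already force [f] and [g] to be endomorphisms of the codomain and of the
    domain of [p] ([squareP]). *)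
Definition square f p g := exists k, cmp k f p /\ cmp k p g.

(* The set coded by t = (p, sh, s, s0, eps), as a set of arrows a -> Z.        *)
Definition point a t x := cmp a (t 4) x /\
  forall fF fE fZ, square fF (t 0) fF -> square fE (t 1) fE ->
    square fF (t 2) fE -> square fZ (t 3) fE -> cmp fZ fZ fZ ->
  cmp x fZ x \/ exists k, cmp k fZ x /\ iszero a k.

(** A relation is coded as the set of its tuples, by five arrows, followed by one coordinate arrow
    for each argument. *)
Definition code_rel (k n : nat) a s (x : 'I_k -> mod_arrow R) (r : 'I_n -> mod_arrow R) :=
  exists y, point a s y /\ ((forall i : 'I_k, cmp (x i) (s (5 + i)%N) y) /\
    forall j : 'I_n, cmp (r j) (s (5 + k + j)%N) y).

Definition rel1 a s x := exists z, point a s z /\ cmp x (s 5) z.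

Definition rel2 a s x y := exists z, point a s z /\ (cmp x (s 5) z /\ cmp y (s 6) z).

Definition separator b := forall a c f h, hom a c f -> hom a c h -> f <> h ->
  exists x k l, cmp x x b /\ (cmp k f x /\ (cmp l h x /\ k <> l)).

Definition generator a := isIdA a /\ (separator a /\
  forall b, isIdA b -> separator b ->
  exists f h, hom a b f /\ (hom b a h /\ cmp a h f)).

(* r1 = r2 + r3, computed through a biproduct of the generator with itself.    *)
Definition sum_arrow a r1 r2 r3 := exists b i1 i2 p1 p2 n c,
  isIdA b /\
  (hom a b i1 /\ (hom a b i2 /\ (hom b a p1 /\ (hom b a p2 /\ (hom a b n /\ hom b a c))))) /\
  ((cmp a p1 i1 /\ (cmp a p2 i2 /\ ((exists z, cmp z p1 i2 /\ iszero a z) /\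
     exists z, cmp z p2 i1 /\ iszero a z))) /\
   ((forall d d' u v, hom a b d -> hom a b d' -> cmp u p1 d -> cmp u p1 d' ->
      cmp v p2 d -> cmp v p2 d' -> d = d') /\
    ((cmp a p1 n /\ cmp a p2 n) /\ (cmp r2 c i1 /\ (cmp r3 c i2 /\ cmp r1 c n))))).
End ArrowPredicates.

Ltac def_step := cbv beta zeta; first
  [ apply: def_eq | apply: def_cmp | apply: def_isId | apply: def_not | apply: def_and
  | apply: def_or | apply: def_all | apply: def_ex | apply: def_imp | apply: def_iff ].

Lemma def_hom i j k : definable (fun R e => hom (e i) (e j) (e k)).
Proof. by rewrite /hom; repeat def_step. Qed.

Lemma def_iszero i j : definable (fun R e => iszero (e i) (e j)).
Proof. by rewrite /iszero; repeat (apply: def_hom || def_step). Qed.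

Lemma def_square i j k : definable (fun R e => square (e i) (e j) (e k)).
Proof. by rewrite /square; repeat def_step. Qed.

Lemma def_point i (t : nat -> nat) j :
  definable (fun R e => point (e i) (fun m => e (t m)) (e j)).
Proof. by rewrite /point; repeat (apply: def_iszero || apply: def_square || def_step). Qed.

Lemma def_forall_ord n (P : 'I_n -> uprop) : (forall i, definable (P i)) ->
  definable (fun R e => forall i, P i R e).
Proof.
elim: n P => [|n IH] P dP.
  apply: (@definable_ext (fun R e => forall f, f = f)) => [R e|]; last by repeat def_step.
  by split=> // _ [].
apply: (@definable_ext (fun R e => P ord0 R e /\ forall i, P (lift ord0 i) R e)).
  move=> R e; split=> [[P0 PS] i|h]; last by split.
  by case: (unliftP ord0 i) => [j|] ->.
by apply: def_and => //; apply: IH.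
Qed.

Lemma def_rel k n i (s : nat -> nat) (x : 'I_k -> nat) (r : 'I_n -> nat) :
  definable (fun R e => @code_rel R k n (e i) (fun m => e (s m)) (fun m => e (x m)) (fun m => e (r m))).
Proof.
rewrite /code_rel; apply: def_ex; apply: def_and; first exact: def_point.
by apply: def_and; apply: def_forall_ord => m; apply: def_cmp.
Qed.

Lemma def_rel1 i (s : nat -> nat) x :
  definable (fun R e => rel1 (e i) (fun m => e (s m)) (e x)).
Proof. by rewrite /rel1; repeat (apply: def_point || def_step). Qed.

Lemma def_rel2 i (s : nat -> nat) x y :
  definable (fun R e => rel2 (e i) (fun m => e (s m)) (e x) (e y)).
Proof. by rewrite /rel2; repeat (apply: def_point || def_step). Qed.

Lemma def_separator i : definable (fun R e => separator (e i)).
Proof. by rewrite /separator; repeat (apply: def_hom || def_step). Qed.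

Lemma def_generator i : definable (fun R e => generator (e i)).
Proof.
by rewrite /generator; repeat (apply: def_hom || apply: def_separator || def_step).
Qed.

Lemma def_sum_arrow i j k l : definable (fun R e => sum_arrow (e i) (e j) (e k) (e l)).
Proof.
by rewrite /sum_arrow; repeat (apply: def_hom || apply: def_iszero || def_step).
Qed.

(** * Coded sets and relations *)

Section FreeGenerator.
Variables (R : pzRingType) (X : lmodType R) (g : X).
Definition free_on := (forall x : X, exists r, x = r *: g) /\ (forall r : R, r *: g = 0 -> r = 0).
Hypothesis gX : free_on.

Definition gcoord (x : X) : R := sval (cid (gX.1 x)).
Lemma gcoordE x : x = gcoord x *: g.
Proof. exact: (svalP (cid (gX.1 x))). Qed.

Lemma gfree r s : r *: g = s *: g -> r = s.
Proof. by move=> e; apply/subr0_eq/gX.2; rewrite scalerBl e subrr. Qed.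

Lemma gcoordK r : gcoord (r *: g) = r.
Proof. by apply: gfree; rewrite -gcoordE. Qed.

Section Pnt.
Variables (M : lmodType R) (m : M).
Definition pnt_fun (x : X) : M := gcoord x *: m.
Lemma pnt_linear : linear pnt_fun.
Proof.
move=> a x y; rewrite /pnt_fun scalerA -scalerDl; congr (_ *: _); apply: gfree.
by rewrite scalerDl -scalerA -!gcoordE.
Qed.
HB.instance Definition _ := GRing.isLinear.Build R X M _ pnt_fun pnt_linear.
Definition pnt : {linear X -> M} := pnt_fun.
Lemma pntE : pnt g = m.
Proof.
by rewrite /pnt /= /pnt_fun -[in gcoord g](scale1r g) gcoordK scale1r.
Qed.
End Pnt.

Lemma gen_eq (M : lmodType R) (u v : {linear X -> M}) : u g = v g -> u =1 v.
Proof. by move=> e x; rewrite (gcoordE x) !linearZ_LR e. Qed.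

(** The dictionary between elements and arrows: every arrow out of [X] is the [pt] of its value at
    [g] ([ptE]). *)
Definition pt (M : lmodType R) (m : M) : mod_arrow R := ModArrow (pnt m).

Lemma ptE (M : lmodType R) (u : {linear X -> M}) : ModArrow u = pt (u g).
Proof. by apply/arrow_eq/gen_eq; rewrite pntE. Qed.

Lemma pt_inj (M : lmodType R) (m m' : M) : pt m = pt m' -> m = m'.
Proof. by move=> /arrow_inj e; rewrite -[m]pntE e pntE. Qed.

Lemma cmp_pt (M N : lmodType R) (u : {linear M -> N}) (m : M) h :
  mod_isComp h (ModArrow u) (pt m) <-> h = pt (u m).
Proof.
rewrite cmpE; have -> : @ModArrow R X N (u \o pnt m) = pt (u m); last by [].
by apply/arrow_eq/gen_eq; rewrite /= !pntE.
Qed.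

Lemma idA_pt : idA X = pt g.
Proof. exact: ptE. Qed.

Lemma cmp_pt_id (M : lmodType R) (u : {linear M -> X}) (m : M) :
  mod_isComp (idA X) (ModArrow u) (pt m) <-> u m = g.
Proof. by rewrite idA_pt cmp_pt; split=> [/pt_inj->|->]. Qed.

Definition rarr (r : R) : mod_arrow R := pt (r *: g).

Lemma rarr_inj : injective rarr.
Proof. by move=> r s /pt_inj/gfree. Qed.

Lemma hom_arrow (A B : lmodType R) f : hom (idA A) (idA B) f <-> exists u : {linear A -> B}, f = ModArrow u.
Proof.
split=> [[/cmp_idr eA /cmp_idl eB]|[u ->]].
  by case: f eA eB => A' B' u /= eA eB; subst; exists u.
by split; [apply/cmp_idr | apply/cmp_idl].
Qed.

Lemma hom_rarr f : hom (idA X) (idA X) f <-> exists r, f = rarr r.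
Proof.
rewrite hom_arrow; split=> [[u ->]|[r ->]]; last by exists (pnt (r *: g)).
by exists (gcoord (u g)); rewrite /rarr -gcoordE ptE.
Qed.

Lemma hom_pt (M : lmodType R) f : hom (idA X) (idA M) f <-> exists m : M, f = pt m.
Proof.
rewrite hom_arrow; split=> [[u ->]|[m ->]]; last by exists (pnt m).
by exists (u g); rewrite ptE.
Qed.

(* Left modules: End(X) is opposite to R. *)
Lemma cmp_rarr f r s : mod_isComp f (rarr r) (rarr s) <-> f = rarr (s * r).
Proof. by rewrite cmp_pt linearZ_LR pntE scalerA. Qed.

Lemma iszero_pt (M : lmodType R) (m : M) : iszero (idA X) (pt m) <-> m = 0.
Proof.
split=> [z|-> u v]; last first.
  move=> /hom_rarr[r ->] /hom_rarr[s ->]; exists (pt (0 : M)).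
  by split; apply/cmp_pt; rewrite linearZ_LR pntE scaler0.
have [||l []] := z (rarr 1) (rarr 0); try by apply/hom_rarr; eexists.
move=> /cmp_pt-> /cmp_pt/pt_inj; rewrite !linearZ_LR !pntE scale1r scale0r.
by [].
Qed.

Lemma squareP (A B : lmodType R) (p : {linear A -> B}) f h :
  square f (ModArrow p) h <-> exists (u : {linear B -> B}) (v : {linear A -> A}),
    [/\ f = ModArrow u, h = ModArrow v & u \o p =1 p \o v].
Proof.
split=> [[k [/cmp_invr[C [u [-> ->]]] /cmp_invl[D [v [-> e]]]]]|[u [v [-> -> uv]]]].
  have [/= eD eC] := (congr1 (@mod_dom R) e, congr1 (@mod_cod R) e); subst C D.
  by exists u, v; split=> //; exact: arrow_eqfun e.
exists (@ModArrow R A B (u \o p)); rewrite !cmpE; split=> //; exact: arrow_eq.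
Qed.

Lemma square_arrow (A B : lmodType R) (p : {linear A -> B}) (u : {linear B -> B})
  (v : {linear A -> A}) : square (ModArrow u) (ModArrow p) (ModArrow v) <-> u \o p =1 p \o v.
Proof.
rewrite squareP; split=> [[u' [v' [/arrow_inj-> /arrow_inj-> //]]]|h].
by exists u, v.
Qed.

Section Coded.
Hypothesis Rdom : forall a b : R, a * b = 0 -> a = 0 \/ b = 0.
Hypothesis R1 : (1 : R) != 0.

Lemma coded_set (B : Type) : exists t : nat -> mod_arrow R,
  forall x, point (idA X) t x <-> exists b, x = pt (delta R b : free R B).
Proof.
have [L [le [S [s [lim [G [leP limI sP GP]]]]]]] := coloured_ladders B.
pose eps : {linear codeZ R B -> X} := flift (fun=> g).
have epsg b : eps (delta R b) = g by rewrite flift_delta.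
exists (fun i => match i with
  | 0 => ModArrow (code_p R B le) | 1 => ModArrow (code_sh R S)
  | 2 => ModArrow (code_s R s G) | 3 => ModArrow (code_s0 R G)
  | _ => ModArrow eps end)%N => x.
have CP := @code_points R B L S le s lim G leP limI sP GP Rdom R1 X g eps _ gX.2 epsg.
(* The squares fix the endpoints of the quantified arrows, so this clause of [point] amounts to the
   clause of [code_points] about linear maps. *)
have key (z : codeZ R B) : (forall fF fE fZ, square fF (ModArrow (code_p R B le)) fF ->
      square fE (ModArrow (code_sh R S)) fE -> square fF (ModArrow (code_s R s G)) fE ->
      square fZ (ModArrow (code_s0 R G)) fE -> mod_isComp fZ fZ fZ ->
      mod_isComp (pt z) fZ (pt z) \/
        exists k, mod_isComp k fZ (pt z) /\ iszero (idA X) k) <->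
    forall fF fE fZ, code_commute le s G fF fE fZ -> fZ \o fZ =1 fZ ->
    fZ z = z \/ fZ z = 0.
  split=> h.
    move=> fF fE fZ [c1 c2 c3 c4] fZ2.
    have [|||||/cmp_pt/pt_inj e|[k [/cmp_pt-> /iszero_pt->]]] :=
      h (ModArrow fF) (ModArrow fE) (ModArrow fZ); [exact/square_arrow..| | |by right].
      by apply/cmpE/arrow_eq => y; exact/esym/fZ2.
    by left.
  move=> fF' fE' fZ' /squareP[fF [_ [-> /arrow_inj <- c1]]].
  move=> /squareP[fE [_ [-> /arrow_inj <- c2]]] /square_arrow c3.
  move=> /squareP[fZ [_ [-> /arrow_inj <- c4]]] /cmpE/arrow_eqfun fZ2.
  have [e|e] : fZ z = z \/ fZ z = 0.
  - by apply: (h fF fE); [split | move=> y; exact/esym/fZ2].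
  - by left; apply/cmp_pt; rewrite e.
  - by right; exists (pt (0 : codeZ R B)); split; [apply/cmp_pt; rewrite e|apply/iszero_pt].
split=> [[/= + H]|[b ->]].
  move=> /cmp_invl[A [v [ex e]]].
  have /= eA := congr1 (@mod_dom R) e; subst A; move: H; rewrite ex ptE => H.
  have [b ->] : exists b, v g = delta R b.
    apply/CP; split; first by have /= <- := arrow_eqfun e g.
    by apply/key.
  by exists b.
have [e H] := (CP (delta R b)).2 (ex_intro _ b erefl).
by split; [rewrite /= idA_pt; apply/cmp_pt; rewrite e | apply/key].
Qed.

(** The tuples in [P] form a set, coded as the basis of a free module; a coordinate is a linear map
    with prescribed values on that basis. *)
Lemma coded_rel k n (Z : 'I_k -> lmodType R) (P : (forall i, Z i) -> ('I_n -> R) -> Prop) :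
  exists s, forall x r, code_rel (idA X) s x r <->
    exists z c, [/\ P z c, forall i, x i = pt (z i) & forall j, r j = rarr (c j)].
Proof.
pose B := {zc : (forall i, Z i) * ('I_n -> R) | P zc.1 zc.2}.
have [t tP] := coded_set B.
pose s m := if (m < 5)%N then t m else
  if insub (m - 5)%N is Some i then
    ModArrow (flift (fun b : B => (sval b).1 i) : {linear free R B -> _})
  else if insub (m - 5 - k)%N is Some j then
    ModArrow (flift (fun b : B => (sval b).2 j *: g) : {linear free R B -> X})
  else t 0.
have sl (i : 'I_k) : s (5 + i)%N =
    ModArrow (flift (fun b : B => (sval b).1 i) : {linear free R B -> _}).
  by rewrite /s ltnNge leq_addr /= addKn valK.
have sr (j : 'I_n) : s (5 + k + j)%N =
    ModArrow (flift (fun b : B => (sval b).2 j *: g) : {linear free R B -> X}).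
  rewrite /s ltnNge -addnA leq_addr /= addKn insubN; first by rewrite addKn valK.
  by rewrite -leqNgt leq_addr.
exists s => x r; rewrite /code_rel; split.
  move=> [y [/tP[b ->] [hx hr]]]; exists (sval b).1, (sval b).2.
  split=> [|i|j]; first exact: (svalP b).
  - by have := hx i; rewrite sl => /cmp_pt->; rewrite flift_delta.
  - by have := hr j; rewrite sr => /cmp_pt->; rewrite flift_delta.
move=> [z [c [Pzc hx hr]]]; pose b : B := exist _ (z, c) Pzc.
exists (pt (delta R b : free R B)); split; first by apply/tP; exists b.
by split=> [i|j]; rewrite ?sl ?sr; apply/cmp_pt; rewrite flift_delta.
Qed.

Lemma coded_rel2 (Z1 Z2 : lmodType R) (P : Z1 -> Z2 -> Prop) : exists s, forall x y,
  rel2 (idA X) s x y <-> exists z1 z2, [/\ P z1 z2, x = pt z1 & y = pt z2].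
Proof.
pose B := {zz : Z1 * Z2 | P zz.1 zz.2}; have [t tP] := coded_set B.
exists (fun m => if (m < 5)%N then t m else
  if m == 5%N then ModArrow (flift (fun b : B => (sval b).1) : {linear free R B -> _})
  else ModArrow (flift (fun b : B => (sval b).2) : {linear free R B -> _})) => x y.
split=> [[z [/tP[b ->] [/cmp_pt-> /cmp_pt->]]]|[z1 [z2 [Pz -> ->]]]].
  by exists (sval b).1, (sval b).2; rewrite !flift_delta; split=> //; apply: (svalP b).
pose b : B := exist _ (z1, z2) Pz.
exists (pt (delta R b : free R B)); split; first by apply/tP; exists b.
by split; apply/cmp_pt; rewrite flift_delta.
Qed.

Lemma coded_rel1 (Z : lmodType R) (P : Z -> Prop) : exists s, forall x,
  rel1 (idA X) s x <-> exists2 z, P z & x = pt z.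
Proof.
pose B := {z : Z | P z}; have [t tP] := coded_set B.
exists (fun m => if (m < 5)%N then t m else
  ModArrow (flift (fun b : B => sval b) : {linear free R B -> _})) => x.
split=> [[z [/tP[b ->] /cmp_pt->]]|[z Pz ->]].
  by exists (sval b); rewrite ?flift_delta //; apply: (svalP b).
exists (pt (delta R (exist _ z Pz) : free R B)); split; first by apply/tP; eexists.
by apply/cmp_pt; rewrite flift_delta.
Qed.
End Coded.

Lemma point_pt t x : point (idA X) t x -> exists z : mod_dom (t 4), x = pt z.
Proof.
move=> [xc _]; have [e1 e2 _] := cmp_dom xc; move: e1 e2 {xc}; case: x => A M v /= e1 e2.
by subst A; rewrite -e1; exists (v g); rewrite ptE.
Qed.

Lemma coef_flift (J : Type) (i : J) (y : free R J) :
  flift (fun j => if pselect (j = i) is left _ then g else 0) y = coef i y *: g.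
Proof.
apply: (@free_ind R J (fun y => flift _ y = _)) y => [|a j z IH].
  by rewrite linear0 coef0 scale0r.
rewrite linearP IH flift_delta coefD coefZ scalerDl -scalerA; congr (_ + _).
congr (_ *: _); case: pselect => [->|ne]; first by rewrite coef_delta scale1r.
by rewrite coef_delta_ne ?scale0r.
Qed.

Lemma sum_arrowP r1 r2 r3 :
  sum_arrow (idA X) (rarr r1) (rarr r2) (rarr r3) <-> r1 = r2 + r3.
Proof.
split=> [|->].
  move=> [b [i1 [i2 [p1 [p2 [n [c [[Y ->] [[]]]]]]]]]].
  move=> /hom_pt[y1 ->] [/hom_pt[y2 ->] [/hom_arrow[{}p1 ->] [/hom_arrow[{}p2 ->]]]].
  move=> [/hom_pt[m ->] /hom_arrow[{}c ->]].
  move=> [[/cmp_pt_id e11 [/cmp_pt_id e22 []]]].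
  move=> [_ [/cmp_pt-> /iszero_pt e12]] [_ [/cmp_pt-> /iszero_pt e21]].
  move=> [joint [[/cmp_pt_id m1 /cmp_pt_id m2]]].
  move=> [/cmp_pt/pt_inj c1 [/cmp_pt/pt_inj c2 /cmp_pt/pt_inj c0]].
  (* Joint monicity of the projections identifies the diagonal with the sum of the two injections,
     on which [c] takes the sum of its values. *)
  have /pt_inj em : pt m = pt (y1 + y2).
    apply: (joint _ _ (pt g) (pt g)); rewrite ?hom_pt ?cmp_pt; try by eexists.
    - by rewrite m1.
    - by rewrite linearD e11 e12 addr0.
    - by rewrite m2.
    - by rewrite linearD e22 e21 add0r.
  by apply: gfree; rewrite c0 em linearD -c1 -c2 scalerDl.
pose Y := free R bool.
pose p b : {linear Y -> X} := flift (fun j => if pselect (j = b) is left _ then g else 0).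
have pE b y : p b y = coef b y *: g by apply: coef_flift.
pose c : {linear Y -> X} := flift (fun b => if b then r2 *: g else r3 *: g).
exists (idA Y), (pt (delta R true : Y)), (pt (delta R false : Y)).
exists (ModArrow (p true)), (ModArrow (p false)).
exists (pt (delta R true + delta R false : Y)), (ModArrow c).
have ne : false <> true by []. have ne' : true <> false by [].
split; first by exists Y.
split; first by rewrite !hom_pt !hom_arrow; do ?split; eexists.
split.
  split; first by apply/cmp_pt_id; rewrite pE coef_delta scale1r.
  split; first by apply/cmp_pt_id; rewrite pE coef_delta scale1r.
  by split; exists (pt (0 : X)); rewrite cmp_pt iszero_pt pE coef_delta_ne ?scale0r.
split.
  move=> _ _ u v /hom_pt[y ->] /hom_pt[y' ->] /cmp_pt-> /cmp_pt/pt_inj e1.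
  move=> /cmp_pt-> /cmp_pt/pt_inj e2; congr pt; apply: free_ext => -[].
    by apply: gfree; rewrite -!pE.
  by apply: gfree; rewrite -!pE.
split.
  by split; apply/cmp_pt_id; rewrite pE coefD coef_delta coef_delta_ne // ?addr0 ?add0r scale1r.
split; first by apply/cmp_pt; rewrite flift_delta.
split; first by apply/cmp_pt; rewrite flift_delta.
by apply/cmp_pt; rewrite linearD !flift_delta /rarr scalerDl.
Qed.
End FreeGenerator.

(** * Recovering the ring as a retract of all separators *)

Section Generator.
Variable R : pzRingType.

Lemma regular_free_on : free_on (1 : R^o).
Proof.
split=> [x|r]; first by exists x; rewrite /GRing.scale /= mulr1.
by rewrite /GRing.scale /= mulr1.
Qed.

Lemma separator_exists (G : lmodType R) (A C : lmodType R) (u v : {linear A -> C}) :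
  separator (idA G) -> u <> v -> exists x : {linear G -> A}, ~ u \o x =1 v \o x.
Proof.
move=> sep ne; have [||/arrow_inj//|x [k [l [xG [kx [lx kl]]]]]] :=
  sep (idA A) (idA C) (ModArrow u) (ModArrow v); try by apply/hom_arrow; eexists.
have [D [y [ex ek]]] := cmp_invl kx; have /cmp_idr/= := xG; rewrite ex /= => eD.
subst D; exists y => e; apply: kl; rewrite ek; move: lx; rewrite ex => /cmpE->.
exact: arrow_eq.
Qed.

Lemma free_separator (X : lmodType R) (g : X) : free_on g -> separator (idA X).
Proof.
move=> gX a c f h [fa fc] [ha hc] fh.
have [e1 _ _] := cmp_dom fa; have [e2 _ _] := cmp_dom ha.
have [_ _ e3] := cmp_dom fc; have [_ _ e4] := cmp_dom hc.
have {}e1 : mod_dom h = mod_dom f by rewrite -e1 -e2.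
have {}e3 : mod_cod h = mod_cod f by rewrite e4 -e3.
case: f h {fa fc ha hc e2 e4} fh e1 e3 => A C u [A' C' v] /= uv e1 e3; subst A' C'.
have [m um] : exists m, u m <> v m.
  by apply: contrapT => n; apply: uv; apply: arrow_eq => m; apply: contrapT => h; apply: n; exists m.
exists (pt gX m), (pt gX (u m)), (pt gX (v m)); rewrite cmp_idr !cmp_pt.
by split=> //; split=> //; split=> // /pt_inj.
Qed.

Hypothesis RD : is_integral_domain R.

(* The image of a nonzero map into R is a free principal left ideal, so R is   *)
(* a retract of any separator.                                                 *)
Lemma regular_retract (G : lmodType R) : separator (idA G) ->
  exists (s : {linear R^o -> G}) (r : {linear G -> R^o}), r \o s =1 idfun.
Proof.
move=> sep; have [Rdom Rpid] := RD; case: (pselect ((1 : R) = 0)) => [e10|R1].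
  exists (pnt regular_free_on (0 : G)), \0 => x /=.
  by rewrite -[x]mul1r e10 mul0r.
have [|x xn] := separator_exists (u := idfun : {linear R^o -> R^o}) (v := \0) sep.
  by move=> /(congr1 (fun f : {linear R^o -> R^o} => f 1)).
have [|a aP] := Rpid [pred r | `[< exists y, x y = r >]].
  split=> [|c _ _ /asboolP[y <-] /asboolP[z <-]]; apply/asboolP.
    by exists 0; rewrite linear0.
  by exists (c *: y + z); rewrite linearP.
have /(aP a).2/asboolP[y0 xy0] : exists r, a = r * a by exists 1; rewrite mul1r.
have a0 : a <> 0.
  move=> a0; apply: xn => y /=.
  have /(aP _).1[r ->] : x y \in [pred r | `[< exists y, x y = r >]] by apply/asboolP; exists y.
  by rewrite a0 mulr0.
have amul r r' : r * a = r' * a -> r = r'.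
  by move=> e; apply/subr0_eq; case: (Rdom (r - r') a) => //; rewrite mulrBl e subrr.
have /choice[q qP] y : exists r, x y = r * a by apply/aP/asboolP; exists y.
have ql : linear (q : G -> R^o).
  by move=> c y z; apply: amul; rewrite -qP linearP !qP /GRing.scale /= mulrDl mulrA.
pose qL := GRing.isLinear.Build R G R^o _ q ql.
pose q' : {linear G -> R^o} := HB.pack q qL.
exists (pnt regular_free_on y0), q' => r /=.
have -> : pnt regular_free_on y0 r = (r : R) *: y0.
  rewrite /pnt /= /pnt_fun; congr (_ *: _); rewrite -[X in gcoord _ X]mulr1.
  exact: (gcoordK regular_free_on r).
by apply: amul; rewrite -qP linearZ_LR xy0.
Qed.

Lemma generator_regular : generator (idA R^o).
Proof.
split; first by exists R^o.
split=> [|_ [G ->] /regular_retract[s [r rs]]]; first exact: free_separator regular_free_on.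
exists (ModArrow s), (ModArrow r); split; first by apply/hom_arrow; eexists.
split; first by apply/hom_arrow; eexists.
by apply/cmpE/arrow_eq => x; exact/esym/rs.
Qed.

(** [X] is a retract of [R], so [s (r 1)] is an idempotent of [R], that is 0 or 1. If it is 0 then
    [X] vanishes, which is impossible because a nonzero [R] is a retract of [X]; if it is 1 then [r]
    is injective and [r 1] is a free generator. *)
Lemma generator_free a : generator a -> exists (X : lmodType R) (g : X),
  a = idA X /\ free_on g.
Proof.
move=> [[X ->] [sepX Xret]]; exists X; have [Rdom _] := RD.
have [||f [h [/hom_arrow[s ->] [/hom_arrow[r ->] /cmpE/arrow_eqfun rs]]]] := Xret (idA R^o).
- by exists R^o.
- exact: free_separator regular_free_on.
have {}rs x : r (s x) = x by exact/esym/rs.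
exists (r 1); split=> //.
have rE (c : R) : r c = c *: (r 1 : X) by rewrite -linearZ_LR /GRing.scale /= mulr1.
split=> [x|c rc]; first by exists (s x); rewrite -rE rs.
case: (pselect ((1 : R) = 0)) => [e10|R1]; first by rewrite -[c]mul1r e10 mul0r.
have dd : s (r 1) * (s (r 1) - 1) = 0.
  rewrite mulrBr mulr1; apply/eqP; rewrite subr_eq0; apply/eqP.
  have -> : s (r 1) * s (r 1) = s (r 1) *: s (r 1) by [].
  by rewrite -linearZ_LR -rE rs.
case: (Rdom _ _ dd) => [d0|/subr0_eq d1].
  have r1 : r 1 = 0 by rewrite -[LHS]rs d0 linear0.
  have [s' [r' r's']] := regular_retract sepX.
  by case: R1; have := r's' 1; rewrite /= -[s' 1]rs rE r1 scaler0 linear0.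
by rewrite -[c]mulr1 -d1 -[c * _]/(c *: (s (r 1))) -linearZ_LR rc linear0.
Qed.
End Generator.

(** * Coded cardinals *)

(** Quantifying over a block of [n] arrows is rendered as quantifying over sequences [U] of which
    only the first [n] terms are read. *)
Definition pushn (T : Type) n (U e : nat -> T) (i : nat) : T :=
  if (i < n)%N then U i else e (i - n)%N.

Lemma pushn_lt (T : Type) n (U e : nat -> T) i : (i < n)%N -> pushn n U e i = U i.
Proof. by rewrite /pushn => ->. Qed.

Lemma pushn_add (T : Type) n (U e : nat -> T) i : pushn n U e (n + i) = e i.
Proof. by rewrite /pushn ltnNge leq_addr addKn. Qed.

Lemma pushnS (T : Type) n (U e : nat -> T) : pushn n.+1 U e = pushn n U (push (U n) e).
Proof.
apply: funext => i; rewrite /pushn ltnS; case: (ltngtP i n) => [lt|lt|->].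
- by [].
- by case: i lt => // i lt; rewrite subSS subSn.
- by rewrite subnn.
Qed.

Lemma def_pushn_all n (Q : uprop) : definable Q ->
  definable (fun R e => forall U, Q R (pushn n U e)).
Proof.
elim: n Q => [|n IH] Q dQ.
  apply: definable_ext dQ => R e.
  have e0 (U : nat -> mod_arrow R) : pushn 0 U e = e.
    by apply: funext => i; rewrite /pushn subn0.
  by split=> [h U|/(_ e)]; rewrite e0.
apply: (@definable_ext (fun R e => forall f U, Q R (pushn n U (push f e)))) => [R e|].
  split=> [h U|h f U]; first by rewrite pushnS.
  have := h (fun i => if (i < n)%N then U i else f); rewrite pushnS ltnn.
  congr (Q R _); apply: funext => i; rewrite /pushn; case: ltnP => // lt.
apply: def_all; apply: (definable_ext _ (IH Q dQ)) => R e.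
suff -> : push (e 0) (fun i => e i.+1) = e by [].
by apply: funext => -[|i].
Qed.

Lemma def_pushn_ex n (Q : uprop) : definable Q ->
  definable (fun R e => exists U, Q R (pushn n U e)).
Proof.
move=> dQ; apply: definable_ext (def_not (def_pushn_all n (def_not dQ))) => R e.
by rewrite -(not_existsP (fun U => Q R (pushn n U e))).
Qed.

Lemma def_all_block n (P : forall R, (nat -> mod_arrow R) -> (nat -> mod_arrow R) -> Prop) :
  (forall R e U V, (forall i, (i < n)%N -> U i = V i) -> P R e U -> P R e V) ->
  definable (fun R e => P R (fun i => e (n + i)%N) (fun i => e i)) ->
  definable (fun R e => forall U, P R e U).
Proof.
move=> Pext dP; apply: definable_ext (def_pushn_all n dP) => R e.
have eU U : (fun i => pushn n U e (n + i)%N) = e.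
  by apply: funext => i; rewrite pushn_add.
by split=> h U; have := h U; rewrite ?eU; apply: Pext => i lt; rewrite pushn_lt.
Qed.

Lemma def_ex_block n (P : forall R, (nat -> mod_arrow R) -> (nat -> mod_arrow R) -> Prop) :
  (forall R e U V, (forall i, (i < n)%N -> U i = V i) -> P R e U -> P R e V) ->
  definable (fun R e => P R (fun i => e (n + i)%N) (fun i => e i)) ->
  definable (fun R e => exists U, P R e U).
Proof.
move=> Pext dP; apply: definable_ext (def_pushn_ex n dP) => R e.
have -> : (exists U, P R (fun i => pushn n U e (n + i)%N) (pushn n U e)) <->
    (exists U, P R e (pushn n U e)).
  by split=> -[U h]; exists U; move: h; congr (P R _ _); apply: funext => i;
    rewrite pushn_add.
split=> -[U h]; first by exists (pushn n U e).
by exists U; apply: Pext h => i lt; rewrite pushn_lt.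
Qed.

Section CardPredicates.
Variable R : pzRingType.
Implicit Types (a x y z : mod_arrow R) (c d s U V : nat -> mod_arrow R).
Implicit Types (A B : mod_arrow R -> Prop) (l m : mod_arrow R -> mod_arrow R -> Prop).

Lemma rel1_ext U V a x : (forall i, (i < 6)%N -> U i = V i) -> rel1 a U x = rel1 a V x.
Proof. by move=> UV; rewrite /rel1 /point !UV. Qed.

Lemma rel2_ext U V a x y : (forall i, (i < 7)%N -> U i = V i) ->
  rel2 a U x y = rel2 a V x y.
Proof. by move=> UV; rewrite /rel2 /point !UV. Qed.

(* A code of an ordered set: the codes of a set and of a relation on it.       *)
Definition ord_le a c x y := rel2 a (fun i => c (5 + i)%N) x y.

Definition initial a c z x := point a c x /\ (ord_le a c x z /\ x <> z).

Definition matching A l B m U a :=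
  (forall x, A x -> exists y, B y /\ rel2 a U x y) /\
  ((forall y, B y -> exists x, A x /\ rel2 a U x y) /\
   forall x x' y y', A x -> A x' -> B y -> B y' -> rel2 a U x y -> rel2 a U x' y' ->
     (x = x' <-> y = y') /\ (l x x' <-> m y y')).

(** A vacuous definable relation, with which [matching] expresses mere equipotency. *)
Definition any (x y : mod_arrow R) := x = x.

(** All subsets are coded ([coded_rel1]), so the quantifier over codes [U] expresses
    well-foundedness in full. Twelve arrows of [c] are read: five for the set and seven for the
    order. *)
Definition isCard a c :=
  ((forall x y, point a c x -> point a c y -> ord_le a c x y -> ord_le a c y x -> x = y) /\
   forall U, (exists x, point a c x /\ rel1 a U x) ->
     exists z, point a c z /\ (rel1 a U z /\
       forall y, point a c y -> rel1 a U y -> ord_le a c z y)) /\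
  forall z, point a c z -> ~ exists U, matching (initial a c z) any (point a c) any U a.

Definition same_card a c d :=
  exists U, matching (point a c) (ord_le a c) (point a d) (ord_le a d) U a.

Definition same_ord a c x d y :=
  exists U, matching (initial a c x) (ord_le a c) (initial a d y) (ord_le a d) U a.
End CardPredicates.

Lemma def_ord_le i (c : nat -> nat) x y :
  definable (fun R e => ord_le (e i) (fun m => e (c m)) (e x) (e y)).
Proof. by rewrite /ord_le; apply: def_rel2. Qed.

Lemma def_initial i (c : nat -> nat) x y :
  definable (fun R e => initial (e i) (fun m => e (c m)) (e x) (e y)).
Proof. by rewrite /initial; repeat (apply: def_point || apply: def_ord_le || def_step). Qed.

Ltac def_card := repeat (first [ apply: def_point | apply: def_ord_le | apply: def_initial
  | apply: def_rel1 | apply: def_rel2 | def_step ]).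

Lemma matching_ext R (A B : mod_arrow R -> Prop) l m U V a :
  (forall i, (i < 7)%N -> U i = V i) -> matching A l B m U a -> matching A l B m V a.
Proof.
move=> UV; have e : rel2 a U = rel2 a V.
  by apply: funext => x; apply: funext => y; exact: rel2_ext.
by rewrite /matching e.
Qed.

Lemma def_isCard i (c : nat -> nat) : definable (fun R e => isCard (e i) (fun m => e (c m))).
Proof.
rewrite /isCard; apply: def_and; first (apply: def_and; first by def_card).
  apply: (@def_all_block 6); first (move=> R e U V UV h [x]).
    rewrite -(rel1_ext _ _ UV) => hx; have [z hz] := h (ex_intro _ x hx).
    exists z; rewrite -(rel1_ext _ _ UV); case: hz => h1 [h2 h3]; split=> //; split=> // y.
    by rewrite -(rel1_ext _ _ UV); apply: h3.
  by def_card.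
apply: def_all; apply: def_imp; first exact: def_point.
apply: def_not; apply: (@def_ex_block 7) => [R e U V|]; first exact: matching_ext.
by rewrite /matching /any; def_card.
Qed.

Lemma def_same_card i (c d : nat -> nat) :
  definable (fun R e => same_card (e i) (fun m => e (c m)) (fun m => e (d m))).
Proof.
apply: (@def_ex_block 7) => [R e U V|]; first exact: matching_ext.
by rewrite /matching; def_card.
Qed.

Lemma def_same_ord i (c : nat -> nat) x (d : nat -> nat) y :
  definable (fun R e => same_ord (e i) (fun m => e (c m)) (e x) (fun m => e (d m)) (e y)).
Proof.
apply: (@def_ex_block 7) => [R e U V|]; first exact: matching_ext.
by rewrite /matching; def_card.
Qed.

Section CardSemantics.
Variables (R : pzRingType) (X : lmodType R) (g : X).
Hypothesis gX : free_on g.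
Hypothesis Rdom : forall a b : R, a * b = 0 -> a = 0 \/ b = 0.
Hypothesis R1 : (1 : R) != 0.
Local Notation a := (idA X).
Local Notation ptg := (pt gX).

Definition in_module (Z : lmodType R) (A : mod_arrow R -> Prop) :=
  forall x, A x -> exists z : Z, x = ptg z.

(** The graph of any bijection between two sets of points is coded by some [U] ([coded_rel2]), so
    first-order existence of [U] is genuine existence of a bijection. *)
Lemma matchingP (T T' : Type) (j : T -> mod_arrow R) (j' : T' -> mod_arrow R)
    (r : T -> T -> Prop) (r' : T' -> T' -> Prop) A l B m (Z Z' : lmodType R) :
    injective j -> injective j' -> (forall x, A x <-> exists t, j t = x) ->
    (forall x, B x <-> exists t, j' t = x) ->
    (forall t u, r t u <-> l (j t) (j u)) -> (forall t u, r' t u <-> m (j' t) (j' u)) ->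
    in_module Z A -> in_module Z' B ->
  (exists U, matching A l B m U a) <->
  exists2 f : T -> T', bijective f & forall t u, r t u <-> r' (f t) (f u).
Proof.
move=> jI jI' Aj Bj rl rm AZ BZ; have Ajt t : A (j t) by apply/Aj; exists t.
have Bjt t : B (j' t) by apply/Bj; exists t.
split=> [[U [U1 [U2 U3]]]|[f [h fK hK] fr]].
  have /choice[f fP] t : exists t', rel2 a U (j t) (j' t').
    by have [y [/Bj[t' <-] tt']] := U1 (j t) (Ajt t); exists t'.
  have /choice[h hP] t' : exists t, rel2 a U (j t) (j' t').
    by have [x [/Aj[t <-] tt']] := U2 (j' t') (Bjt t'); exists t.
  exists f; last first.
    move=> t u; rewrite rl rm.
    exact: (U3 _ _ _ _ (Ajt t) (Ajt u) (Bjt _) (Bjt _) (fP t) (fP u)).2.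
  exists h => t.
    have [e _] := U3 _ _ _ _ (Ajt _) (Ajt t) (Bjt _) (Bjt _) (hP (f t)) (fP t).
    by apply/jI/e.
  have [e _] := U3 _ _ _ _ (Ajt _) (Ajt (h t)) (Bjt _) (Bjt _) (fP (h t)) (hP t).
  by apply/jI'/e.
have [U UP] := coded_rel2 gX Rdom R1
  (fun (z : Z) (z' : Z') => exists t, ptg z = j t /\ ptg z' = j' (f t)).
have Ut t : rel2 a U (j t) (j' (f t)).
  have [z ez] := AZ _ (Ajt t); have [z' ez'] := BZ _ (Bjt (f t)).
  by apply/UP; exists z, z'; split=> //; exists t.
exists U; split=> [x /Aj[t <-]|]; first by exists (j' (f t)); split.
split=> [y /Bj[t <-]|]; first by exists (j (h t)); split=> //; have := Ut (h t); rewrite hK.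
move=> x x' y y' _ _ _ _ /UP[z1 [z2 [[t [-> ->]] -> ->]]] /UP[z3 [z4 [[u [-> ->]] -> ->]]].
by rewrite -rl -rm -fr; split=> //; split=> [/jI->//|/jI'/(can_inj fK)->].
Qed.

Record pcard := PCard { pw : woset; pj : wo_car pw -> mod_arrow R }.

Definition pres (c : nat -> mod_arrow R) (p : pcard) :=
  [/\ forall x, point a c x <-> exists z, @pj p z = x, injective (@pj p) &
      forall z z' : wo_car (pw p), wo_le z z' <-> ord_le a c (pj z) (pj z')].

Lemma in_module_point c A : (forall x, A x -> point a c x) -> in_module (mod_dom (c 4)) A.
Proof. by move=> Ac x /Ac/(point_pt gX). Qed.

Lemma initialP c p (z : wo_car (pw p)) : pres c p ->
  forall x, initial a c (pj z) x <-> exists y : wo_car (seg z), pj (sval y) = x.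
Proof.
move=> [cj jI cle] x; split=> [[/cj[y <-] [/cle yz n]]|[[y [yz n]] /= <-]].
  have h : slt (@wo_le (pw p)) y z by split=> // e; apply: n; rewrite e.
  by exists (in_seg h).
by split; [apply/cj; exists y | split; [apply/cle | move=> /jI]].
Qed.

Lemma initial_inj p (z : wo_car (pw p)) : injective (@pj p) ->
  injective (fun y : wo_car (seg z) => pj (sval y)).
Proof. by move=> jI y y' /jI/seg_ext. Qed.

Lemma same_cardP c d p q : pres c p -> pres d q ->
  same_card a c d <-> ot (pw p) = ot (pw q).
Proof.
move=> pp qq; have [cj jI cle] := pp; have [dj jI' dle] := qq.
rewrite ot_eq /same_card (matchingP jI jI' cj dj cle dle); first last.
- exact: (in_module_point (c := d)).
- exact: (in_module_point (c := c)).
by split=> -[f fb fle]; exists f => // x y; first [by rewrite fle | by apply/idP/idP => /fle].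
Qed.

Lemma same_ordP c d p q (z : wo_car (pw p)) (y : wo_car (pw q)) : pres c p -> pres d q ->
  same_ord a c (pj z) d (pj y) <-> ot (seg z) = ot (seg y).
Proof.
move=> pp qq; have [cj jI cle] := pp; have [dj jI' dle] := qq.
have cle' (s t : wo_car (seg z)) : wo_le s t <-> ord_le a c (pj (sval s)) (pj (sval t)).
  exact: cle.
have dle' (s t : wo_car (seg y)) : wo_le s t <-> ord_le a d (pj (sval s)) (pj (sval t)).
  exact: dle.
rewrite ot_eq /same_ord (matchingP (initial_inj (z := z) jI) (initial_inj (z := y) jI')
  (initialP z pp) (initialP y qq) cle' dle'); first last.
- by apply: (in_module_point (c := d)) => x [].
- by apply: (in_module_point (c := c)) => x [].
by split=> -[f fb fle]; exists f => // s t; first [by rewrite fle | by apply/idP/idP => /fle].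
Qed.

Lemma is_cardinal_pres c p : pres c p -> is_cardinal (ot (pw p)) <->
  forall z, point a c z -> ~ exists U, matching (initial a c z) (@any R) (point a c) (@any R) U a.
Proof.
move=> pp; have [cj jI cle] := pp; rewrite is_cardinal_ot.
have mz (z : wo_car (pw p)) :
    (exists U, matching (initial a c (pj z)) (@any R) (point a c) (@any R) U a) <->
    exists f : wo_car (seg z) -> wo_car (pw p), bijective f.
  rewrite (@matchingP _ _ _ _ (fun _ _ => True) (fun _ _ => True) _ _ _ _ _ _
    (initial_inj jI) jI (initialP z pp) cj); last 4 first.
  - by [].
  - by [].
  - by apply: (in_module_point (c := c)) => x [].
  - exact: (in_module_point (c := c)).
  by split=> [[f fb _]|[f fb]]; exists f.
split=> [h z /cj[t <-] /mz|h z /mz]; first exact: h.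
by apply: h; apply/cj; exists z.
Qed.

Lemma isCardP c : isCard a c <-> exists p, pres c p /\ is_cardinal (ot (pw p)).
Proof.
split=> [[[anti wf] ini]|[p [pp pc]]]; last first.
  split; last exact/(is_cardinal_pres pp).
  have [cj jI cle] := pp; split=> [x y /cj[s <-] /cj[t <-] /cle st /cle ts|].
    by rewrite (wo_anti (@wo_leP (pw p)) st ts).
  move=> U [x [/cj[t <-] Ut]].
  have [|m [Um mmin]] := wo_min (@wo_leP (pw p)) (P := fun t => rel1 a U (pj t)).
    by exists t.
  exists (pj m); split; first by apply/cj; exists m.
  by split=> // y /cj[u <-] /mmin; rewrite cle.
pose T := {z : mod_dom (c 4) | point a c (ptg z)}.
pose j (z : T) := ptg (sval z).
have jI : injective j by move=> [z pz] [y py] /pt_inj /= e; apply: eq_exist.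
have cj x : point a c x <-> exists z, j z = x.
  split=> [px|[[z pz] <-]] //; have [z ez] := point_pt gX px; subst x.
  by exists (exist _ z px).
pose le (z y : T) := `[< ord_le a c (j z) (j y) >].
have leP : well_order le.
  apply: antisymmetric_well_order => [x y /andP[/asboolP xy /asboolP yx]|A [x Ax]].
    by apply: jI; apply: anti xy yx; apply/cj; eexists.
  (* The arbitrary subset [A] reaches the first-order clause [wf] through a code. *)
  have [U UP] := coded_rel1 gX Rdom R1 (fun z => exists y : T, sval y = z /\ y \in A).
  have Uj y : rel1 a U (j y) <-> y \in A.
    rewrite UP; split=> [[_ [t [<- tA]] /jI->//]|yA].
    by exists (sval y) => //; exists y.
  have [|m [/cj[z <-] [/Uj zA zmin]]] := wf U.
    by exists (j x); split; [apply/cj; exists x | apply/Uj].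
  exists z; split=> // y yA; apply/asboolP; apply: zmin; last exact/Uj.
  by apply/cj; exists y.
pose p := PCard (pw := WOSet leP) j.
have pp : pres c p by split=> // z y; split=> [/asboolP|h] //; apply/asboolP.
by exists p; split=> //; apply/(is_cardinal_pres pp).
Qed.

Lemma coded_card w : exists c p, pres c p /\ pw p = w.
Proof.
have [t tP] := coded_set gX Rdom R1 (wo_car w).
pose Z := free R (wo_car w).
have [s sP] := coded_rel2 gX Rdom R1 (fun z y : Z => exists b b', [/\ z = delta R b,
  y = delta R b' & wo_le b b']).
have deltaI : injective (fun b : wo_car w => delta R b : Z).
  move=> b b' e; apply: contrapT => ne.
  have := congr1 (coef b) e; rewrite coef_delta coef_delta_ne; last by move/esym.
  by move/eqP: R1.
exists (fun m => if (m < 5)%N then t m else s (m - 5)%N).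
exists (PCard (pw := w) (fun b => ptg (delta R b : Z))); split=> //; split=> /=.
- move=> x; rewrite (_ : point _ _ _ = point a t x) // tP.
  by split=> -[b e]; exists b.
- by move=> b b' /pt_inj/deltaI.
- move=> b b'; rewrite /ord_le.
  rewrite (@rel2_ext _ _ s) => [|i _]; last by rewrite ltnNge leq_addr addKn.
  rewrite sP; split=> [bb|[z [y [[c [c' [-> -> cc]]] /pt_inj/deltaI-> /pt_inj/deltaI->]]]] //.
  by exists (delta R b), (delta R b'); split=> //; exists b, b'.
Qed.

(** An ordinal below the presented cardinal is represented by the point whose initial segment has
    that order type. *)
Definition ordpt (p : pcard) (al : ordnum) (x : mod_arrow R) :=
  exists z : wo_car (pw p), pj z = x /\ al = ot (seg z).

Lemma ordpt_uniq p al x y : ordpt p al x -> ordpt p al y -> x = y.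
Proof. by move=> [z [<- ->]] [t [<-]] /ot_seg_inj->. Qed.

Lemma ordpt_lt p al : ord_lt al (ot (pw p)) <-> exists x, ordpt p al x.
Proof.
rewrite ord_lt_ot; split=> [[z ->]|[x [z [_ ->]]]]; last by exists z.
by exists (pj z), z.
Qed.

Lemma ordpt_point c p x : pres c p -> point a c x -> exists al, ordpt p al x.
Proof. by move=> [cj _ _] /cj[z <-]; exists (ot (seg z)), z. Qed.

Lemma pres_ordpt c p al x : pres c p -> ordpt p al x -> point a c x.
Proof. by move=> [cj _ _] [z [<- _]]; apply/cj; exists z. Qed.

Lemma coded_pvar k n (c : 'I_k -> nat -> mod_arrow R) (p : 'I_k -> pcard)
    (P : ('I_k -> ordnum) -> ('I_n -> R) -> Prop) : (forall i, pres (c i) (p i)) ->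
  exists s, forall al x r, (forall i, ordpt (p i) (al i) (x i)) ->
    (P al r <-> code_rel a s x (fun l => rarr gX (r l))).
Proof.
move=> pp; have [s sP] := coded_rel gX Rdom R1 (Z := fun i => mod_dom (c i 4))
  (fun z r => exists al, (forall i, ordpt (p i) (al i) (ptg (z i))) /\ P al r).
exists s => al x r alx; rewrite sP; split=> [Pr|[z [r' [[al' [al'z Pr]] xz rr]]]].
  have /cid[z zP] : exists z : forall i, mod_dom (c i 4), forall i, x i = ptg (z i).
    have h i : exists z : mod_dom (c i 4), x i = ptg z.
      by apply: (point_pt gX); apply: pres_ordpt (alx i).
    by exists (fun i => sval (cid (h i))) => i; apply: (svalP (cid (h i))).
  exists z, r; split=> //; exists al; split=> // i; rewrite -zP; exact: alx.
have -> : al = al'.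
  apply: funext => i; have := al'z i; rewrite -xz => -[t [et ->]].
  have [u [eu ->]] := alx i; have [_ jI _] := pp i.
  by rewrite (jI t u) // et.
by rewrite (_ : r = r') //; apply: funext => l; apply: (rarr_inj (gX := gX)).
Qed.
End CardSemantics.

(** * Environments of [L2] represented by sequences of arrows *)

Lemma env_consS (T : Type) n (x : T) (e : 'I_n -> T) i : env_cons x e (lift ord0 i) = e i.
Proof. by case: i => i lt /=; congr (e _); apply: val_inj. Qed.

Lemma pushn_block (T : Type) n (U e : nat -> T) k :
  (fun m => pushn n U e (n + k + m)%N) = (fun m => e (k + m)%N).
Proof. by apply: funext => m; rewrite -addnA pushn_add. Qed.

Lemma pushn_block0 (T : Type) n (U e : nat -> T) m : (m < n)%N -> pushn n U e (0 + m) = U m.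
Proof. by rewrite add0n; apply: pushn_lt. Qed.

(* e represents the L2 environment (ec, eo, er, ep); x0, xc, xo, xr, xp are    *)
(* the positions in e of the generator, of the 12 arrows of each cardinal, of  *)
(* the ordinals, of the ring elements and of the codes of the relations.       *)
Record simulates (R : pzRingType) (X : lmodType R) (g : X) (gX : free_on g)
    (c o r p : nat) (so : 'I_o -> 'I_c) (sp : 'I_p -> pvar_sort c)
    (x0 : nat) (xc : 'I_c -> nat) (xo : 'I_o -> nat) (xr : 'I_r -> nat) (xp : 'I_p -> nat)
    (e : nat -> mod_arrow R) (cs : 'I_c -> pcard R)
    (ec : 'I_c -> ordnum) (eo : 'I_o -> ordnum) (er : 'I_r -> R)
    (ep : forall j, pvar_rel R (sp j)) : Prop := Simulates {
  sim_gen : e x0 = idA X;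
  sim_card : forall i, pres X (fun m => e (xc i + m)%N) (cs i) /\ ec i = ot (pw (cs i));
  sim_ord : forall i, ordpt (cs (so i)) (eo i) (e (xo i));
  sim_ring : forall i, e (xr i) = rarr gX (er i);
  sim_pvar : forall j al x rs,
    (forall i, ordpt (cs (ocards (sp j) i)) (al i) (x i)) ->
    (ep j al rs <->
      code_rel (idA X) (fun m => e (xp j + m)%N) x (fun l => rarr gX (rs l)))
}.

Section Steps.
Variables (R : pzRingType) (X : lmodType R) (g : X) (gX : free_on g).
Variables (c o r p : nat) (so : 'I_o -> 'I_c) (sp : 'I_p -> pvar_sort c).
Variables (x0 : nat) (xc : 'I_c -> nat) (xo : 'I_o -> nat) (xr : 'I_r -> nat).
Variables (xp : 'I_p -> nat) (e : nat -> mod_arrow R) (cs : 'I_c -> pcard R).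
Variables (ec : 'I_c -> ordnum) (eo : 'I_o -> ordnum) (er : 'I_r -> R).
Variable ep : forall j, pvar_rel R (sp j).
Hypothesis S : simulates gX so x0 xc xo xr xp e cs ec eo er ep.

Lemma sim_push_ring U s : U 0 = rarr gX s ->
  simulates gX so (1 + x0)%N (fun i => 1 + xc i)%N (fun i => 1 + xo i)%N
    (env_cons 0 (fun i => 1 + xr i))%N (fun i => 1 + xp i)%N (pushn 1 U e) cs ec eo
    (env_cons s er) ep.
Proof.
move=> U0; split=> [|i|i|[[|i] lt]|j al x rs h]; rewrite ?pushn_block ?pushn_add.
- exact: sim_gen S.
- exact: sim_card S i.
- exact: sim_ord S i.
- by rewrite pushn_lt.
- exact: (sim_ring S (Ordinal (lt : (i < r)%N))).
- exact: sim_pvar S j al x rs h.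
Qed.

Lemma sim_push_ord U k al : ordpt (cs k) al (U 0) ->
  simulates gX (env_cons k so) (1 + x0)%N (fun i => 1 + xc i)%N
    (env_cons 0 (fun i => 1 + xo i))%N (fun i => 1 + xr i)%N (fun i => 1 + xp i)%N
    (pushn 1 U e) cs ec (env_cons al eo) er ep.
Proof.
move=> U0; split=> [|i|[[|i] lt]|i|j al' x rs h]; rewrite ?pushn_block ?pushn_add.
- exact: sim_gen S.
- exact: sim_card S i.
- by rewrite pushn_lt.
- exact: (sim_ord S (Ordinal (lt : (i < o)%N))).
- exact: sim_ring S i.
- exact: sim_pvar S j al' x rs h.
Qed.

Lemma sim_push_card U q : pres X U q ->
  simulates gX (fun i => lift ord0 (so i)) (sp := fun j => shift_pvar_sort (sp j))
    (12 + x0)%N (env_cons 0 (fun i => 12 + xc i))%N (fun i => 12 + xo i)%N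
    (fun i => 12 + xr i)%N (fun i => 12 + xp i)%N
    (pushn 12 U e) (env_cons q cs) (env_cons (ot (pw q)) ec) eo er ep.
Proof.
move=> Uq; split=> [|[[|i] lt]|i|i|j al x rs h]; rewrite ?pushn_block ?pushn_add.
- exact: sim_gen S.
- by split=> //; case: Uq.
- exact: (sim_card S (Ordinal (lt : (i < c)%N))).
- by rewrite env_consS; apply: sim_ord S i.
- exact: sim_ring S i.
- by apply: (sim_pvar S) => i; rewrite -(env_consS q cs); apply: h.
Qed.

Lemma sim_push_pvar U (s : pvar_sort c) (P : pvar_rel R s) :
  (forall al x rs, (forall i, ordpt (cs (ocards s i)) (al i) (x i)) ->
    (P al rs <-> code_rel (idA X) U x (fun l => rarr gX (rs l)))) ->
  let n := (5 + oarity s + rarity s)%N in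
  simulates gX so (sp := env_cons s sp) (n + x0)%N (fun i => n + xc i)%N (fun i => n + xo i)%N
    (fun i => n + xr i)%N (env_cons 0 (fun i => n + xp i))%N
    (pushn n U e) cs ec eo er (penv_cons P ep).
Proof.
move=> UP n; split=> [|i|i|i|[[|j] lt] al x rs h]; rewrite ?pushn_block ?pushn_add.
- exact: sim_gen S.
- exact: sim_card S i.
- exact: sim_ord S i.
- exact: sim_ring S i.
- rewrite /= UP //; rewrite /code_rel /point.
  have eU m : (m < n)%N -> pushn n U e (0 + m) = U m by exact: pushn_block0.
  have lt5 m : (m < 5)%N -> (m < n)%N by move=> h5; rewrite /n -addnA ltn_addr.
  rewrite !eU ?lt5 //.
  have e1 (i : 'I_(oarity s)) : pushn n U e (0 + (5 + i)) = U (5 + i)%N.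
    by rewrite eU // /n -addnA ltn_add2l ltn_addr.
  have e2 (i : 'I_(rarity s)) : pushn n U e (0 + (5 + oarity s + i)) = U (5 + oarity s + i)%N.
    by rewrite eU // /n ltn_add2l.
  split=> -[y [h1 [h2 h3]]]; exists y; split=> //; split=> i; move: (h2) (h3).
  - by move=> /(_ i); rewrite e1.
  - by move=> _ /(_ i); rewrite e2.
  - by move=> /(_ i); rewrite e1.
  - by move=> _ /(_ i); rewrite e2.
- have := @sim_pvar _ _ _ _ _ _ _ _ _ _ _ _ _ _ _ _ _ _ _ _ _ S (Ordinal (lt : (j < p)%N)) al x rs h.
  by [].
Qed.
End Steps.

(** * Interpretation of L2 in the category *)

Definition interprets (c o r p : nat) (so : 'I_o -> 'I_c) (sp : 'I_p -> pvar_sort c)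
    (x0 : nat) (xc : 'I_c -> nat) (xo : 'I_o -> nat) (xr : 'I_r -> nat) (xp : 'I_p -> nat)
    (q : L2_formula r so sp) (P : uprop) : Prop :=
  forall (R : pzRingType) (X : lmodType R) (g : X) (gX : free_on g),
    (forall a b : R, a * b = 0 -> a = 0 \/ b = 0) -> (1 : R) != 0 ->
  forall e cs ec eo er ep, simulates gX so (sp := sp) x0 xc xo xr xp e cs ec eo er ep ->
  (P R e <-> L2_holds q ec eo er ep).

Section Quantifiers.
Variables (R : pzRingType) (X : lmodType R) (g : X) (gX : free_on g).
Hypothesis Rdom : forall a b : R, a * b = 0 -> a = 0 \/ b = 0.
Hypothesis R1 : (1 : R) != 0.
Variables (c o r p : nat) (so : 'I_o -> 'I_c) (sp : 'I_p -> pvar_sort c).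
Variables (x0 : nat) (xc : 'I_c -> nat) (xo : 'I_o -> nat) (xr : 'I_r -> nat).
Variables (xp : 'I_p -> nat) (e : nat -> mod_arrow R) (cs : 'I_c -> pcard R).
Variables (ec : 'I_c -> ordnum) (eo : 'I_o -> ordnum) (er : 'I_r -> R).
Variable ep : forall j, pvar_rel R (sp j).
Hypothesis S : simulates gX so x0 xc xo xr xp e cs ec eo er ep.

Lemma ring_arrows U : hom (e x0) (e x0) (U 0%N) <-> exists s, U 0%N = rarr gX s.
Proof. by rewrite (sim_gen S) (hom_rarr gX). Qed.

Lemma ordinal_arrows U k : point (e x0) (fun m => e (xc k + m)%N) (U 0%N) <->
  exists2 al, ord_lt al (ec k) & ordpt (cs k) al (U 0%N).
Proof.
have [pk ek] := sim_card S k; rewrite (sim_gen S) ek; split=> [/(ordpt_point pk)[al h]|[al _]].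
  by exists al => //; apply/ordpt_lt; exists (U 0%N).
exact: pres_ordpt pk.
Qed.

Lemma card_arrows U : isCard (e x0) U <->
  exists2 k, is_cardinal k & exists q, pres X U q /\ k = ot (pw q).
Proof.
rewrite (sim_gen S) (isCardP gX Rdom R1); split=> [[q [Uq qc]]|[k kc [q [Uq e']]]].
  by exists (ot (pw q)) => //; exists q.
by exists q; rewrite -e'.
Qed.

Lemma pvar_code (s : pvar_sort c) (P : pvar_rel R s) : exists U,
  forall al x rs, (forall i, ordpt (cs (ocards s i)) (al i) (x i)) ->
    (P al rs <-> code_rel (idA X) U x (fun l => rarr gX (rs l))).
Proof.
exact: (coded_pvar gX Rdom R1 _ (fun i => (sim_card S (ocards s i)).1)).
Qed.

(** Any sequence of arrows can be read as a relation, by restricting it to tuples of points of the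
    right cardinals. Hence quantifiers over predicate variables translate without a guard. *)
Lemma code_pvar (s : pvar_sort c) U : exists2 P : pvar_rel R s,
  rel_within (fun i => ec (ocards s i)) P &
  forall al x rs, (forall i, ordpt (cs (ocards s i)) (al i) (x i)) ->
    (P al rs <-> code_rel (idA X) U x (fun l => rarr gX (rs l))).
Proof.
exists (fun al rs => exists x, (forall i, ordpt (cs (ocards s i)) (al i) (x i)) /\
    code_rel (idA X) U x (fun l => rarr gX (rs l))).
  move=> al rs [x [h _]] i; have [_ ->] := sim_card S (ocards s i).
  by apply/ordpt_lt; exists (x i).
move=> al x rs h; split=> [[y [yP Uy]]|Ux]; last by exists x.
rewrite (_ : x = y) //; apply: funext => i.
exact: (ordpt_uniq (h i) (yP i)).
Qed.
End Quantifiers.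

Lemma isCard_ext (R : pzRingType) (a : mod_arrow R) n U V :
  (12 <= n)%N -> (forall i, (i < n)%N -> U i = V i) -> isCard a U -> isCard a V.
Proof.
move=> n12 UV; have UV' i : (i < 12)%N -> U i = V i by move=> lt; apply/UV/(leq_trans lt).
by rewrite /isCard /initial /matching /ord_le /rel2 /point /= !UV'.
Qed.

Section Translate.
Ltac unpack := move=> R X g gX Rdom R1 e cs ec eo er ep S.

(** The positions are arbitrary because each quantifier inserts a block at the front of the
    environment and moves all earlier variables. *)
Lemma interpret (c o r p : nat) (so : 'I_o -> 'I_c) (sp : 'I_p -> pvar_sort c)
    (q : L2_formula r so sp) : forall x0 xc xo xr xp,
  exists P, definable P /\ interprets x0 xc xo xr xp q P.
Proof.
elim: c o r p so sp / q => c o r p so sp.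
- move=> x y z x0 xc xo xr xp.
  exists (fun R e => sum_arrow (e x0) (e (xr x)) (e (xr y)) (e (xr z))).
  split; first exact: def_sum_arrow.
  by unpack; rewrite (sim_gen S) !(sim_ring S) sum_arrowP.
- move=> x y z x0 xc xo xr xp.
  (* The factors are exchanged, since endomorphisms of a left module compose in the opposite
     order. *)
  exists (fun R e => mod_isComp (e (xr x)) (e (xr z)) (e (xr y))); split; first exact: def_cmp.
  unpack; rewrite !(sim_ring S) cmp_rarr /=.
  by split=> [/rarr_inj|->].
- move=> x y x0 xc xo xr xp; exists (fun R e => e (xr x) = e (xr y)); split; first exact: def_eq.
  by unpack; rewrite !(sim_ring S) /=; split=> [/rarr_inj|->].
- move=> k l x0 xc xo xr xp; exists (fun R e =>
    same_card (e x0) (fun m => e (xc k + m)%N) (fun m => e (xc l + m)%N)).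
  split; first exact: def_same_card.
  unpack; have [pk /= ->] := sim_card S k; have [pl ->] := sim_card S l.
  by rewrite (sim_gen S) (same_cardP gX Rdom R1 pk pl).
- move=> x y x0 xc xo xr xp; exists (fun R e =>
    same_ord (e x0) (fun m => e (xc (so x) + m)%N) (e (xo x))
                    (fun m => e (xc (so y) + m)%N) (e (xo y))).
  split; first exact: def_same_ord.
  unpack; have [px _] := sim_card S (so x); have [py _] := sim_card S (so y).
  have [z [<- /= ->]] := sim_ord S x; have [t [<- ->]] := sim_ord S y.
  by rewrite (sim_gen S) (same_ordP gX Rdom R1 _ _ px py).
- move=> P al xs sal x0 xc xo xr xp; exists (fun R e =>
    code_rel (e x0) (fun m => e (xp P + m)%N) (fun i => e (xo (al i))) (fun l => e (xr (xs l)))).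
  split; first exact: def_rel.
  unpack; rewrite (sim_gen S) /=.
  rewrite (_ : (fun l => e (xr (xs l))) = fun l => rarr gX (er (xs l))).
    by symmetry; apply: (sim_pvar S) => i; rewrite -sal; apply: (sim_ord S).
  by apply: funext => l; rewrite (sim_ring S).
- move=> q IH x0 xc xo xr xp; have [P [dP iP]] := IH x0 xc xo xr xp.
  exists (fun R e => ~ P R e); split; first exact: def_not.
  by unpack; rewrite (iP _ _ _ gX Rdom R1 _ _ _ _ _ _ S).
- move=> q1 IH1 q2 IH2 x0 xc xo xr xp; have [P1 [dP1 iP1]] := IH1 x0 xc xo xr xp.
  have [P2 [dP2 iP2]] := IH2 x0 xc xo xr xp.
  exists (fun R e => P1 R e /\ P2 R e); split; first exact: def_and.
  by unpack; rewrite (iP1 _ _ _ gX Rdom R1 _ _ _ _ _ _ S) (iP2 _ _ _ gX Rdom R1 _ _ _ _ _ _ S).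
- move=> q1 IH1 q2 IH2 x0 xc xo xr xp; have [P1 [dP1 iP1]] := IH1 x0 xc xo xr xp.
  have [P2 [dP2 iP2]] := IH2 x0 xc xo xr xp.
  exists (fun R e => P1 R e \/ P2 R e); split; first exact: def_or.
  by unpack; rewrite (iP1 _ _ _ gX Rdom R1 _ _ _ _ _ _ S) (iP2 _ _ _ gX Rdom R1 _ _ _ _ _ _ S).
- move=> q1 IH1 q2 IH2 x0 xc xo xr xp; have [P1 [dP1 iP1]] := IH1 x0 xc xo xr xp.
  have [P2 [dP2 iP2]] := IH2 x0 xc xo xr xp.
  exists (fun R e => P1 R e -> P2 R e); split; first exact: def_imp.
  by unpack; rewrite (iP1 _ _ _ gX Rdom R1 _ _ _ _ _ _ S) (iP2 _ _ _ gX Rdom R1 _ _ _ _ _ _ S).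
- move=> q IH x0 xc xo xr xp.
  have [P [dP iP]] := IH (1 + x0)%N (fun i => 1 + xc i)%N (fun i => 1 + xo i)%N
    (env_cons 0 (fun i => 1 + xr i))%N (fun i => 1 + xp i)%N.
  (* [H] guards the quantified block: ring elements are endomorphisms of the generator, which the
     new block has moved by one position. *)
  pose H : uprop := fun R e => hom (e (1 + x0)%N) (e (1 + x0)%N) (e 0%N).
  have dH : definable H by exact: def_hom.
  have HU R e U : H R (pushn 1 U e) <-> hom (e x0) (e x0) (U 0%N).
    by rewrite /H !pushn_add.
  exists (fun R e => forall U, H R (pushn 1 U e) -> P R (pushn 1 U e)).
  split; first by apply: (@def_pushn_all 1 (fun R e => H R e -> P R e)); exact: def_imp.
  unpack; split=> [h s|h U]; last first.
    move=> /HU/(ring_arrows S)[s U0].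
    by apply/(iP _ _ _ gX Rdom R1 _ _ _ _ _ _ (sim_push_ring S U0)); apply: h.
  pose U (_ : nat) := rarr gX s; have U0 : U 0%N = rarr gX s by [].
  apply/(iP _ _ _ gX Rdom R1 _ _ _ _ _ _ (sim_push_ring S U0)); apply: (h U).
  by apply/HU/(ring_arrows S); exists s.
- move=> q IH x0 xc xo xr xp.
  have [P [dP iP]] := IH (1 + x0)%N (fun i => 1 + xc i)%N (fun i => 1 + xo i)%N
    (env_cons 0 (fun i => 1 + xr i))%N (fun i => 1 + xp i)%N.
  pose H : uprop := fun R e => hom (e (1 + x0)%N) (e (1 + x0)%N) (e 0%N).
  have dH : definable H by exact: def_hom.
  have HU R e U : H R (pushn 1 U e) <-> hom (e x0) (e x0) (U 0%N).
    by rewrite /H !pushn_add.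
  exists (fun R e => exists U, H R (pushn 1 U e) /\ P R (pushn 1 U e)).
  split; first by apply: (@def_pushn_ex 1 (fun R e => H R e /\ P R e)); exact: def_and.
  unpack; split=> [[U []]|[s h]].
    move=> /HU/(ring_arrows S)[s U0].
    by move=> /(iP _ _ _ gX Rdom R1 _ _ _ _ _ _ (sim_push_ring S U0)); exists s.
  pose U (_ : nat) := rarr gX s; have U0 : U 0%N = rarr gX s by [].
  exists U; split.
    by apply/HU/(ring_arrows S); exists s.
  exact/(iP _ _ _ gX Rdom R1 _ _ _ _ _ _ (sim_push_ring S U0)).
- move=> q IH x0 xc xo xr xp.
  have [P [dP iP]] := IH (12 + x0)%N (env_cons 0 (fun i => 12 + xc i))%N
    (fun i => 12 + xo i)%N (fun i => 12 + xr i)%N (fun i => 12 + xp i)%N.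
  pose H : uprop := fun R e => isCard (e (12 + x0)%N) (fun m => e m).
  have dH : definable H by exact: def_isCard.
  have HU R e U : H R (pushn 12 U e) <-> isCard (e x0) U.
    by rewrite /H pushn_add; split=> h; apply: (isCard_ext (n := 12)) h => // i lt;
      rewrite pushn_lt.
  exists (fun R e => forall U, H R (pushn 12 U e) -> P R (pushn 12 U e)).
  split; first by apply: (@def_pushn_all 12 (fun R e => H R e -> P R e)); exact: def_imp.
  unpack; split=> [h k kc|h U]; last first.
    move=> /HU/(card_arrows Rdom R1 S)[k kc [u [Uu ek]]].
    apply/(iP _ _ _ gX Rdom R1 _ _ _ _ _ _ (sim_push_card S Uu)).
    by rewrite -ek; apply: h.
  have [w ew] := ord_rep k; have [U [u [Uu eu]]] := coded_card gX Rdom R1 w.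
  have ek : k = ot (pw u) by rewrite eu.
  rewrite ek; apply/(iP _ _ _ gX Rdom R1 _ _ _ _ _ _ (sim_push_card S Uu)); apply: h.
  by apply/HU/(card_arrows Rdom R1 S); exists k => //; exists u.
- move=> q IH x0 xc xo xr xp.
  have [P [dP iP]] := IH (12 + x0)%N (env_cons 0 (fun i => 12 + xc i))%N
    (fun i => 12 + xo i)%N (fun i => 12 + xr i)%N (fun i => 12 + xp i)%N.
  pose H : uprop := fun R e => isCard (e (12 + x0)%N) (fun m => e m).
  have dH : definable H by exact: def_isCard.
  have HU R e U : H R (pushn 12 U e) <-> isCard (e x0) U.
    by rewrite /H pushn_add; split=> h; apply: (isCard_ext (n := 12)) h => // i lt;
      rewrite pushn_lt.
  exists (fun R e => exists U, H R (pushn 12 U e) /\ P R (pushn 12 U e)).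
  split; first by apply: (@def_pushn_ex 12 (fun R e => H R e /\ P R e)); exact: def_and.
  unpack; split=> [[U []]|[k kc h]].
    move=> /HU/(card_arrows Rdom R1 S)[k kc [u [Uu ek]]].
    move=> /(iP _ _ _ gX Rdom R1 _ _ _ _ _ _ (sim_push_card S Uu)).
    by rewrite -ek; exists k.
  have [w ew] := ord_rep k; have [U [u [Uu eu]]] := coded_card gX Rdom R1 w.
  have ek : k = ot (pw u) by rewrite eu.
  exists U; split; last first.
    by apply/(iP _ _ _ gX Rdom R1 _ _ _ _ _ _ (sim_push_card S Uu)); rewrite -ek.
  by apply/HU/(card_arrows Rdom R1 S); exists k => //; exists u.
- move=> k q IH x0 xc xo xr xp.
  have [P [dP iP]] := IH (1 + x0)%N (fun i => 1 + xc i)%N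
    (env_cons 0 (fun i => 1 + xo i))%N (fun i => 1 + xr i)%N (fun i => 1 + xp i)%N.
  pose H : uprop := fun R e => point (e (1 + x0)%N) (fun m => e (1 + (xc k + m))%N) (e 0%N).
  have dH : definable H by exact: def_point.
  have HU R e U : H R (pushn 1 U e) <-> point (e x0) (fun m => e (xc k + m)%N) (U 0%N).
    by rewrite /H /point !pushn_add.
  exists (fun R e => forall U, H R (pushn 1 U e) -> P R (pushn 1 U e)).
  split; first by apply: (@def_pushn_all 1 (fun R e => H R e -> P R e)); exact: def_imp.
  unpack; split=> [h al ak|h U]; last first.
    move=> /HU/(ordinal_arrows S)[al ak U0].
    by apply/(iP _ _ _ gX Rdom R1 _ _ _ _ _ _ (sim_push_ord S U0)); apply: h.
  have [pk ek] := sim_card S k; rewrite ek in ak; have [x xP] := (ordpt_lt _ _).1 ak.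
  apply/(iP _ _ _ gX Rdom R1 _ _ _ _ _ _ (sim_push_ord (U := fun=> x) S xP)); apply: h.
  by apply/HU/(ordinal_arrows S); exists al; rewrite ?ek.
- move=> k q IH x0 xc xo xr xp.
  have [P [dP iP]] := IH (1 + x0)%N (fun i => 1 + xc i)%N
    (env_cons 0 (fun i => 1 + xo i))%N (fun i => 1 + xr i)%N (fun i => 1 + xp i)%N.
  pose H : uprop := fun R e => point (e (1 + x0)%N) (fun m => e (1 + (xc k + m))%N) (e 0%N).
  have dH : definable H by exact: def_point.
  have HU R e U : H R (pushn 1 U e) <-> point (e x0) (fun m => e (xc k + m)%N) (U 0%N).
    by rewrite /H /point !pushn_add.
  exists (fun R e => exists U, H R (pushn 1 U e) /\ P R (pushn 1 U e)).
  split; first by apply: (@def_pushn_ex 1 (fun R e => H R e /\ P R e)); exact: def_and.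
  unpack; split=> [[U []]|[al ak h]].
    move=> /HU/(ordinal_arrows S)[al ak U0].
    by move=> /(iP _ _ _ gX Rdom R1 _ _ _ _ _ _ (sim_push_ord S U0)); exists al.
  have [pk ek] := sim_card S k; rewrite ek in ak; have [x xP] := (ordpt_lt _ _).1 ak.
  exists (fun=> x); split.
    by apply/HU/(ordinal_arrows S); exists al; rewrite ?ek.
  by apply/(iP _ _ _ gX Rdom R1 _ _ _ _ _ _ (sim_push_ord (U := fun=> x) S xP)).
- move=> s q IH x0 xc xo xr xp; pose n := (5 + oarity s + rarity s)%N.
  have [P [dP iP]] := IH (n + x0)%N (fun i => n + xc i)%N (fun i => n + xo i)%N
    (fun i => n + xr i)%N (env_cons 0 (fun i => n + xp i))%N.
  exists (fun R e => forall U, P R (pushn n U e)).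
  split; first exact: (def_pushn_all n).
  unpack; split=> [h Q Qw|h U].
    have [U UP] := pvar_code Rdom R1 S Q.
    by apply/(iP _ _ _ gX Rdom R1 _ _ _ _ _ _ (sim_push_pvar S UP)).
  have [Q Qw UP] := code_pvar S s U.
  by apply/(iP _ _ _ gX Rdom R1 _ _ _ _ _ _ (sim_push_pvar S UP)); apply: h.
- move=> s q IH x0 xc xo xr xp; pose n := (5 + oarity s + rarity s)%N.
  have [P [dP iP]] := IH (n + x0)%N (fun i => n + xc i)%N (fun i => n + xo i)%N
    (fun i => n + xr i)%N (env_cons 0 (fun i => n + xp i))%N.
  exists (fun R e => exists U, P R (pushn n U e)).
  split; first exact: (def_pushn_ex n).
  unpack; split=> [[U h]|[Q Qw h]].
    have [Q Qw UP] := code_pvar S s U.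
    by exists Q => //; apply/(iP _ _ _ gX Rdom R1 _ _ _ _ _ _ (sim_push_pvar S UP)).
  have [U UP] := pvar_code Rdom R1 S Q; exists U.
  by apply/(iP _ _ _ gX Rdom R1 _ _ _ _ _ _ (sim_push_pvar S UP)).
Qed.
End Translate.

(** * Sentences, the zero ring, and the first direction *)

Lemma close_formula n (p : cat_formula 0 n) : exists p0 : cat_formula 0 0,
  forall R, cat_true (mod_cat R) p0 <->
    forall e, @cat_holds (mod_cat R) 0 n p (@no_var _) (ordenv e n).
Proof.
elim: n p => [|n IH] p.
  exists p => R; rewrite /cat_true; split=> [h e|/(_ (fun=> idA R^o))].
    by rewrite (no_var_unique (ordenv e 0)).
  by rewrite (no_var_unique (ordenv _ 0)).
have [p0 p0P] := IH (CatAllMor p); exists p0 => R; rewrite p0P.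
split=> [h e|h e f]; last by rewrite env_cons_ordenv; apply: h.
have := h (fun i => e i.+1) (e 0%N); rewrite env_cons_ordenv.
by congr cat_holds; apply: funext => -[[|i] lt].
Qed.

Lemma definable_sentence (P : uprop) : definable P -> exists p : cat_formula 0 0,
  forall R, cat_true (mod_cat R) p <-> forall e, P R e.
Proof.
move=> [n H]; have [p pP] := H n (leqnn n); have [p0 p0P] := close_formula p.
by exists p0 => R; rewrite p0P; split=> h e; apply/pP.
Qed.

(** The sentence says that parallel arrows are equal; on the regular module, the identity and zero
    agree only if [1 = 0]. *)
Lemma trivial_sentence : exists p : cat_formula 0 0, forall R : pzRingType,
  cat_true (mod_cat R) p <-> (1 : R) = 0.
Proof.
have dT : definable (fun R _ => forall a b f h : mod_arrow R,
    hom a b f -> hom a b h -> f = h).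
  by repeat (apply: def_hom || def_step).
have [p pP] := definable_sentence dT.
exists p => R; rewrite pP; split=> [/(_ (fun=> idA R^o)) h|e10 _ a b f h [fa fb] [ha hb]].
  have /arrow_inj e : idA R^o = ModArrow (\0 : {linear R^o -> R^o}).
    by apply: (h (idA R^o) (idA R^o)); apply/hom_arrow; eexists.
  by have := congr1 (fun u : {linear R^o -> R^o} => u 1) e.
have [e1 _ _] := cmp_dom fa; have [e2 _ _] := cmp_dom ha.
have [_ _ e3] := cmp_dom fb; have [_ _ e4] := cmp_dom hb.
have {}e1 : mod_dom h = mod_dom f by rewrite -e1 -e2.
have {}e3 : mod_cod h = mod_cod f by rewrite e4 -e3.
case: f h {fa fb ha hb e2 e4} e1 e3 => A C u [A' C' v] /= e1 e3; subst A' C'.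
by apply: arrow_eq => x; rewrite -[u x]scale1r -[v x]scale1r e10 !scale0r.
Qed.

(** The generator is a parameter that can be quantified away: one exists, and by [interpret] every
    choice gives the same truth value. *)
Lemma L2_sentence_cat (q : L2_sentence) : exists p : cat_formula 0 0,
  forall R, is_integral_domain R -> (1 : R) <> 0 ->
  (cat_true (mod_cat R) p <-> L2_true R q).
Proof.
have [P [dP iP]] := interpret q 0 (@no_var _) (@no_var _) (@no_var _) (@no_var _).
have dQ : definable (fun R e => exists f, generator f /\ P R (push f e)).
  apply: def_ex; apply: def_and; first exact: def_generator.
  apply: definable_ext dP => R e.
  by rewrite (_ : push _ _ = e) //; apply: funext => -[|i].
have [p' pP] := definable_sentence dQ.
exists p' => R RD /eqP R1; rewrite pP.
have key e f : generator f -> (P R (push f e) <-> L2_true R q).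
  move=> /(generator_free RD)[X [g [-> gX]]].
  apply: (iP R X g gX RD.1 R1 _ (@no_var _)); split=> // -[[|i] //].
split=> [/(_ (fun=> idA R^o))[f [/key h /h//]]|h e].
have gR := generator_regular RD.
by exists (idA R^o); split=> //; apply/key.
Qed.

(** This settles the zero rings, over which sets cannot be coded by arrows. *)
Lemma L2_holds_iso (R S : pzRingType) (f : R -> S) : bijective f ->
  {morph f : x y / x + y} -> {morph f : x y / x * y} ->
  forall c o r p (so : 'I_o -> 'I_c) (sp : 'I_p -> pvar_sort c) (q : L2_formula r so sp)
    ec eo er ep er' ep', (forall i, er' i = f (er i)) ->
    (forall j al xs, ep' j al (fun i => f (xs i)) <-> ep j al xs) ->
  (@L2_holds R c o r p so sp q ec eo er ep <-> @L2_holds S c o r p so sp q ec eo er' ep').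
Proof.
move=> [h fK hK] fD fM c o r p so sp q; have fI := can_inj fK.
have cons_er r' (er : 'I_r' -> R) er' x : (forall i, er' i = f (er i)) ->
    forall i, env_cons (f x) er' i = f (env_cons x er i).
  by move=> e [[|i] lt] /=.
elim: c o r p so sp / q => c o r p so sp.
- by move=> x y z ec eo er ep er' ep' e1 e2 /=; rewrite !e1 -fD; split=> [->|/fI].
- by move=> x y z ec eo er ep er' ep' e1 e2 /=; rewrite !e1 -fM; split=> [->|/fI].
- by move=> x y ec eo er ep er' ep' e1 e2 /=; rewrite !e1; split=> [->|/fI].
- by [].
- by [].
- move=> P al xs sal ec eo er ep er' ep' e1 e2 /=; rewrite -e2.
  by rewrite (_ : (fun i => er' _) = (fun i => f (er (xs i)))) //; apply: funext => i.
- by move=> q IH ec eo er ep er' ep' e1 e2 /=; rewrite (IH _ _ _ _ _ _ e1 e2).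
- move=> q1 IH1 q2 IH2 ec eo er ep er' ep' e1 e2 /=.
  by rewrite (IH1 _ _ _ _ _ _ e1 e2) (IH2 _ _ _ _ _ _ e1 e2).
- move=> q1 IH1 q2 IH2 ec eo er ep er' ep' e1 e2 /=.
  by rewrite (IH1 _ _ _ _ _ _ e1 e2) (IH2 _ _ _ _ _ _ e1 e2).
- move=> q1 IH1 q2 IH2 ec eo er ep er' ep' e1 e2 /=.
  by rewrite (IH1 _ _ _ _ _ _ e1 e2) (IH2 _ _ _ _ _ _ e1 e2).
- move=> q IH ec eo er ep er' ep' e1 e2 /=; split=> H x.
    by have := H (h x); rewrite (IH _ _ _ _ _ _ (cons_er _ _ _ _ e1) e2) hK.
  by apply/(IH _ _ _ _ _ _ (cons_er _ _ _ _ e1) e2); apply: H.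
- move=> q IH ec eo er ep er' ep' e1 e2 /=; split=> -[x H].
    by exists (f x); apply/(IH _ _ _ _ _ _ (cons_er _ _ _ _ e1) e2).
  by exists (h x); apply/(IH _ _ _ _ _ _ (cons_er _ _ _ _ e1) e2); rewrite hK.
- move=> q IH ec eo er ep er' ep' e1 e2 /=.
  by split=> H k kc; apply/(IH _ _ _ _ _ _ e1 e2); apply: H.
- move=> q IH ec eo er ep er' ep' e1 e2 /=.
  by split=> -[k kc H]; exists k => //; apply/(IH _ _ _ _ _ _ e1 e2); apply: H.
- move=> k q IH ec eo er ep er' ep' e1 e2 /=.
  by split=> H al alk; apply/(IH _ _ _ _ _ _ e1 e2); apply: H.
- move=> k q IH ec eo er ep er' ep' e1 e2 /=.
  by split=> -[al alk H]; exists al => //; apply/(IH _ _ _ _ _ _ e1 e2); apply: H.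
- move=> s q IH ec eo er ep er' ep' e1 e2 /=; split=> H P Pw.
    apply/(IH _ _ er (penv_cons (fun al xs => P al (fun i => f (xs i))) ep)) => //.
      by move=> [[|j] lt] al xs //=; apply: e2.
    by apply: H => al xs; apply: Pw.
  apply/(IH _ _ _ _ er' (penv_cons (fun al ys => P al (fun i => h (ys i))) ep')) => //.
    move=> [[|j] lt] al xs /=; last exact: e2.
    by rewrite (_ : (fun i => h _) = xs) //; apply: funext => i; rewrite fK.
  by apply: H => al ys; apply: Pw.
- move=> s q IH ec eo er ep er' ep' e1 e2 /=; split=> -[P Pw H].
    exists (fun al ys => P al (fun i => h (ys i))); first by move=> al ys; apply: Pw.
    apply/(IH _ _ er (penv_cons P ep)) => //.
    move=> [[|j] lt] al xs /=; last exact: e2.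
    by rewrite (_ : (fun i => h _) = xs) //; apply: funext => i; rewrite fK.
  exists (fun al xs => P al (fun i => f (xs i))); first by move=> al xs; apply: Pw.
  apply/(IH _ _ _ _ er' (penv_cons P ep')) => //.
  by move=> [[|j] lt] al xs //=; apply: e2.
Qed.

Lemma trivial_L2 (R S : pzRingType) : (1 : R) = 0 -> (1 : S) = 0 -> L2_equivalent R S.
Proof.
move=> R0 S0 q; have z (T : pzRingType) (x : T) : 1 = 0 :> T -> x = 0.
  by move=> e; rewrite -[x]mulr1 e mulr0.
have fb : bijective (fun _ : R => 0 : S).
  by exists (fun _ : S => 0 : R) => x; symmetry; apply: z.
apply: (L2_holds_iso fb) => // [x y|x y|[]|[]] //=; by rewrite ?addr0 ?mulr0.
Qed.

Theorem cat_to_L2 (R S : pzRingType) : is_integral_domain R -> is_integral_domain S ->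
  elementarily_equivalent (mod_cat R) (mod_cat S) -> L2_equivalent R S.
Proof.
move=> RD SD eRS; have [p0 p0P] := trivial_sentence.
have t : (1 : R) = 0 <-> (1 : S) = 0 by rewrite -!p0P; apply: eRS.
case: (pselect ((1 : R) = 0)) => [R0|R1]; first by apply: trivial_L2 => //; apply/t.
have S1 : (1 : S) <> 0 by move/t.
by move=> q; have [p pP] := L2_sentence_cat q; rewrite -!pP.
Qed.

(** * The category of modules on cardinals *)

(* A category equivalent to a full subcategory of mod-R, presented with copies *)
(* of its objects: objects lie over modules and each Hom-set is that of the    *)
(* modules below.                                                              *)
Record blowup (R : pzRingType) (C : cat_structure) := Blowup {
  base : Ob C -> lmodType R;
  bdom : Mor C -> Ob C;
  bcod : Mor C -> Ob C;
  core : Mor C -> mod_arrow R;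
  core_dom : forall f, mod_dom (core f) = base (bdom f);
  core_cod : forall f, mod_cod (core f) = base (bcod f);
  core_inj : forall f g, bdom f = bdom g -> bcod f = bcod g -> core f = core g -> f = g;
  core_surj : forall X Y h, mod_dom h = base X -> mod_cod h = base Y ->
    exists f, [/\ bdom f = X, bcod f = Y & core f = h];
  blow_mor : forall f X Y, isMor f X Y <-> bdom f = X /\ bcod f = Y;
  blow_comp : forall h f g, isComp h f g <->
    [/\ bcod g = bdom f, bdom h = bdom g, bcod h = bcod f &
        mod_isComp (core h) (core f) (core g)];
  blow_id : forall f X, isId f X <->
    [/\ bdom f = X, bcod f = X & core f = idA (base X)]
}.

(** * Back-and-forth between categories over the same modules *)

Section BackAndForth.
Variables (R : pzRingType).

(** Since equality of objects is in the language, equivalent categories may be told apart by their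
    numbers of isomorphic copies. Here fresh copies never run out. *)
Definition inexhaustible C D (A : blowup R C) (B : blowup R D) :=
  forall X (s : list (Ob D)), exists Y, base B Y = base A X /\ ~ List.In Y s.

Section Match.
Variables (C D : cat_structure) (A : blowup R C) (B : blowup R D).

Definition coherent (s : list (Ob C * Ob D)) := forall p q, List.In p s -> List.In q s ->
  (p.1 = q.1 <-> p.2 = q.2) /\ base A p.1 = base B p.2.

Lemma coherent_extend s X : inexhaustible A B -> coherent s ->
  exists Y, coherent ((X, Y) :: s).
Proof.
move=> ex coh; case: (pselect (exists Y, List.In (X, Y) s)) => [[Y XY]|n].
  exists Y => p q [<-|ps] [<-|qs] /=; [split=> //; exact: (coh _ _ XY XY).2| | |].
  - by split; [exact: (coh _ _ XY qs).1 | exact: (coh _ _ XY XY).2].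
  - by have := coh _ _ ps XY.
  - exact: coh.
have [Y [YX nY]] := ex X (List.map snd s).
have sep p : List.In p s -> (p.1 <> X) /\ (p.2 <> Y).
  case: p => Z W ps; split=> /= e; subst; first by apply: n; exists W.
  by apply: nY; exact: (List.in_map snd _ _ ps).
exists Y => p q [<-|ps] [<-|qs] /=.
- by [].
- by have [h1 h2] := sep _ qs; split=> //; split=> e; [case: h1|case: h2]; rewrite e.
- have [h1 h2] := sep _ ps; split; last exact: (coh _ _ ps ps).2.
  by split=> e; [case: h1|case: h2]; rewrite e.
- exact: coh.
Qed.

Definition matched n m (eo : 'I_n -> Ob C) (em : 'I_m -> Mor C)
    (eo' : 'I_n -> Ob D) (em' : 'I_m -> Mor D) (s : list (Ob C * Ob D)) :=
  [/\ coherent s, forall i, List.In (eo i, eo' i) s &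
      forall i, [/\ List.In (bdom A (em i), bdom B (em' i)) s,
        List.In (bcod A (em i), bcod B (em' i)) s & core A (em i) = core B (em' i)]].

Lemma matched_ob n m eo em eo' em' s X Y : @matched n m eo em eo' em' s ->
  coherent ((X, Y) :: s) -> matched (env_cons X eo) em (env_cons Y eo') em' ((X, Y) :: s).
Proof.
move=> [_ so sm] coh; split=> // [[[|i] lt]|i] /=; [by left|right; exact: so|].
by have [h1 h2 h3] := sm i; split=> //; right.
Qed.

Lemma matched_mor n m eo em eo' em' s f g : @matched n m eo em eo' em' s ->
  coherent ((bdom A f, bdom B g) :: (bcod A f, bcod B g) :: s) -> core A f = core B g ->
  matched eo (env_cons f em) eo' (env_cons g em')
    ((bdom A f, bdom B g) :: (bcod A f, bcod B g) :: s).
Proof.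
move=> [_ so sm] coh e; split=> // [i|[[|i] lt]] /=; first by right; right.
  by split=> //; [left | right; left].
by have [h1 h2 h3] := sm (Ordinal (lt : (i < m)%N)); split=> //; right; right.
Qed.

Lemma extend_mor s f : inexhaustible A B -> coherent s -> exists g,
  coherent ((bdom A f, bdom B g) :: (bcod A f, bcod B g) :: s) /\ core A f = core B g.
Proof.
move=> ex coh; have [Y cohY] := coherent_extend (bcod A f) ex coh.
have [X cohX] := coherent_extend (bdom A f) ex cohY.
have [_ eX] := cohX _ _ (or_introl erefl) (or_introl erefl).
have [_ eY] := cohY _ _ (or_introl erefl) (or_introl erefl).
have [|| g [gX gY e]] := core_surj (b := B) (X := X) (Y := Y) (h := core A f).
- by rewrite core_dom.
- by rewrite core_cod.
by exists g; rewrite gX gY.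
Qed.
End Match.

Lemma coherent_flip C D (A : blowup R C) (B : blowup R D) s :
  coherent A B s -> coherent B A (List.map (fun p => (p.2, p.1)) s).
Proof.
move=> coh p q /List.in_map_iff[[x y] [<- xs]] /List.in_map_iff[[z t] [<- zs]] /=.
by have [/= h1 h2] := coh _ _ xs zs; split=> //; symmetry.
Qed.

Lemma coherent_unflip C D (A : blowup R C) (B : blowup R D) s :
  coherent B A (List.map (fun p => (p.2, p.1)) s) -> coherent A B s.
Proof.
move=> /coherent_flip; rewrite List.map_map (_ : List.map _ s = s) //.
by elim: s => //= -[x y] s ->.
Qed.

(** A finite matching of objects with equal bases extends by any object on either side. For an
    arrow, its endpoints are matched first; its counterpart is then the arrow between them with the
    same core. Truth is preserved along such matchings by induction on formulas. *)
Lemma back_and_forth C D (A : blowup R C) (B : blowup R D) :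
  inexhaustible A B -> inexhaustible B A -> elementarily_equivalent C D.
Proof.
move=> AB BA.
suff main n m (p : cat_formula n m) : forall eo em eo' em' s, matched A B eo em eo' em' s ->
    (cat_holds p eo em <-> cat_holds p eo' em').
  by move=> p; apply: (main _ _ _ _ _ _ _ nil); split=> // -[].
have ob_eq s X X' Y Y' : coherent A B s -> List.In (X, Y) s -> List.In (X', Y') s ->
    (X = X' <-> Y = Y').
  by move=> coh h h'; have [] := coh _ _ h h'.
have base_eq s X Y : coherent A B s -> List.In (X, Y) s -> base A X = base B Y.
  by move=> coh h; have [] := coh _ _ h h.
elim: n m / p => n m.
- by move=> X Y eo em eo' em' s [coh so _] /=; exact: (ob_eq _ _ _ _ _ coh (so X) (so Y)).
- move=> f g eo em eo' em' s [coh so sm] /=.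
  have [f1 f2 f3] := sm f; have [g1 g2 g3] := sm g.
  split=> e.
    apply: (core_inj (b := B)); last by rewrite -f3 -g3 e.
      by apply/(ob_eq _ _ _ _ _ coh f1 g1); rewrite e.
    by apply/(ob_eq _ _ _ _ _ coh f2 g2); rewrite e.
  apply: (core_inj (b := A)); last by rewrite f3 g3 e.
    by apply/(ob_eq _ _ _ _ _ coh f1 g1); rewrite e.
  by apply/(ob_eq _ _ _ _ _ coh f2 g2); rewrite e.
- move=> f X Y eo em eo' em' s [coh so sm] /=; have [f1 f2 f3] := sm f.
  by rewrite (blow_mor A) (blow_mor B) (ob_eq _ _ _ _ _ coh f1 (so X))
    (ob_eq _ _ _ _ _ coh f2 (so Y)).
- move=> h f g eo em eo' em' s [coh so sm] /=.
  have [f1 f2 f3] := sm f; have [g1 g2 g3] := sm g; have [h1 h2 h3] := sm h.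
  rewrite (blow_comp A) (blow_comp B) f3 g3 h3.
  by split=> -[e1 e2 e3 e4]; split=> //; [apply/(ob_eq _ _ _ _ _ coh g2 f1)
   |apply/(ob_eq _ _ _ _ _ coh h1 g1)|apply/(ob_eq _ _ _ _ _ coh h2 f2)
   |apply/(ob_eq _ _ _ _ _ coh g2 f1)|apply/(ob_eq _ _ _ _ _ coh h1 g1)
   |apply/(ob_eq _ _ _ _ _ coh h2 f2)].
- move=> f X eo em eo' em' s [coh so sm] /=; have [f1 f2 f3] := sm f.
  rewrite (blow_id A) (blow_id B) f3 (base_eq _ _ _ coh (so X)).
  by split=> -[e1 e2 e3]; split=> //; [apply/(ob_eq _ _ _ _ _ coh f1 (so X))
    |apply/(ob_eq _ _ _ _ _ coh f2 (so X))|apply/(ob_eq _ _ _ _ _ coh f1 (so X))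
    |apply/(ob_eq _ _ _ _ _ coh f2 (so X))].
- by move=> p IH eo em eo' em' s S /=; rewrite (IH _ _ _ _ _ S).
- by move=> p IHp q IHq eo em eo' em' s S /=; rewrite (IHp _ _ _ _ _ S) (IHq _ _ _ _ _ S).
- by move=> p IHp q IHq eo em eo' em' s S /=; rewrite (IHp _ _ _ _ _ S) (IHq _ _ _ _ _ S).
- by move=> p IHp q IHq eo em eo' em' s S /=; rewrite (IHp _ _ _ _ _ S) (IHq _ _ _ _ _ S).
- move=> p IH eo em eo' em' s S /=; have [coh so sm] := S; split=> h X.
    have [Y cY] := coherent_extend X BA (coherent_flip coh).
    have cohY := coherent_unflip (s := (Y, X) :: s) cY.
    by apply/(IH _ _ _ _ _ (matched_ob S cohY)).
  have [Y cohY] := coherent_extend X AB coh.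
  by apply/(IH _ _ _ _ _ (matched_ob S cohY)).
- move=> p IH eo em eo' em' s S /=; have [coh so sm] := S; split=> -[X h].
    have [Y cohY] := coherent_extend X AB coh.
    by exists Y; apply/(IH _ _ _ _ _ (matched_ob S cohY)).
  have [Y cY] := coherent_extend X BA (coherent_flip coh).
  have cohY := coherent_unflip (s := (Y, X) :: s) cY.
  by exists Y; apply/(IH _ _ _ _ _ (matched_ob S cohY)).
- move=> p IH eo em eo' em' s S /=; have [coh so sm] := S; split=> h f.
    have [g [cohg eg]] := extend_mor f BA (coherent_flip coh).
    by apply/(IH _ _ _ _ _ (matched_mor S (coherent_unflip (s := (_, _) :: (_, _) :: s) cohg)
      (esym eg))).
  have [g [cohg eg]] := extend_mor f AB coh.
  by apply/(IH _ _ _ _ _ (matched_mor S cohg eg)).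
- move=> p IH eo em eo' em' s S /=; have [coh so sm] := S; split=> -[f h].
    have [g [cohg eg]] := extend_mor f AB coh.
    by exists g; apply/(IH _ _ _ _ _ (matched_mor S cohg eg)).
  have [g [cohg eg]] := extend_mor f BA (coherent_flip coh).
  by exists g; apply/(IH _ _ _ _ _ (matched_mor S
    (coherent_unflip (s := (_, _) :: (_, _) :: s) cohg) (esym eg))).
Qed.
End BackAndForth.

(** * Representatives of isomorphism classes of modules *)

Section Representatives.
Variable R : pzRingType.

Definition mod_iso (M N : lmodType R) :=
  exists (u : {linear M -> N}) (v : {linear N -> M}), cancel u v /\ cancel v u.

Lemma mod_iso_refl M : mod_iso M M.
Proof. by exists idfun, idfun. Qed.

Lemma mod_iso_sym M N : mod_iso M N -> mod_iso N M.
Proof. by move=> [u [v [uK vK]]]; exists v, u. Qed.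

Lemma mod_iso_trans M N Q : mod_iso M N -> mod_iso N Q -> mod_iso M Q.
Proof.
move=> [u [v [uK vK]]] [u' [v' [uK' vK']]]; exists (u' \o u), (v \o v').
by split; apply: can_comp.
Qed.

Definition pick_of (P : lmodType R -> Prop) (e : exists M, P M) : lmodType R := sval (cid e).

(** The choice depends on the predicate alone. Isomorphic modules define the same isomorphism class,
    hence share one representative. *)
Lemma pick_of_eq (P Q : lmodType R -> Prop) (e : exists M, P M) (e' : exists M, Q M) :
  P = Q -> pick_of e = pick_of e'.
Proof. by move=> eq; subst Q; rewrite (Prop_irrelevance e e'). Qed.

Definition rep (M : lmodType R) : lmodType R :=
  pick_of (ex_intro (mod_iso M) M (mod_iso_refl M)).

Lemma rep_iso M : mod_iso M (rep M).
Proof. exact: (svalP (cid (ex_intro (mod_iso M) M (mod_iso_refl M)))). Qed.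

Lemma rep_eq M N : mod_iso M N -> rep M = rep N.
Proof.
move=> MN; apply: pick_of_eq; apply: funext => Q; apply/propext.
split; apply: mod_iso_trans => //; exact: mod_iso_sym.
Qed.

Definition to_rep (M : lmodType R) : {linear M -> rep M} := sval (cid (rep_iso M)).
Definition from_rep (M : lmodType R) : {linear rep M -> M} := sval (cid (svalP (cid (rep_iso M)))).
Lemma to_repK (M : lmodType R) : cancel (to_rep M) (from_rep M).
Proof. by have [] := svalP (cid (svalP (cid (rep_iso M)))). Qed.
Lemma from_repK (M : lmodType R) : cancel (from_rep M) (to_rep M).
Proof. by have [] := svalP (cid (svalP (cid (rep_iso M)))). Qed.

Definition rep_arrow (M N : lmodType R) (u : {linear M -> N}) : mod_arrow R :=
  @ModArrow R (rep M) (rep N) (to_rep N \o (u \o from_rep M)).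

Lemma rep_arrow_inj (M N : lmodType R) (u v : {linear M -> N}) : rep_arrow u = rep_arrow v -> u =1 v.
Proof.
move=> /arrow_eqfun e x; have := e (to_rep M x); rewrite /= to_repK.
exact: (can_inj (to_repK (M := N))).
Qed.

Lemma rep_arrow_surj (M N : lmodType R) h : mod_dom h = rep M -> mod_cod h = rep N ->
  exists u : {linear M -> N}, h = rep_arrow u.
Proof.
case: h => A B h /= eA eB; subst A B; exists (from_rep N \o (h \o to_rep M)).
by apply: arrow_eq => x /=; rewrite !from_repK.
Qed.

Lemma rep_arrow_comp (M N Q : lmodType R) (u : {linear N -> Q}) (v : {linear M -> N}) (w : {linear M -> Q}) :
  mod_isComp (rep_arrow w) (rep_arrow u) (rep_arrow v) <-> w =1 u \o v.
Proof.
rewrite cmpE; split=> [/arrow_eqfun e x|e].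
  have := e (to_rep M x); rewrite /= !to_repK.
  exact: (can_inj (to_repK (M := Q))).
by apply: arrow_eq => x; rewrite /= e /= to_repK.
Qed.

Lemma rep_arrow_id (M : lmodType R) (u : {linear M -> M}) : rep_arrow u = idA (rep M) <-> u =1 id.
Proof.
split=> [/arrow_eqfun e x|e]; last by apply: arrow_eq => x; rewrite /= e from_repK.
by have := e (to_rep M x); rewrite /= to_repK => /(can_inj (to_repK (M := M))).
Qed.

Definition mod_core (f : mod_arrow R) : mod_arrow R := rep_arrow (mod_map f).

Lemma mod_blowup : blowup R (mod_cat R).
Proof.
apply: (@Blowup R (mod_cat R) rep (@mod_dom R) (@mod_cod R) mod_core) => //.
- move=> [A B u] [A' B' v] /= eA eB; subst A' B'.
  by move=> /rep_arrow_inj/arrow_eq.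
- move=> M N h eM eN; have [u ->] := rep_arrow_surj eM eN.
  by exists (ModArrow u).
- move=> [P Q w] [N' Q' u] [M N v]; rewrite /= /mod_core /=; split.
    move=> hc; have [/= e1 e2 e3] := cmp_dom hc; subst; split=> //.
    by move: hc => /cmpE/arrow_eqfun e; apply/rep_arrow_comp.
  by move=> [? ? ?]; subst => /rep_arrow_comp e; apply/cmpE/arrow_eq.
- move=> [A B u] X; rewrite /= /mod_isId /mod_core /=; split.
    move=> hc; have [eA eB] := (congr1 (@mod_dom R) hc, congr1 (@mod_cod R) hc).
    rewrite /= in eA eB; subst; split=> //; apply/rep_arrow_id.
    by move/arrow_eqfun: hc.
  by move=> [? ?]; subst => /rep_arrow_id e; apply: arrow_eq.
Defined.
End Representatives.

(** Relations of all arities in one type, so that an environment is a plain sequence; [urel_within]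
    and [fits] restore the sorts. *)
Definition urel (R : Type) := seq ordnum -> seq R -> Prop.

(** * Modules carried by cardinals *)

Section CodedModules.
Variable R : pzRingType.

(* The carrier of M is identified by j with the set of ordinals below k.       *)
Record codes (k : ordnum) (P Q : urel R) (M : lmodType R) (j : M -> ordnum) : Prop := Codes {
  code_inj : injective j;
  code_im : forall al, ord_lt al k <-> exists x, j x = al;
  code_add : forall al rs, P al rs <-> exists x y, al = [:: j x; j y; j (x + y)] /\ rs = [::];
  code_scale : forall al rs, Q al rs <-> exists x r, al = [:: j x; j (r *: x)] /\ rs = [:: r]
}.

(* The cardinal ktag carries no information: it makes room for infinitely many *)
(* isomorphic copies of every module.                                          *)
Record kob := KOb {
  kcard : ordnum;
  ktag : ordnum;
  kadd : urel R;
  kscale : urel R;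
  kvalid : [/\ is_cardinal kcard, is_cardinal ktag &
    exists (M : lmodType R) (j : M -> ordnum), codes kcard kadd kscale j]
}.

Definition kmod (X : kob) : lmodType R := let: And3 _ _ e := kvalid X in sval (cid e).
Definition kpt (X : kob) : kmod X -> ordnum.
Proof. by rewrite /kmod; case: kvalid => _ _ e; exact: (sval (cid (svalP (cid e)))). Defined.
Lemma kptP X : codes (kcard X) (kadd X) (kscale X) (@kpt X).
Proof.
rewrite /kpt /kmod; case: X => k l P Q /= [? ? e].
exact: (svalP (cid (svalP (cid e)))).
Qed.

Definition is_graph (X Y : kob) (F : urel R) (u : {linear kmod X -> kmod Y}) :=
  forall al rs, F al rs <-> exists x, al = [:: kpt x; kpt (u x)] /\ rs = [::].

Record kmor := KMor {
  ksrc : kob;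
  ktgt : kob;
  kgraph : urel R;
  kgraphP : exists u, is_graph (X := ksrc) (Y := ktgt) kgraph u
}.

Definition kmap (f : kmor) : {linear kmod (ksrc f) -> kmod (ktgt f)} :=
  sval (cid (kgraphP f)).
Lemma kmapP f : is_graph (kgraph f) (kmap f).
Proof. exact: (svalP (cid (kgraphP f))). Qed.

Definition k_isMor f X Y := ksrc f = X /\ ktgt f = Y.
Definition k_isComp h f g := [/\ ktgt g = ksrc f, ksrc h = ksrc g, ktgt h = ktgt f &
  forall al ga, kgraph h [:: al; ga] [::] <->
    exists be, kgraph g [:: al; be] [::] /\ kgraph f [:: be; ga] [::]].
Definition k_isId f X := [/\ ksrc f = X, ktgt f = X &
  forall al be, kgraph f [:: al; be] [::] <-> ord_lt al (kcard X) /\ al = be].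

Definition kcat : cat_structure := @CatStructure kob kmor k_isMor k_isComp k_isId.

Lemma kob_ext X Y : kcard X = kcard Y -> ktag X = ktag Y -> kadd X = kadd Y ->
  kscale X = kscale Y -> X = Y.
Proof.
case: X Y => [k l P Q v] [k' l' P' Q' v'] /= *; subst.
by rewrite (Prop_irrelevance v v').
Qed.

Lemma urel_ext (F G : urel R) : (forall al rs, F al rs <-> G al rs) -> F = G.
Proof. by move=> e; apply: funext => al; apply: funext => rs; apply/propext. Qed.

Lemma kmor_ext f g : ksrc f = ksrc g -> ktgt f = ktgt g -> kgraph f = kgraph g -> f = g.
Proof.
case: f g => [X Y F v] [X' Y' F' v'] /= *; subst.
by rewrite (Prop_irrelevance v v').
Qed.

Lemma kpt_inj X : injective (@kpt X). Proof. exact: code_inj (kptP X). Qed.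

Lemma kgraphE f al be : kgraph f [:: al; be] [::] <->
  exists x, al = kpt x /\ be = kpt (kmap f x).
Proof.
rewrite (kmapP f); split=> [[x [[-> ->] _]]|[x [-> ->]]]; by exists x.
Qed.

Lemma kgraph_map f g : ksrc f = ksrc g -> ktgt f = ktgt g ->
  rep_arrow (kmap f) = rep_arrow (kmap g) -> f = g.
Proof.
move=> e1 e2 e3; apply: (kmor_ext e1 e2); apply: urel_ext => al rs.
rewrite (kmapP f) (kmapP g); move: (kmap f) (kmap g) e3.
rewrite e1 e2 => u v /rep_arrow_inj e.
by split=> -[x [-> ->]]; exists x; rewrite e.
Qed.

Lemma k_blowup : blowup R kcat.
Proof.
apply: (@Blowup R kcat (fun X => rep (kmod X)) ksrc ktgt (fun f => rep_arrow (kmap f))) => //.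
- exact: kgraph_map.
- move=> X Y h eX eY; have [u ->] := rep_arrow_surj eX eY.
  pose F : urel R := fun al rs => exists x, al = [:: kpt x; kpt (u x)] /\ rs = [::].
  have FP : exists v, is_graph (X := X) (Y := Y) F v by exists u.
  exists (KMor FP); split=> //; rewrite /rep_arrow.
  have eu : kmap (KMor FP) =1 u.
    move=> x; have /(kgraphE (KMor FP))[y [/kpt_inj <- /kpt_inj//]] :
      kgraph (KMor FP) [:: kpt x; kpt (u x)] [::] by exists x.
  by apply: arrow_eq => x /=; rewrite eu.
- move=> h f g; rewrite /= /k_isComp; split=> -[e1 e2 e3 e4]; split=> //.
    case: f g h e1 e2 e3 e4 => [Y Z F fP] [X Y' G gP] [X' Z' H hP] /= ? ? ?; subst => e.
    apply/rep_arrow_comp => x.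
    have /e[_ [/(kgraphE (KMor gP))[y [/kpt_inj <- ->]]]] : H [:: kpt x; kpt (kmap (KMor hP) x)] [::].
      by apply/(kgraphE (KMor hP)); exists x.
    by move=> /(kgraphE (KMor fP))[z [/kpt_inj <- /kpt_inj]].
  case: f g h e1 e2 e3 e4 => [Y Z F fP] [X Y' G gP] [X' Z' H hP] /= ? ? ?; subst.
  move=> /rep_arrow_comp e al ga; apply: iff_trans (kgraphE (KMor hP) _ _) _; split.
    move=> [x [-> ->]]; exists (kpt (kmap (KMor gP) x)).
    split; first by apply/(kgraphE (KMor gP)); exists x.
    by apply/(kgraphE (KMor fP)); exists (kmap (KMor gP) x); rewrite e.
  move=> [_ [/(kgraphE (KMor gP))[x [-> ->]] /(kgraphE (KMor fP))[y [/kpt_inj <- ->]]]].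
  by exists x; rewrite e.
- move=> f X; rewrite /= /k_isId; split=> -[e1 e2 e3]; split=> //.
    case: f e1 e2 e3 => [Y Z F fP] /= ? ?; subst => e.
    apply/rep_arrow_id => x.
    have /e[_ /kpt_inj//] : F [:: kpt x; kpt (kmap (KMor fP) x)] [::].
    by apply/(kgraphE (KMor fP)); exists x.
  case: f e1 e2 e3 => [Y Z F fP] /= ? ?; subst => /rep_arrow_id e al be.
  apply: iff_trans (kgraphE (KMor fP) _ _) _; split=> [[x [-> ->]]|[/(code_im (kptP X))[x <-] <-]].
    by rewrite e; split=> //; apply/(code_im (kptP X)); exists x.
  by exists x; rewrite e.
Defined.

(** Both carriers are enumerated by the ordinals below [k]; matching elements with the same code is
    linear because the operations have common graphs. *)
Lemma codes_iso k P Q (M N : lmodType R) (j : M -> ordnum) (j' : N -> ordnum) :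
  codes k P Q j -> codes k P Q j' -> mod_iso M N.
Proof.
move=> c c'; have /choice[u uP] x : exists y, j' y = j x.
  by apply/(code_im c')/(code_im c); exists x.
have /choice[v vP] y : exists x, j x = j' y.
  by apply/(code_im c)/(code_im c'); exists y.
have uK : cancel u v by move=> x; apply: (code_inj c); rewrite vP uP.
have vK : cancel v u by move=> x; apply: (code_inj c'); rewrite uP vP.
have lin : linear u.
  move=> a x y; apply: (code_inj c').
  have /(code_scale c')[z [b [[h1 h2] [hb]]]] : Q [:: j x; j (a *: x)] [:: a].
    by apply/(code_scale c); exists x, a.
  have /(code_add c')[z1 [z2 [[h3 h4 h5] _]]] : P [:: j (a *: x); j y; j (a *: x + y)] [::].
    by apply/(code_add c); exists (a *: x), y.
  rewrite uP h5; congr (j' (_ + _)); apply: (code_inj c').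
    by rewrite -h3 h2 hb; congr (j' (_ *: _)); apply: (code_inj c'); rewrite uP.
  by rewrite -h4 uP.
have linv : linear v.
  by move=> a x y; rewrite -{1}[x]vK -{1}[y]vK -lin uK.
pose uL := GRing.isLinear.Build R M N _ u lin.
pose vL := GRing.isLinear.Build R N M _ v linv.
pose u' : {linear M -> N} := HB.pack u uL.
pose v' : {linear N -> M} := HB.pack v vL.
by exists u', v'.
Qed.

Lemma codes_exist (M : lmodType R) : exists k P Q (j : M -> ordnum),
  is_cardinal k /\ codes k P Q j.
Proof.
have [w [wc [f [h fK hK]]]] := cardinal_exists M.
pose j x := ot (seg (f x)); exists (ot w).
exists (fun al rs => exists x y, al = [:: j x; j y; j (x + y)] /\ rs = [::]).
exists (fun al rs => exists x r, al = [:: j x; j (r *: x)] /\ rs = [:: r]).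
exists j; split=> //; split=> // [x y /ot_seg_inj/(can_inj fK)//|al].
rewrite ord_lt_ot; split=> [[z ->]|[x <-]]; last by exists (f x).
by exists (h z); rewrite /j hK.
Qed.

Lemma escape (T : Type) (f : nat -> T) (s : list T) : injective f -> exists n, ~ List.In (f n) s.
Proof.
elim: s f => [|x s IH] f fI; first by exists 0%N => -[].
case: (pselect (exists m, f m = x)) => [[m fm]|n].
  have [|n nP] := IH (fun n => f (m.+1 + n)%N).
    by move=> a b /fI/eqP; rewrite eqn_add2l => /eqP.
  exists (m.+1 + n)%N => -[e|//].
  by have /fI/eqP := etrans fm e; rewrite -[X in X == _]addn0 addSnnS eqn_add2l.
have [n' n'P] := IH f fI; exists n' => -[e|//]; by apply: n; exists n'.
Qed.

(** The finite cardinals suffice; they serve as tags. *)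
Lemma infinitely_many_cardinals : exists f : nat -> ordnum,
  injective f /\ forall n, is_cardinal (f n).
Proof.
have /choice[w wP] n := cardinal_exists 'I_n.
exists (fun n => ot (w n)); split=> [m n /ot_eq[f fb _]|n]; last by have [] := wP n.
have [_ [g gb]] := wP m; have [_ [h [k hK kK]]] := wP n.
have kb : bijective k by exists h.
have := bij_eq_card (bij_comp kb (bij_comp fb gb)).
by rewrite !card_ord.
Qed.

(** Fresh copies of an object differ by their tag in [kcat], and by the delay of their choice
    structure in mod-R. *)
Theorem kcat_equivalent : elementarily_equivalent (mod_cat R) kcat.
Proof.
apply: (back_and_forth (A := mod_blowup R) (B := k_blowup)).
  move=> M s; have [k [P [Q [j [kc jP]]]]] := codes_exist M.
  have [f [fI fc]] := infinitely_many_cardinals.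
  have v n : [/\ is_cardinal k, is_cardinal (f n) &
      exists (M : lmodType R) (j : M -> ordnum), codes k P Q j].
    by split=> //; exists M, j.
  have [|n nP] := @escape kob (fun n => KOb (v n)) s.
    by move=> m n /(congr1 ktag)/fI.
  exists (KOb (v n)); split=> //; apply: rep_eq.
  exact: (codes_iso (kptP (KOb (v n))) jP).
move=> X s; have [|n nP] := @escape (lmodType R) (fun n => mkmod n (data_of (kmod X))) s.
  move=> m n e; have h := mkmod_delay m (data_of (kmod X)); rewrite e in h.
  exact: find_delay_inj h (mkmod_delay n _).
exists (mkmod n (data_of (kmod X))); split=> //; apply: rep_eq.
by exists (@of_copy R (kmod X) n), (@to_copy R (kmod X) n).
Qed.
End CodedModules.

(** * Definability in L2 *)

Fixpoint below (al Ks : seq ordnum) : Prop :=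
  match al, Ks with
  | [::], [::] => True
  | a :: al', K :: Ks' => ord_lt a K /\ below al' Ks'
  | _, _ => False
  end.

Definition urel_within (R : Type) (Ks : seq ordnum) (n : nat) (S : urel R) : Prop :=
  forall al xs, S al xs -> below al Ks /\ size xs = n.

Definition lpred := forall R : pzRingType,
  (nat -> ordnum) -> (nat -> ordnum) -> (nat -> R) -> (nat -> urel R) -> Prop.

Definition typed (R : Type) c p (sp : 'I_p -> pvar_sort c) (U : nat -> urel R) (j : 'I_p) :
  pvar_rel R (sp j) := fun al xs => U j (codom al) (codom xs).
Arguments typed {R c p} sp U j.

Definition fits (R : Type) c (s : pvar_sort c) (C : nat -> ordnum) (S : urel R) :=
  forall al xs, S al xs -> exists (fa : 'I_(oarity s) -> ordnum) (fx : 'I_(rarity s) -> R),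
    [/\ al = codom fa, xs = codom fx & forall i, ord_lt (fa i) (C (ocards s i))].

(** A formula is required for all sorts [so] and [sp], which avoids renaming variables in the
    dependent syntax; its meaning is prescribed only on relations that fit their sorts. *)
Definition L2_definable c o r p (P : lpred) : Prop :=
  forall (so : 'I_o -> 'I_c) (sp : 'I_p -> pvar_sort c), exists q : L2_formula r so sp,
  forall (R : pzRingType) C O (x : nat -> R) (U : nat -> urel R), (forall j : 'I_p, fits (sp j) C (U j)) ->
    (L2_holds q (ordenv C c) (ordenv O o) (ordenv x r) (typed sp U) <-> P R C O x U).

Lemma codom_nth (T : Type) k (f : 'I_k -> T) x0 (i : 'I_k) : nth x0 (codom f) i = f i.
Proof. by rewrite (nth_map i) ?size_enum_ord // nth_ord_enum. Qed.

Lemma size_codom_ord (T : Type) k (f : 'I_k -> T) : size (codom f) = k.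
Proof. by rewrite size_map size_enum_ord. Qed.

Lemma codom_inj (T : Type) k (f g : 'I_k -> T) : codom f = codom g -> f = g.
Proof. by move=> e; apply: funext => i; rewrite -(codom_nth f (f i)) e codom_nth. Qed.

Lemma codom_of_nth (T : Type) k x0 (s : seq T) : size s = k ->
  s = codom (fun i : 'I_k => nth x0 s i).
Proof.
move=> e; apply: (@eq_from_nth _ x0); first by rewrite size_codom_ord.
by move=> i; rewrite e => lt; rewrite (codom_nth _ _ (Ordinal lt)).
Qed.

Lemma belowP x0 al Ks : below al Ks <->
  size al = size Ks /\ forall i, (i < size Ks)%N -> ord_lt (nth x0 al i) (nth x0 Ks i).
Proof.
elim: al Ks => [|a al IH] [|K Ks] /=; [by split|by split=> [|[]]|by split=> [|[]]|].
rewrite IH; split=> [[aK [-> h]]|[[e] h]].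
  by split=> [|[|i]] //; apply: (h i).
split; first exact: (h 0%N).
by split=> [|i i_lt]; [exact: e|exact: (h i.+1)].
Qed.

Section Definable2.
Variables (c o r p : nat).
Implicit Types (P Q : lpred).

Lemma L2_def_not P : L2_definable c o r p P ->
  L2_definable c o r p (fun R C O x U => ~ P R C O x U).
Proof.
move=> H so sp; have [q qP] := H so sp; exists (L2Not q) => R C O x U f /=.
by rewrite (qP _ _ _ _ _ f).
Qed.

Lemma L2_def_and P Q : L2_definable c o r p P -> L2_definable c o r p Q ->
  L2_definable c o r p (fun R C O x U => P R C O x U /\ Q R C O x U).
Proof.
move=> H K so sp; have [q qP] := H so sp; have [q' qP'] := K so sp.
by exists (L2And q q') => R C O x U f /=; rewrite (qP _ _ _ _ _ f) (qP' _ _ _ _ _ f).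
Qed.

Lemma L2_def_or P Q : L2_definable c o r p P -> L2_definable c o r p Q ->
  L2_definable c o r p (fun R C O x U => P R C O x U \/ Q R C O x U).
Proof.
move=> H K so sp; have [q qP] := H so sp; have [q' qP'] := K so sp.
by exists (L2Or q q') => R C O x U f /=; rewrite (qP _ _ _ _ _ f) (qP' _ _ _ _ _ f).
Qed.

Lemma L2_def_imp P Q : L2_definable c o r p P -> L2_definable c o r p Q ->
  L2_definable c o r p (fun R C O x U => P R C O x U -> Q R C O x U).
Proof.
move=> H K so sp; have [q qP] := H so sp; have [q' qP'] := K so sp.
by exists (L2Imp q q') => R C O x U f /=; rewrite (qP _ _ _ _ _ f) (qP' _ _ _ _ _ f).
Qed.

Lemma L2_def_iff P Q : L2_definable c o r p P -> L2_definable c o r p Q ->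
  L2_definable c o r p (fun R C O x U => P R C O x U <-> Q R C O x U).
Proof. by move=> dP dQ; apply: L2_def_and; apply: L2_def_imp. Qed.

Lemma L2_def_add i j k : (i < r)%N -> (j < r)%N -> (k < r)%N ->
  L2_definable c o r p (fun R C O x U => x i = x j + x k).
Proof.
by move=> hi hj hk so sp; exists (L2AddR _ _ (Ordinal hi) (Ordinal hj) (Ordinal hk)).
Qed.

Lemma L2_def_mul i j k : (i < r)%N -> (j < r)%N -> (k < r)%N ->
  L2_definable c o r p (fun R C O x U => x i = x j * x k).
Proof.
by move=> hi hj hk so sp; exists (L2MulR _ _ (Ordinal hi) (Ordinal hj) (Ordinal hk)).
Qed.

Lemma L2_def_eqC i j : (i < c)%N -> (j < c)%N ->
  L2_definable c o r p (fun R C O x U => C i = C j).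
Proof. by move=> hi hj so sp; exists (L2EqC _ _ _ (Ordinal hi) (Ordinal hj)). Qed.

Lemma L2_def_eqO i j : (i < o)%N -> (j < o)%N ->
  L2_definable c o r p (fun R C O x U => O i = O j).
Proof. by move=> hi hj so sp; exists (L2EqO _ _ _ (Ordinal hi) (Ordinal hj)). Qed.

(** Every atom needs a variable, so falsity is obtained by quantifying over the ring. *)
Lemma L2_def_false : L2_definable c o r p (fun R C O x U => False).
Proof.
move=> so sp; exists (L2Not (L2AllR (L2EqR _ _ ord0 ord0))) => R C O x U _ /=.
by split=> // h; apply: h.
Qed.

End Definable2.

Section Quantifiers2.
Variables (c o r p : nat).

Lemma L2_def_pushR_all (P : lpred) : L2_definable c o r.+1 p P ->
  L2_definable c o r p (fun R C O x U => forall y, P R C O (push y x) U).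
Proof.
move=> H so sp; have [q qP] := H so sp; exists (L2AllR q) => R C O x U f /=.
by split=> h y; move: (h y); rewrite env_cons_ordenv (qP _ _ _ _ _ f).
Qed.

Lemma L2_def_pushR_ex (P : lpred) : L2_definable c o r.+1 p P ->
  L2_definable c o r p (fun R C O x U => exists y, P R C O (push y x) U).
Proof.
move=> H so sp; have [q qP] := H so sp; exists (L2ExR q) => R C O x U f /=.
by split=> -[y h]; exists y; move: h; rewrite env_cons_ordenv (qP _ _ _ _ _ f).
Qed.

Lemma L2_def_pushC_all (P : lpred) : L2_definable c.+1 o r p P ->
  L2_definable c o r p (fun R C O x U => forall k, is_cardinal k -> P R (push k C) O x U).
Proof.
move=> H so sp; have [q qP] := H (fun i => lift ord0 (so i)) (fun j => shift_pvar_sort (sp j)).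
exists (L2AllC q) => R C O x U f /=; split=> h k kc;
  have fk : forall j, fits (shift_pvar_sort (sp j)) (push k C) (U j) by [].
  by apply/(qP _ _ _ _ _ fk); rewrite -env_cons_ordenv; apply: h.
by rewrite env_cons_ordenv; apply/(qP _ _ _ _ _ fk); apply: h.
Qed.

Lemma L2_def_pushO_all k (P : lpred) : (k < c)%N -> L2_definable c o.+1 r p P ->
  L2_definable c o r p (fun R C O x U => forall a, ord_lt a (C k) -> P R C (push a O) x U).
Proof.
move=> kc H so sp; have [q qP] := H (env_cons (Ordinal kc) so) sp.
exists (L2AllO (Ordinal kc) q) => R C O x U f /=.
by split=> h a ak; move: (h a ak); rewrite env_cons_ordenv (qP _ _ _ _ _ f).
Qed.

Lemma L2_def_pushO_ex k (P : lpred) : (k < c)%N -> L2_definable c o.+1 r p P ->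
  L2_definable c o r p (fun R C O x U => exists2 a, ord_lt a (C k) & P R C (push a O) x U).
Proof.
move=> kc H so sp; have [q qP] := H (env_cons (Ordinal kc) so) sp.
exists (L2ExO (Ordinal kc) q) => R C O x U f /=.
by split=> -[a ak h]; exists a => //; move: h; rewrite env_cons_ordenv (qP _ _ _ _ _ f).
Qed.

Definition list_sort (ks : seq nat) (n : nat) (H : all (fun k => k < c)%N ks) : pvar_sort c :=
  PVarSort (fun i : 'I_(size ks) => Ordinal (all_nthP 0%N H i (ltn_ord i))) n.

Lemma fits_list_sort (R : Type) ks n (H : all (fun k => k < c)%N ks) C (S : urel R) :
  fits (list_sort n H) C S <-> urel_within [seq C k | k <- ks] n S.
Proof.
split=> h al xs /h.
  move=> [fa [fx [-> -> lt]]]; rewrite size_codom_ord; split=> //.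
  apply/(belowP (C 0%N)); rewrite size_codom_ord size_map; split=> // i i_lt.
  rewrite (codom_nth _ _ (Ordinal i_lt)) (nth_map 0%N) //; exact: lt (Ordinal i_lt).
move=> [/(belowP (C 0%N))[e lt] en]; rewrite size_map in e lt; subst n.
have [x0 xs_x0] : exists x0 : 'I_(size xs) -> R, xs = codom x0.
  case: xs {h} => [|x xs]; last by exists (fun i => nth x (x :: xs) i); apply: codom_of_nth.
  by exists (@no_var R); apply/esym/size0nil; rewrite size_codom_ord.
exists (fun i => nth (C 0%N) al i), x0; split=> // [|i].
  exact: codom_of_nth.
by rewrite -(nth_map _ (C 0%N)) //; apply: lt.
Qed.

Definition untyped (R : Type) (s : pvar_sort c) (S : pvar_rel R s) : urel R :=
  fun al xs => exists fa fx, [/\ al = codom fa, xs = codom fx & S fa fx].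

Lemma typed_penv_cons (R : Type) (s : pvar_sort c) (sp : 'I_p -> pvar_sort c)
  (S : pvar_rel R s) (S' : urel R) U : (forall fa fx, S fa fx <-> S' (codom fa) (codom fx)) ->
  penv_cons S (typed sp U) = typed (env_cons s sp) (push S' U).
Proof.
move=> e; apply: functional_extensionality_dep => -[[|j] lt] //=.
by apply: funext => fa; apply: funext => fx; apply/propext.
Qed.

Lemma untypedE (R : Type) (s : pvar_sort c) (S : pvar_rel R s) fa fx :
  S fa fx <-> untyped S (codom fa) (codom fx).
Proof.
by split=> [h|[ga [gx [/codom_inj-> /codom_inj->]]]//]; exists fa, fx.
Qed.

Lemma fits_untyped (R : Type) (s : pvar_sort c) C (S : pvar_rel R s) :
  rel_within (fun i => ordenv C c (ocards s i)) S <-> fits s C (untyped S).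
Proof.
split=> [w al xs [fa [fx [-> -> h]]]|w fa fx /untypedE/w[ga [gx [/codom_inj-> _ h]]]//].
by exists fa, fx; split=> // i; apply: (w fa fx h).
Qed.

Lemma fits_push (R : Type) (s : pvar_sort c) (sp : 'I_p -> pvar_sort c) C (S : urel R)
    (U : nat -> urel R) :
  fits s C S -> (forall j : 'I_p, fits (sp j) C (U j)) ->
  forall j : 'I_p.+1, fits (env_cons s sp j) C (push S U j).
Proof. by move=> fS f [[|j] lt] //; apply: (f (Ordinal (lt : (j < p)%N))). Qed.

Lemma rel_within_typed (R : Type) (s : pvar_sort c) C (S : urel R) : fits s C S ->
  rel_within (fun i => ordenv C c (ocards s i))
    ((fun fa fx => S (codom fa) (codom fx)) : pvar_rel R s).
Proof. by move=> fS fa fx /fS[ga [gx [/codom_inj-> _]]]. Qed.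

Lemma L2_def_pushP_all ks n (P : lpred) : all (fun k => k < c)%N ks ->
  L2_definable c o r p.+1 P ->
  L2_definable c o r p (fun R C O x U =>
    forall S, urel_within [seq C k | k <- ks] n S -> P R C O x (push S U)).
Proof.
move=> H dP so sp; have [q qP] := dP so (env_cons (list_sort n H) sp).
exists (L2AllP (list_sort n H) q) => R C O x U f /=; split=> h S Sw.
  have {}Sw := (@fits_list_sort R ks n H C S).2 Sw.
  apply/(qP _ _ _ _ _ (fits_push Sw f)).
  rewrite -(@typed_penv_cons R (list_sort n H) sp
    (fun fa fx => S (codom fa) (codom fx)) S U (fun fa fx => iff_refl _)).
  by apply: h; exact: (@rel_within_typed R (list_sort n H)).
have Sf := (@fits_untyped R (list_sort n H) C S).1 Sw.
rewrite (@typed_penv_cons R (list_sort n H) sp S _ U (untypedE S)); apply/(qP _ _ _ _ _ (fits_push Sf f)).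
by apply: h; apply/fits_list_sort.
Qed.

End Quantifiers2.

Section HeadForms.
Variables (c o r p : nat).

Lemma L2_def_allR (P : forall R : pzRingType,
    (nat -> ordnum) -> (nat -> ordnum) -> (nat -> R) -> (nat -> urel R) -> R -> Prop) :
  L2_definable c o r.+1 p (fun R C O x U => P R C O (fun i => x i.+1) U (x 0%N)) ->
  L2_definable c o r p (fun R C O x U => forall y, P R C O x U y).
Proof. exact: L2_def_pushR_all. Qed.

Lemma L2_def_exR (P : forall R : pzRingType,
    (nat -> ordnum) -> (nat -> ordnum) -> (nat -> R) -> (nat -> urel R) -> R -> Prop) :
  L2_definable c o r.+1 p (fun R C O x U => P R C O (fun i => x i.+1) U (x 0%N)) ->
  L2_definable c o r p (fun R C O x U => exists y, P R C O x U y).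
Proof. exact: L2_def_pushR_ex. Qed.

Lemma L2_def_allO k (P : forall R : pzRingType,
    (nat -> ordnum) -> (nat -> ordnum) -> (nat -> R) -> (nat -> urel R) -> ordnum -> Prop) :
  (k < c)%N -> L2_definable c o.+1 r p (fun R C O x U => P R C (fun i => O i.+1) x U (O 0%N)) ->
  L2_definable c o r p (fun R C O x U => forall a, ord_lt a (C k) -> P R C O x U a).
Proof. exact: L2_def_pushO_all. Qed.

Lemma L2_def_exO k (P : forall R : pzRingType,
    (nat -> ordnum) -> (nat -> ordnum) -> (nat -> R) -> (nat -> urel R) -> ordnum -> Prop) :
  (k < c)%N -> L2_definable c o.+1 r p (fun R C O x U => P R C (fun i => O i.+1) x U (O 0%N)) ->
  L2_definable c o r p (fun R C O x U => exists2 a, ord_lt a (C k) & P R C O x U a).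
Proof. exact: L2_def_pushO_ex. Qed.
End HeadForms.

(* An atom whose ordinals are bounded by other cardinal variables than its     *)
(* sort requires is expressed with fresh ordinal variables of the right sort:  *)
(* d positions remain to be replaced.                                          *)
Lemma L2_app_any_sort d c o r p (so : 'I_o -> 'I_c) (sp : 'I_p -> pvar_sort c) (j : 'I_p)
    (al : 'I_(oarity (sp j)) -> 'I_o) (xs : 'I_(rarity (sp j)) -> 'I_r) :
  (forall i : 'I_(oarity (sp j)), (d <= i)%N -> so (al i) = ocards (sp j) i) ->
  exists q : L2_formula r so sp,
  forall (R : pzRingType) C O (x : nat -> R) (U : nat -> urel R),
    (forall j : 'I_p, fits (sp j) C (U j)) ->
    (L2_holds q (ordenv C c) (ordenv O o) (ordenv x r) (typed sp U) <->
     U j (codom (fun i => O (al i))) (codom (fun i => x (xs i)))).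
Proof.
elim: d o so al => [|d IH] o so al sorts.
  by exists (L2App j al xs (fun i => sorts i isT)).
case: (ltnP d (oarity (sp j))) => [d_lt|d_ge]; last first.
  by apply: IH => i d_le; have := leq_trans (ltn_ord i) d_ge; rewrite ltnNge d_le.
pose i0 := Ordinal d_lt; pose k := ocards (sp j) i0.
pose al' i : 'I_o.+1 := if i == i0 then ord0 else lift ord0 (al i).
have [|q qP] := IH o.+1 (env_cons k so) al'.
  move=> i d_le; rewrite /al'; case: eqP => [->//|/eqP ne]; rewrite env_consS.
  by apply: sorts; rewrite ltn_neqAle d_le andbT eq_sym.
exists (L2ExO k (L2And (@L2EqO c o.+1 r p _ _ ord0 (lift ord0 (al i0))) q)) => R C O x U f /=.
have key : codom (fun i => push (O (al i0)) O (al' i)) = codom (fun i => O (al i)).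
  by congr codom; apply: funext => i; rewrite /al'; case: eqP => [->|].
split=> [[a _ [ea]]|Uj].
  have {}ea : a = O (al i0) := ea.
  by rewrite env_cons_ordenv qP // ea key.
exists (O (al i0)); last by split; [|rewrite env_cons_ordenv qP // key].
by have [fa [fx [/codom_inj e _ lt]]] := f j _ _ Uj; move: (lt i0); rewrite -e.
Qed.

(** An application with the wrong numbers of arguments fails for every fitting relation and is
    rendered by a false formula. *)
Lemma L2_def_app c o r p j als xs : (j < p)%N -> all (fun i => i < o)%N als ->
  all (fun i => i < r)%N xs ->
  L2_definable c o r p (fun R C O x U => U j [seq O i | i <- als] [seq x i | i <- xs]).
Proof.
move=> j_lt alsP xsP so sp; pose j' := Ordinal j_lt.
case: (pselect (size als = oarity (sp j') /\ size xs = rarity (sp j'))) => [[ea ex]|ne];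
    last first.
  have [q qP] := @L2_def_false c o r p so sp.
  exists q => R C O x U f; rewrite qP //; split=> // /(f j')[fa [fx [e1 e2 _]]]; apply: ne.
  by split; rewrite -(size_codom_ord fa, size_codom_ord fx) -?e1 -?e2 size_map.
have alP (i : 'I_(oarity (sp j'))) : (nth 0%N als i < o)%N.
  by apply: (all_nthP 0%N alsP); rewrite ea.
have xP (i : 'I_(rarity (sp j'))) : (nth 0%N xs i < r)%N.
  by apply: (all_nthP 0%N xsP); rewrite ex.
have [|q qP] := @L2_app_any_sort (oarity (sp j')) c o r p so sp j'
    (fun i => Ordinal (alP i)) (fun i => Ordinal (xP i)).
  by move=> i; rewrite leqNgt ltn_ord.
exists q => R C O x U f; rewrite qP //=.
have -> : codom (fun i : 'I_(oarity (sp j')) => O (nth 0%N als i)) = [seq O i | i <- als].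
  rewrite [in RHS](codom_of_nth 0%N ea) -map_comp; exact: eq_map.
have -> // : codom (fun i : 'I_(rarity (sp j')) => x (nth 0%N xs i)) = [seq x i | i <- xs].
rewrite [in RHS](codom_of_nth 0%N ex) -map_comp; exact: eq_map.
Qed.

(** * Interpretation of the category in L2 *)

Notation "'all_below' k a .. b , p" :=
  (forall a, ord_lt a k -> .. (forall b, ord_lt b k -> p) ..)
  (at level 200, k at level 8, a binder, b binder, p at level 200).

Definition addition_laws (R : Type) (k : ordnum) (P : urel R) : Prop :=
  (all_below k a b, exists2 d, ord_lt d k & P [:: a; b; d] [::]) /\
  (all_below k a b d e, P [:: a; b; d] [::] -> P [:: a; b; e] [::] -> d = e) /\
  (all_below k a b d u v w, P [:: a; b; u] [::] -> P [:: u; d; w] [::] ->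
     P [:: b; d; v] [::] -> P [:: a; v; w] [::]) /\
  (all_below k a b d, P [:: a; b; d] [::] -> P [:: b; a; d] [::]) /\
  (exists2 z, ord_lt z k & (all_below k a, P [:: z; a; a] [::]) /\
     (all_below k a, exists2 b, ord_lt b k & P [:: b; a; z] [::])).

(** [L2] has no symbol for [1], so the unit law is stated for every left unit [u]; sums and products
    enter as premises to match the atoms of the language. *)
Definition scaling_laws (R : pzRingType) (k : ordnum) (P Q : urel R) : Prop :=
  (forall r, all_below k a, exists2 b, ord_lt b k & Q [:: a; b] [:: r]) /\
  (forall r, all_below k a b d, Q [:: a; b] [:: r] -> Q [:: a; d] [:: r] -> b = d) /\
  (forall r s t, t = r * s -> all_below k a b d,
     Q [:: a; b] [:: s] -> Q [:: b; d] [:: r] -> Q [:: a; d] [:: t]) /\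
  (forall u, (forall r, r = u * r) -> all_below k a, Q [:: a; a] [:: u]) /\
  (forall r, all_below k a b d a' b' d', P [:: a; b; d] [::] -> Q [:: a; a'] [:: r] ->
     Q [:: b; b'] [:: r] -> P [:: a'; b'; d'] [::] -> Q [:: d; d'] [:: r]) /\
  (forall r s t, t = r + s -> all_below k a b d e, Q [:: a; b] [:: r] ->
     Q [:: a; d] [:: s] -> P [:: b; d; e] [::] -> Q [:: a; e] [:: t]).

Definition graph_laws (R : Type) (k k' : ordnum) (P Q P' Q' F : urel R) : Prop :=
  (all_below k a, exists2 b, ord_lt b k' & F [:: a; b] [::]) /\
  (all_below k a, all_below k' b d, F [:: a; b] [::] -> F [:: a; d] [::] -> b = d) /\
  (all_below k a b d, all_below k' a' b' d', P [:: a; b; d] [::] -> F [:: a; a'] [::] ->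
     F [:: b; b'] [::] -> F [:: d; d'] [::] -> P' [:: a'; b'; d'] [::]) /\
  (forall r, all_below k a b, all_below k' a' b', Q [:: a; b] [:: r] -> F [:: a; a'] [::] ->
     F [:: b; b'] [::] -> Q' [:: a'; b'] [:: r]).

Section Laws.
Variable R : pzRingType.

Lemma code_addE k P Q (M : lmodType R) (j : M -> ordnum) : codes k P Q j ->
  forall x y z, P [:: j x; j y; j z] [::] <-> z = x + y.
Proof.
move=> c x y z; split=> [/(code_add c)[x' [y' [[]]]]|->].
  by move=> /(code_inj c)-> /(code_inj c)-> /(code_inj c).
by apply/(code_add c); exists x, y.
Qed.

Lemma code_scaleE k P Q (M : lmodType R) (j : M -> ordnum) : codes k P Q j ->
  forall x y r, Q [:: j x; j y] [:: r] <-> y = r *: x.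
Proof.
move=> c x y r; split=> [/(code_scale c)[x' [r' [[]]]]|->].
  by move=> /(code_inj c)-> /(code_inj c)-> [->].
by apply/(code_scale c); exists x, r.
Qed.

Lemma codes_laws k P Q (M : lmodType R) (j : M -> ordnum) : codes k P Q j ->
  addition_laws k P /\ scaling_laws k P Q.
Proof.
move=> c; have jk x : ord_lt (j x) k by apply/(code_im c); exists x.
have im a : ord_lt a k -> exists x, j x = a by move/(code_im c).
have addE := code_addE c; have scaleE := code_scaleE c.
split; [split; [|split; [|split; [|split]]]|split; [|split; [|split; [|split; [|split]]]]].
- by move=> _ /im[x <-] _ /im[y <-]; exists (j (x + y)) => //; apply/addE.
- by move=> _ /im[x <-] _ /im[y <-] _ /im[z <-] _ /im[t <-] /addE-> /addE->.
- move=> _ /im[x <-] _ /im[y <-] _ /im[z <-] _ /im[u <-] _ /im[v <-] _ /im[w <-].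
  by move=> /addE-> /addE-> /addE->; apply/addE; rewrite addrA.
- by move=> _ /im[x <-] _ /im[y <-] _ /im[z <-] /addE->; apply/addE; rewrite addrC.
- exists (j 0) => //; split=> _ /im[x <-]; first by apply/addE; rewrite add0r.
  by exists (j (- x)) => //; apply/addE; rewrite addNr.
- by move=> r _ /im[x <-]; exists (j (r *: x)) => //; apply/scaleE.
- by move=> r _ /im[x <-] _ /im[y <-] _ /im[z <-] /scaleE-> /scaleE->.
- move=> r s _ -> _ /im[x <-] _ /im[y <-] _ /im[z <-] /scaleE-> /scaleE->.
  by apply/scaleE; rewrite scalerA.
- move=> u /(_ 1); rewrite mulr1 => <- _ /im[x <-].
  by apply/scaleE; rewrite scale1r.
- move=> r _ /im[x <-] _ /im[y <-] _ /im[z <-] _ /im[x' <-] _ /im[y' <-] _ /im[z' <-].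
  by move=> /addE-> /scaleE-> /scaleE-> /addE->; apply/scaleE; rewrite scalerDr.
- move=> r s _ -> _ /im[x <-] _ /im[y <-] _ /im[z <-] _ /im[t <-].
  by move=> /scaleE-> /scaleE-> /addE->; apply/scaleE; rewrite scalerDl.
Qed.

(** By totality and functionality the relations become operations on a well-order of type [k], and
    the remaining laws become the module axioms. *)
Lemma laws_codes k (P Q : urel R) : urel_within [:: k; k; k] 0 P ->
  urel_within [:: k; k] 1 Q -> addition_laws k P -> scaling_laws k P Q ->
  exists (M : lmodType R) (j : M -> ordnum), codes k P Q j.
Proof.
have [w ->] := ord_rep k => Pw Qw.
pose j (x : wo_car w) := ot (seg x); have jI : injective j := @ot_seg_inj w.
have jk x : ord_lt (j x) (ot w) by apply/ord_lt_ot; exists x.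
have im a : ord_lt a (ot w) -> exists x, j x = a by move=> /ord_lt_ot[z ->]; exists z.
move=> [A1 [A2 [A3 [A4 [_ /im[z <-] [A5 A6]]]]]] [S1 [S2 [S3 [S4 [S5 S6]]]]].
have /choice[add addP] (x : wo_car w * wo_car w) : exists y, P [:: j x.1; j x.2; j y] [::].
  by have [_ /im[y <-] h] := A1 _ (jk x.1) _ (jk x.2); exists y.
have /choice[scale scaleP] (x : R * wo_car w) : exists y, Q [:: j x.2; j y] [:: x.1].
  by have [_ /im[y <-] h] := S1 x.1 _ (jk x.2); exists y.
have /choice[opp oppP] x : exists y, P [:: j y; j x; j z] [::].
  by have [_ /im[y <-] h] := A6 _ (jk x); exists y.
have addE x y t : P [:: j x; j y; j t] [::] <-> t = add (x, y).
  split=> [h|->]; last exact: addP (x, y).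
  by apply: jI; apply: (A2 _ (jk x) _ (jk y)) => //; apply: addP (x, y).
have scaleE r x y : Q [:: j x; j y] [:: r] <-> y = scale (r, x).
  split=> [h|->]; last exact: scaleP (r, x).
  by apply: jI; apply: (S2 r _ (jk x)) => //; apply: scaleP (r, x).
have addA : associative (fun x y => add (x, y)).
  move=> x y t; symmetry; apply/addE.
  by apply: (A3 _ (jk x) _ (jk y) _ (jk t) _ (jk (add (x, y)))); rewrite ?addE.
have addC : commutative (fun x y => add (x, y)).
  by move=> x y; apply/addE/A4; rewrite ?addE.
have add0 : left_id z (fun x y => add (x, y)) by move=> x; symmetry; apply/addE/A5.
have addN : left_inverse z opp (fun x y => add (x, y)) by move=> x; symmetry; apply/addE/oppP.
have scaleA a b v : scale (a, scale (b, v)) = scale (a * b, v).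
  by apply/scaleE; apply: (S3 a b _ erefl _ (jk v) _ (jk (scale (b, v)))); rewrite ?scaleE.
have scale1 : left_id 1 (fun r x => scale (r, x)).
  by move=> x; symmetry; apply/scaleE/S4 => // r; rewrite mul1r.
have scaleDr : right_distributive (fun r x => scale (r, x)) (fun x y => add (x, y)).
  move=> r x y; symmetry; apply/scaleE.
  by apply: (S5 r _ (jk x) _ (jk y) _ _ _ (jk (scale (r, x))) _ (jk (scale (r, y))));
    rewrite ?addE ?scaleE.
have scaleDl v a b : scale (a + b, v) = add (scale (a, v), scale (b, v)).
  symmetry; apply/scaleE.
  by apply: (S6 a b _ erefl _ (jk v) _ (jk (scale (a, v))) _ (jk (scale (b, v))));
    rewrite ?addE ?scaleE.
pose D := @ModData R (wo_car w) z opp _ _ addA addC add0 addN scaleA scale1 scaleDr scaleDl.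
exists (mkmod 0 D), j; split=> //.
- by move=> al; split=> [/im//|[x <-]].
- move=> al xs; split=> [h|[x [y [-> ->]]]]; last exact: (addP (x, y)).
  have [] := Pw _ _ h; case: al h => [|a [|b [|d [|? ?]]]] h; try by move=> /= *; intuition.
  move=> /= [/im[x ex] [/im[y ey] [/im[t et] _]]] /size0nil e0; subst.
  by exists x, y; split=> //; move/addE: h => ->.
- move=> al xs; split=> [h|[x [r [-> ->]]]]; last exact: (scaleP (r, x)).
  have [] := Qw _ _ h; case: al h => [|a [|b [|? ?]]] h; try by move=> /= *; intuition.
  move=> /= [/im[x ex] [/im[y ey] _]]; case: xs h => [|r [|? ?]] // h _; subst.
  by exists x, r; split=> //; move/scaleE: h => ->.
Qed.

Lemma graph_lawsP (X Y : kob R) (F : urel R) : 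
  urel_within [:: kcard X; kcard Y] 0 F ->
  graph_laws (kcard X) (kcard Y) (kadd X) (kscale X) (kadd Y) (kscale Y) F <->
  exists u, is_graph (X := X) (Y := Y) F u.
Proof.
move=> Fw; have cX := kptP X; have cY := kptP Y.
have jX x : ord_lt (kpt (X := X) x) (kcard X) by apply/(code_im cX); exists x.
have jY x : ord_lt (kpt (X := Y) x) (kcard Y) by apply/(code_im cY); exists x.
have imX a : ord_lt a (kcard X) -> exists x, kpt (X := X) x = a by move/(code_im cX).
have imY a : ord_lt a (kcard Y) -> exists x, kpt (X := Y) x = a by move/(code_im cY).
have addX := code_addE cX; have scaleX := code_scaleE cX.
have addY := code_addE cY; have scaleY := code_scaleE cY.
split=> [[F1 [F2 [F3 F4]]]|[u uP]]; last first.
  have FE x y : F [:: kpt x; kpt y] [::] <-> y = u x.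
    split=> [/uP[x' [[/kpt_inj-> /kpt_inj->]]]//|->]; apply/uP; by exists x.
  split; [|split; [|split]].
  - by move=> _ /imX[x <-]; exists (kpt (u x)) => //; apply/FE.
  - by move=> _ /imX[x <-] _ /imY[y <-] _ /imY[z <-] /FE-> /FE->.
  - move=> _ /imX[x <-] _ /imX[y <-] _ /imX[z <-] _ /imY[x' <-] _ /imY[y' <-] _ /imY[z' <-].
    by move=> /addX-> /FE-> /FE-> /FE->; apply/addY; rewrite linearD.
  - move=> r _ /imX[x <-] _ /imX[y <-] _ /imY[x' <-] _ /imY[y' <-].
    by move=> /scaleX-> /FE-> /FE->; apply/scaleY; rewrite linearZ.
have /choice[u uP] x : exists y, F [:: kpt (X := X) x; kpt (X := Y) y] [::].
  by have [_ /imY[y <-] h] := F1 _ (jX x); exists y.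
have FE x y : F [:: kpt x; kpt y] [::] <-> y = u x.
  by split=> [h|-> //]; apply: kpt_inj; apply: (F2 _ (jX x)).
have lin : linear u.
  move=> a x y; have /scaleY <- : kscale Y [:: kpt (u x); kpt (u (a *: x))] [:: a].
    by apply: (F4 a _ (jX x) _ (jX (a *: x))) => //; apply/scaleX.
  apply/addY.
  by apply: (F3 _ (jX (a *: x)) _ (jX y) _ (jX (a *: x + y))) => //; apply/addX.
pose uL := GRing.isLinear.Build R (kmod X) (kmod Y) _ u lin.
pose u' : {linear kmod X -> kmod Y} := HB.pack u uL.
exists u' => al rs; split=> [h|[x [-> ->]]]; last exact: uP.
have [] := Fw _ _ h; case: al h => [|a [|b [|? ?]]] h; try by move=> /= *; intuition.
move=> /= [/imX[x ex] [/imY[y ey] _]] /size0nil e0; subst.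
by exists x; split=> //; move/FE: h => ->.
Qed.
End Laws.

Section RelationAtoms.
Variables (c o r p : nat).

Lemma L2_def_app2 j a b : (j < p)%N -> (a < o)%N -> (b < o)%N ->
  L2_definable c o r p (fun R C O x U => U j [:: O a; O b] [::]).
Proof. by move=> hj ha hb; apply: (@L2_def_app _ _ _ _ j [:: a; b] [::]); rewrite //= ha hb. Qed.

Lemma L2_def_app3 j a b d : (j < p)%N -> (a < o)%N -> (b < o)%N -> (d < o)%N ->
  L2_definable c o r p (fun R C O x U => U j [:: O a; O b; O d] [::]).
Proof.
by move=> hj ha hb hd; apply: (@L2_def_app _ _ _ _ j [:: a; b; d] [::]); rewrite //= ha hb hd.
Qed.

Lemma L2_def_app21 j a b s : (j < p)%N -> (a < o)%N -> (b < o)%N -> (s < r)%N ->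
  L2_definable c o r p (fun R C O x U => U j [:: O a; O b] [:: x s]).
Proof.
by move=> hj ha hb hs; apply: (@L2_def_app _ _ _ _ j [:: a; b] [:: s]); rewrite //= ?ha ?hb ?hs.
Qed.
End RelationAtoms.

Ltac L2_def_step := first
  [ by [] | apply: L2_def_allO | apply: L2_def_exO | apply: L2_def_allR | apply: L2_def_exR
  | apply: L2_def_imp | apply: L2_def_iff | apply: L2_def_and
  | apply: L2_def_app3 | apply: L2_def_app21 | apply: L2_def_app2
  | apply: L2_def_eqO | apply: L2_def_eqC | apply: L2_def_add | apply: L2_def_mul ].

Section LawsDefinable.
Variables (c o r p : nat).

Lemma L2_def_addition_laws k i : (k < c)%N -> (i < p)%N ->
  L2_definable c o r p (fun R C O x U => addition_laws (C k) (U i)).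
Proof. by move=> kc ip; rewrite /addition_laws; repeat L2_def_step. Qed.

Lemma L2_def_scaling_laws k i j : (k < c)%N -> (i < p)%N -> (j < p)%N ->
  L2_definable c o r p (fun R C O x U => scaling_laws (C k) (U i) (U j)).
Proof. by move=> kc ip jp; rewrite /scaling_laws; repeat L2_def_step. Qed.

Lemma L2_def_graph_laws k i j k' i' j' f : (k < c)%N -> (i < p)%N -> (j < p)%N ->
  (k' < c)%N -> (i' < p)%N -> (j' < p)%N -> (f < p)%N ->
  L2_definable c o r p (fun R C O x U =>
    graph_laws (C k) (C k') (U i) (U j) (U i') (U j') (U f)).
Proof. by move=> kc ip jp kc' ip' jp' fp; rewrite /graph_laws; repeat L2_def_step. Qed.
End LawsDefinable.

Section CodesWithin.
Variable R : pzRingType.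

Lemma codes_within k (P Q : urel R) (M : lmodType R) (j : M -> ordnum) : codes k P Q j ->
  urel_within [:: k; k; k] 0 P /\ urel_within [:: k; k] 1 Q.
Proof.
move=> c; have jk x : ord_lt (j x) k by apply/(code_im c); exists x.
by split=> al xs; [move/(code_add c)|move/(code_scale c)] => -[x [y [-> ->]]].
Qed.

Lemma kob_within (X : kob R) :
  urel_within [:: kcard X; kcard X; kcard X] 0 (kadd X) /\
  urel_within [:: kcard X; kcard X] 1 (kscale X).
Proof. exact: codes_within (kptP X). Qed.

Lemma kgraph_within (f : kmor R) :
  urel_within [:: kcard (ksrc f); kcard (ktgt f)] 0 (kgraph f).
Proof.
move=> al xs /(kmapP f)[x [-> ->]]; split=> //=; split; first by apply/(code_im (kptP _)); exists x.
by split=> //; apply/(code_im (kptP _)); exists (kmap f x).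
Qed.

Lemma urel_eq3 (k : ordnum) (P Q : urel R) : urel_within [:: k; k; k] 0 P ->
  urel_within [:: k; k; k] 0 Q ->
  (all_below k a b d, P [:: a; b; d] [::] <-> Q [:: a; b; d] [::]) -> P = Q.
Proof.
move=> Pw Qw e; apply: urel_ext => al xs; split=> h.
  have [] := Pw _ _ h; case: al h => [|a [|b [|d [|? ?]]]] h; try by move=> /= *; intuition.
  by move=> /= [ha [hb [hd _]]] /size0nil e0; subst; apply/e.
have [] := Qw _ _ h; case: al h => [|a [|b [|d [|? ?]]]] h; try by move=> /= *; intuition.
by move=> /= [ha [hb [hd _]]] /size0nil e0; subst; apply/e.
Qed.

Lemma urel_eq21 (k : ordnum) (P Q : urel R) : urel_within [:: k; k] 1 P ->
  urel_within [:: k; k] 1 Q ->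
  (forall r, all_below k a b, P [:: a; b] [:: r] <-> Q [:: a; b] [:: r]) -> P = Q.
Proof.
move=> Pw Qw e; apply: urel_ext => al xs; split=> h.
  have [] := Pw _ _ h; case: al h => [|a [|b [|? ?]]] h; try by move=> /= *; intuition.
  by move=> /= [ha [hb _]]; case: xs h => [|s [|? ?]] // h _; apply/e.
have [] := Qw _ _ h; case: al h => [|a [|b [|? ?]]] h; try by move=> /= *; intuition.
by move=> /= [ha [hb _]]; case: xs h => [|s [|? ?]] // h _; apply/e.
Qed.

Lemma urel_eq2 (k l : ordnum) (P Q : urel R) : urel_within [:: k; l] 0 P ->
  urel_within [:: k; l] 0 Q ->
  (all_below k a, all_below l b, P [:: a; b] [::] <-> Q [:: a; b] [::]) -> P = Q.
Proof.
move=> Pw Qw e; apply: urel_ext => al xs; split=> h.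
  have [] := Pw _ _ h; case: al h => [|a [|b [|? ?]]] h; try by move=> /= *; intuition.
  by move=> /= [ha [hb _]] /size0nil e0; subst; apply/e.
have [] := Qw _ _ h; case: al h => [|a [|b [|? ?]]] h; try by move=> /= *; intuition.
by move=> /= [ha [hb _]] /size0nil e0; subst; apply/e.
Qed.
End CodesWithin.

(* The object at position t has its cardinals at t.1.+1 and t.1 and its        *)
(* relations at t.2.+1 and t.2; a morphism position consists of the positions  *)
(* of its source, its target and its graph.                                    *)
Definition ob_pos := (nat * nat)%type.
Definition mor_pos := (ob_pos * ob_pos * nat)%type.

Section Positions.
Variables (R : pzRingType) (C : nat -> ordnum) (U : nat -> urel R).

Definition at_ob (t : ob_pos) (X : kob R) : Prop :=
  [/\ kcard X = C t.1.+1, ktag X = C t.1, kadd X = U t.2.+1 & kscale X = U t.2].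

Definition at_mor (s : mor_pos) (f : kmor R) : Prop :=
  [/\ at_ob s.1.1 (ksrc f), at_ob s.1.2 (ktgt f) & kgraph f = U s.2].

(** Comparing relations below the cardinal is enough, since those of an object live there
    ([kob_within]). *)
Definition same_ob (t t' : ob_pos) : Prop :=
  C t.1.+1 = C t'.1.+1 /\ C t.1 = C t'.1 /\
  (all_below (C t.1.+1) a b d,
     U t.2.+1 [:: a; b; d] [::] <-> U t'.2.+1 [:: a; b; d] [::]) /\
  (forall r, all_below (C t.1.+1) a b, U t.2 [:: a; b] [:: r] <-> U t'.2 [:: a; b] [:: r]).

Definition same_mor (s s' : mor_pos) : Prop :=
  same_ob s.1.1 s'.1.1 /\ same_ob s.1.2 s'.1.2 /\
  (all_below (C s.1.1.1.+1) a, all_below (C s.1.2.1.+1) b,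
     U s.2 [:: a; b] [::] <-> U s'.2 [:: a; b] [::]).

Definition comp_at (h f g : mor_pos) : Prop :=
  same_ob g.1.2 f.1.1 /\ same_ob h.1.1 g.1.1 /\ same_ob h.1.2 f.1.2 /\
  (all_below (C h.1.1.1.+1) a, all_below (C h.1.2.1.+1) d, U h.2 [:: a; d] [::] <->
     exists2 b, ord_lt b (C f.1.1.1.+1) & U g.2 [:: a; b] [::] /\ U f.2 [:: b; d] [::]).

Definition id_at (f : mor_pos) (t : ob_pos) : Prop :=
  same_ob f.1.1 t /\ same_ob f.1.2 t /\
  (all_below (C t.1.+1) a b, U f.2 [:: a; b] [::] <-> a = b).

Lemma same_obP t t' X Y : at_ob t X -> at_ob t' Y -> (same_ob t t' <-> X = Y).
Proof.
move=> [k1 l1 P1 Q1] [k2 l2 P2 Q2]; rewrite /same_ob -k1 -k2 -l1 -l2 -P1 -P2 -Q1 -Q2.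
have [PX QX] := kob_within X; have [PY QY] := kob_within Y.
split=> [[ek [el [eP eQ]]]|<-//]; rewrite -ek in PY QY.
by apply: kob_ext => //; [apply: (urel_eq3 PX PY)|apply: (urel_eq21 QX QY)].
Qed.

Lemma same_morP s s' f g : at_mor s f -> at_mor s' g -> (same_mor s s' <-> f = g).
Proof.
move=> [X1 Y1 F1] [X2 Y2 F2]; have [k1 _ _ _] := X1; have [k2 _ _ _] := Y1.
rewrite /same_mor (same_obP X1 X2) (same_obP Y1 Y2) -k1 -k2 -F1 -F2.
split=> [[eX [eY eF]]|<-//]; apply: kmor_ext => //.
have := @kgraph_within R g; rewrite -eX -eY => gw.
exact: (urel_eq2 (@kgraph_within R f) gw).
Qed.

Lemma comp_atP sh sf sg h f g : at_mor sh h -> at_mor sf f -> at_mor sg g ->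
  (comp_at sh sf sg <-> k_isComp h f g).
Proof.
move=> [Xh Yh Fh] [Xf Yf Ff] [Xg Yg Fg].
have [k1 _ _ _] := Xh; have [k2 _ _ _] := Yh; have [k3 _ _ _] := Xf.
rewrite /comp_at (same_obP Yg Xf) (same_obP Xh Xg) (same_obP Yh Yf) -k1 -k2 -k3 -Fh -Ff -Fg.
split=> [[e1 [e2 [e3 e]]]|[e1 e2 e3 e]]; split=> //; last first.
  split=> //; split=> // a _ d _; rewrite e.
  split=> [[b [gab fbd]]|[b _ []]]; last by exists b.
  by exists b => //; have [[]] := kgraph_within fbd.
move=> a d; split=> [had|[b [gab fbd]]].
  have [[ha [hd _]] _] := kgraph_within had.
  by have /(e a ha d hd)[b _ []] := had; exists b.
have [[ha _] _] := kgraph_within gab; have [[hb [hd _]] _] := kgraph_within fbd.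
by apply/e; rewrite ?e2 ?e3 //; exists b.
Qed.

Lemma id_atP s t f X : at_mor s f -> at_ob t X -> (id_at s t <-> k_isId f X).
Proof.
move=> [Xf Yf Ff] Xt; have [k1 _ _ _] := Xt.
rewrite /id_at (same_obP Xf Xt) (same_obP Yf Xt) -k1 -Ff.
split=> [[e1 [e2 e]]|[e1 e2 e]]; split=> //; last first.
  by split=> // a ha b _; rewrite e; split=> [[]|].
move=> a b; split=> [fab|[ha <-]]; last exact/e.
have [[]] := kgraph_within fab; rewrite e1 e2 => ha [hb _] _.
by split=> //; apply/e.
Qed.
End Positions.

Definition ob_ok (c p : nat) (t : ob_pos) : bool := (t.1.+1 < c)%N && (t.2.+1 < p)%N.
Definition mor_ok (c p : nat) (s : mor_pos) : bool :=
  [&& ob_ok c p s.1.1, ob_ok c p s.1.2 & (s.2 < p)%N].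

Lemma ob_okE c p t : ob_ok c p t ->
  [/\ (t.1.+1 < c)%N, (t.1 < c)%N, (t.2.+1 < p)%N & (t.2 < p)%N].
Proof. by move=> /andP[h1 h2]; split=> //; apply: ltnW. Qed.

Section AtomsDefinable.
Variables (c o r p : nat).

Lemma L2_def_same_ob t t' : ob_ok c p t -> ob_ok c p t' ->
  L2_definable c o r p (fun R C O x U => same_ob C U t t').
Proof.
move=> /ob_okE[h1 h2 h3 h4] /ob_okE[h1' h2' h3' h4'].
by rewrite /same_ob; repeat L2_def_step.
Qed.

Lemma L2_def_same_mor s s' : mor_ok c p s -> mor_ok c p s' ->
  L2_definable c o r p (fun R C O x U => same_mor C U s s').
Proof.
move=> /and3P[ok1 ok2 ok3] /and3P[ok1' ok2' ok3'].
have [h1 _ _ _] := ob_okE ok1; have [h2 _ _ _] := ob_okE ok2.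
by rewrite /same_mor; repeat (apply: L2_def_same_ob || L2_def_step).
Qed.

Lemma L2_def_comp_at h f g : mor_ok c p h -> mor_ok c p f -> mor_ok c p g ->
  L2_definable c o r p (fun R C O x U => comp_at C U h f g).
Proof.
move=> /and3P[okh1 okh2 okh3] /and3P[okf1 okf2 okf3] /and3P[okg1 okg2 okg3].
have [h1 _ _ _] := ob_okE okh1; have [h2 _ _ _] := ob_okE okh2.
have [h3 _ _ _] := ob_okE okf1.
by rewrite /comp_at; repeat (apply: L2_def_same_ob || L2_def_step).
Qed.

Lemma L2_def_id_at f t : mor_ok c p f -> ob_ok c p t ->
  L2_definable c o r p (fun R C O x U => id_at C U f t).
Proof.
move=> /and3P[ok1 ok2 ok3] okt; have [h1 _ _ _] := ob_okE okt.
by rewrite /id_at; repeat (apply: L2_def_same_ob || L2_def_step).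
Qed.
End AtomsDefinable.

Section BlockQuantifiers.
Variables (o r : nat).

(** The tag is pushed after the cardinal and the scaling after the addition, which puts the new
    object at position [(0, 0)]. *)
Definition all_obs (P : lpred) : lpred := fun R C O x U =>
  forall k, is_cardinal k -> forall l, is_cardinal l ->
  forall A, urel_within [:: k; k; k] 0 A -> forall S, urel_within [:: k; k] 1 S ->
  addition_laws k A /\ scaling_laws k A S ->
  P R (push l (push k C)) O x (push S (push A U)).

Lemma L2_def_all_obs c p P : L2_definable c.+2 o r p.+2 P ->
  L2_definable c o r p (all_obs P).
Proof.
move=> dP; apply: (@L2_def_pushC_all c o r p (fun R C O x U =>
  forall l, is_cardinal l ->
  forall A, urel_within [:: C 0%N; C 0%N; C 0%N] 0 A ->
  forall S, urel_within [:: C 0%N; C 0%N] 1 S ->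
  addition_laws (C 0%N) A /\ scaling_laws (C 0%N) A S ->
  P R (push l C) O x (push S (push A U)))).
apply: (@L2_def_pushC_all c.+1 o r p (fun R C O x U =>
  forall A, urel_within [:: C 1%N; C 1%N; C 1%N] 0 A ->
  forall S, urel_within [:: C 1%N; C 1%N] 1 S ->
  addition_laws (C 1%N) A /\ scaling_laws (C 1%N) A S -> P R C O x (push S (push A U)))).
apply: (@L2_def_pushP_all c.+2 o r p [:: 1; 1; 1]%N 0 (fun R C O x U =>
  forall S, urel_within [:: C 1%N; C 1%N] 1 S ->
  addition_laws (C 1%N) (U 0%N) /\ scaling_laws (C 1%N) (U 0%N) S ->
  P R C O x (push S U))) => //.
apply: (@L2_def_pushP_all c.+2 o r p.+1 [:: 1; 1]%N 1 (fun R C O x U =>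
  addition_laws (C 1%N) (U 1%N) /\ scaling_laws (C 1%N) (U 1%N) (U 0%N) ->
  P R C O x U)) => //.
apply: L2_def_imp => //; apply: L2_def_and.
  exact: L2_def_addition_laws.
exact: L2_def_scaling_laws.
Qed.

Lemma all_obsP (P : lpred) (R : pzRingType) C O (x : nat -> R) U : @all_obs P R C O x U <-> forall X : kob R,
  P R (push (ktag X) (push (kcard X) C)) O x (push (kscale X) (push (kadd X) U)).
Proof.
split=> [h X|h k kc l lc A Aw S Sw [A_laws S_laws]].
  have [Aw Sw] := kob_within X; have [kc lc _] := kvalid X.
  by apply: h => //; exact: (codes_laws (kptP X)).
have v := laws_codes Aw Sw A_laws S_laws.
exact: (h (KOb (And3 kc lc v))).
Qed.

(** The target is pushed after the source, so their cardinals are at 1 and 3. The graph comes last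
    and shifts the relations only, whence the position [((2, 3), (0, 1), 0)] of the new morphism. *)
Definition all_mors (P : lpred) : lpred := all_obs (all_obs (fun R C O x U =>
  forall F, urel_within [:: C 3; C 1%N] 0 F ->
  graph_laws (C 3) (C 1%N) (U 3) (U 2) (U 1%N) (U 0%N) F -> P R C O x (push F U))).

Lemma L2_def_all_mors c p P : L2_definable c.+4 o r p.+4.+1 P ->
  L2_definable c o r p (all_mors P).
Proof.
move=> dP; do 2!apply: L2_def_all_obs.
apply: (@L2_def_pushP_all c.+4 o r p.+4 [:: 3; 1]%N 0 (fun R C O x U =>
  graph_laws (C 3) (C 1%N) (U 4) (U 3) (U 2) (U 1%N) (U 0%N) -> P R C O x U)) => //.
by apply: L2_def_imp => //; apply: L2_def_graph_laws.
Qed.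

Lemma all_morsP (P : lpred) (R : pzRingType) C O (x : nat -> R) U : @all_mors P R C O x U <-> forall f : kmor R,
  P R (push (ktag (ktgt f)) (push (kcard (ktgt f))
        (push (ktag (ksrc f)) (push (kcard (ksrc f)) C)))) O x
      (push (kgraph f) (push (kscale (ktgt f)) (push (kadd (ktgt f))
        (push (kscale (ksrc f)) (push (kadd (ksrc f)) U))))).
Proof.
rewrite /all_mors all_obsP; split=> [h f|h X].
  have /all_obsP/(_ (ktgt f)) hf := h (ksrc f).
  apply: hf; first exact: kgraph_within.
  by apply/graph_lawsP; [exact: kgraph_within|exact: kgraphP].
apply/all_obsP => Y F Fw /(graph_lawsP Fw) FP.
exact: (h (KMor FP)).
Qed.
End BlockQuantifiers.

(** * Translation of categorical sentences and the second direction *)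

Definition shift_ob (a b : nat) (t : ob_pos) : ob_pos := (a + t.1, b + t.2)%N.
Definition shift_mor (a b : nat) (s : mor_pos) : mor_pos :=
  (shift_ob a b s.1.1, shift_ob a b s.1.2, b + s.2)%N.

Lemma cat_interpret n m (phi : cat_formula n m) : forall c p xo xm,
  (forall i : 'I_n, ob_ok c p (xo i)) -> (forall i : 'I_m, mor_ok c p (xm i)) ->
  exists P, L2_definable c 0 0 p P /\
  forall (R : pzRingType) C O x (U : nat -> urel R) eo em,
    (forall i, at_ob C U (xo i) (eo i)) -> (forall i, at_mor C U (xm i) (em i)) ->
    (P R C O x U <-> @cat_holds (kcat R) n m phi eo em).
Proof.
elim: n m / phi => n m.
- move=> X Y c p xo xm oko okm; exists (fun R C O x U => same_ob C U (xo X) (xo Y)).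
  split; first exact: L2_def_same_ob.
  by move=> R C O x U eo em So Sm; apply: same_obP.
- move=> f g c p xo xm oko okm; exists (fun R C O x U => same_mor C U (xm f) (xm g)).
  split; first exact: L2_def_same_mor.
  by move=> R C O x U eo em So Sm; apply: same_morP.
- move=> f X Y c p xo xm oko okm.
  exists (fun R C O x U => same_ob C U (xm f).1.1 (xo X) /\ same_ob C U (xm f).1.2 (xo Y)).
  split.
    by have /and3P[ok1 ok2 _] := okm f; apply: L2_def_and; apply: L2_def_same_ob.
  move=> R C O x U eo em So Sm; have [Sf1 Sf2 _] := Sm f.
  by rewrite (same_obP Sf1 (So X)) (same_obP Sf2 (So Y)).
- move=> h f g c p xo xm oko okm.
  exists (fun R C O x U => comp_at C U (xm h) (xm f) (xm g)).
  split; first exact: L2_def_comp_at.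
  by move=> R C O x U eo em So Sm; apply: comp_atP.
- move=> f X c p xo xm oko okm; exists (fun R C O x U => id_at C U (xm f) (xo X)).
  split; first exact: L2_def_id_at.
  by move=> R C O x U eo em So Sm; apply: id_atP.
- move=> phi IH c p xo xm oko okm; have [P [dP PP]] := IH _ _ _ _ oko okm.
  exists (fun R C O x U => ~ P R C O x U); split; first exact: L2_def_not.
  by move=> R C O x U eo em So Sm /=; rewrite (PP _ _ _ _ _ _ _ So Sm).
- move=> phi IH psi IH' c p xo xm oko okm; have [P [dP PP]] := IH _ _ _ _ oko okm.
  have [Q [dQ QQ]] := IH' _ _ _ _ oko okm.
  exists (fun R C O x U => P R C O x U /\ Q R C O x U); split; first exact: L2_def_and.
  by move=> R C O x U eo em So Sm /=; rewrite (PP _ _ _ _ _ _ _ So Sm) (QQ _ _ _ _ _ _ _ So Sm).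
- move=> phi IH psi IH' c p xo xm oko okm; have [P [dP PP]] := IH _ _ _ _ oko okm.
  have [Q [dQ QQ]] := IH' _ _ _ _ oko okm.
  exists (fun R C O x U => P R C O x U \/ Q R C O x U); split; first exact: L2_def_or.
  by move=> R C O x U eo em So Sm /=; rewrite (PP _ _ _ _ _ _ _ So Sm) (QQ _ _ _ _ _ _ _ So Sm).
- move=> phi IH psi IH' c p xo xm oko okm; have [P [dP PP]] := IH _ _ _ _ oko okm.
  have [Q [dQ QQ]] := IH' _ _ _ _ oko okm.
  exists (fun R C O x U => P R C O x U -> Q R C O x U); split; first exact: L2_def_imp.
  by move=> R C O x U eo em So Sm /=; rewrite (PP _ _ _ _ _ _ _ So Sm) (QQ _ _ _ _ _ _ _ So Sm).
- move=> phi IH c p xo xm oko okm.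
  have [||P [dP PP]] := IH c.+2 p.+2 (env_cons (0, 0)%N (fun i => shift_ob 2 2 (xo i)))
    (fun i => shift_mor 2 2 (xm i)).
  + by move=> [[|i] lt] //; apply: (oko (Ordinal (lt : (i < n)%N))).
  + exact: okm.
  exists (all_obs P); split; first exact: L2_def_all_obs.
  move=> R C O x U eo em So Sm /=; apply: iff_trans (all_obsP _ _ _ _ _) _.
  have key (X : kob R) : P R (push (ktag X) (push (kcard X) C)) O x
      (push (kscale X) (push (kadd X) U)) <-> @cat_holds (kcat R) _ _ phi (env_cons X eo) em.
    apply: PP; last exact: Sm.
    by move=> [[|i] lt] //; apply: (So (Ordinal (lt : (i < n)%N))).
  by split=> h X; apply/key.
- move=> phi IH c p xo xm oko okm.
  have [||P [dP PP]] := IH c.+2 p.+2 (env_cons (0, 0)%N (fun i => shift_ob 2 2 (xo i)))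
    (fun i => shift_mor 2 2 (xm i)).
  + by move=> [[|i] lt] //; apply: (oko (Ordinal (lt : (i < n)%N))).
  + exact: okm.
  (* Existence of an object is expressed as the dual of the universal block quantifier. *)
  exists (fun R C O x U => ~ @all_obs (fun R C O x U => ~ P R C O x U) R C O x U).
  split; first by apply/L2_def_not/L2_def_all_obs/L2_def_not.
  move=> R C O x U eo em So Sm /=.
  have key (X : kob R) : P R (push (ktag X) (push (kcard X) C)) O x
      (push (kscale X) (push (kadd X) U)) <-> @cat_holds (kcat R) _ _ phi (env_cons X eo) em.
    apply: PP; last exact: Sm.
    by move=> [[|i] lt] //; apply: (So (Ordinal (lt : (i < n)%N))).
  split=> [h|[X /key h] /all_obsP/(_ X)//].
  by apply: contrapT => nex; apply/h/all_obsP => X /key hX; apply: nex; exists X.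
- move=> phi IH c p xo xm oko okm.
  have [||P [dP PP]] := IH c.+4 p.+4.+1 (fun i => shift_ob 4 5 (xo i))
    (env_cons ((2, 3), (0, 1), 0)%N (fun i => shift_mor 4 5 (xm i))).
  + exact: oko.
  + by move=> [[|i] lt] //; apply: (okm (Ordinal (lt : (i < m)%N))).
  exists (all_mors P); split; first exact: L2_def_all_mors.
  move=> R C O x U eo em So Sm /=; apply: iff_trans (all_morsP _ _ _ _ _) _.
  have key (f : kmor R) : P R (push (ktag (ktgt f)) (push (kcard (ktgt f))
        (push (ktag (ksrc f)) (push (kcard (ksrc f)) C)))) O x
      (push (kgraph f) (push (kscale (ktgt f)) (push (kadd (ktgt f))
        (push (kscale (ksrc f)) (push (kadd (ksrc f)) U))))) <->
      @cat_holds (kcat R) _ _ phi eo (env_cons f em).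
    apply: PP; first exact: So.
    by move=> [[|i] lt] //; apply: (Sm (Ordinal (lt : (i < m)%N))).
  by split=> h f; apply/key.
- move=> phi IH c p xo xm oko okm.
  have [||P [dP PP]] := IH c.+4 p.+4.+1 (fun i => shift_ob 4 5 (xo i))
    (env_cons ((2, 3), (0, 1), 0)%N (fun i => shift_mor 4 5 (xm i))).
  + exact: oko.
  + by move=> [[|i] lt] //; apply: (okm (Ordinal (lt : (i < m)%N))).
  exists (fun R C O x U => ~ @all_mors (fun R C O x U => ~ P R C O x U) R C O x U).
  split; first by apply/L2_def_not/L2_def_all_mors/L2_def_not.
  move=> R C O x U eo em So Sm /=.
  have key (f : kmor R) : P R (push (ktag (ktgt f)) (push (kcard (ktgt f))
        (push (ktag (ksrc f)) (push (kcard (ksrc f)) C)))) O x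
      (push (kgraph f) (push (kscale (ktgt f)) (push (kadd (ktgt f))
        (push (kscale (ksrc f)) (push (kadd (ksrc f)) U))))) <->
      @cat_holds (kcat R) _ _ phi eo (env_cons f em).
    apply: PP; first exact: So.
    by move=> [[|i] lt] //; apply: (Sm (Ordinal (lt : (i < m)%N))).
  split=> [h|[f /key h] /all_morsP/(_ f)//].
  by apply: contrapT => nex; apply/h/all_morsP => f /key hf; apply: nex; exists f.
Qed.

Lemma cat_sentence_L2 (phi : cat_formula 0 0) : exists q : L2_sentence,
  forall R, L2_true R q <-> cat_true (kcat R) phi.
Proof.
have [||P [dP PP]] := @cat_interpret 0 0 phi 0%N 0%N (@no_var _) (@no_var _); try by case.
have [q qP] := dP (@no_var 'I_0) (@no_var (pvar_sort 0)).
have [w _] := cardinal_exists False; exists q => R.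
(* The sentence has no free variable, so any environment will do. *)
pose C (_ : nat) := ot w; pose x (_ : nat) : R := 0.
pose U (_ : nat) : urel R := fun _ _ => False.
apply: (iff_trans _ (PP R C C x U (@no_var _) (@no_var _) _ _)); try by case.
apply: (iff_trans _ (qP R C C x U _)); last by case.
rewrite /L2_true (no_var_unique (ordenv C 0)) (no_var_unique (ordenv x 0)).
have -> // : typed (@no_var (pvar_sort 0)) U =
    (fun j : 'I_0 => match notF (ltn_ord j) with end).
by apply: functional_extensionality_dep => -[].
Qed.

Theorem L2_to_cat (R S : pzRingType) : L2_equivalent R S ->
  elementarily_equivalent (mod_cat R) (mod_cat S).
Proof.
move=> RS phi; have [q qP] := cat_sentence_L2 phi.
by rewrite !(kcat_equivalent _ phi) -!qP.
Qed.

Theorem corollary4 (R1 R2 : pzRingType) :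
  is_integral_domain R1 -> is_integral_domain R2 ->
  elementarily_equivalent (mod_cat R1) (mod_cat R2) <-> L2_equivalent R1 R2.
Proof. by move=> R1dom R2dom; split; [apply: cat_to_L2|apply: L2_to_cat]. Qed.
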